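(* Let $M$ be a matroid of rank $k+1$ on the ground set $E=\{0,\dots,n\}$. Suppose $i\in E$ is neither a loop nor a coloop of $M$. Then in every chart $U_j=\{x\in\mathbb{TP}^n\mid x_j\neq-\infty\}=\mathbb{T}^n\subset\mathbb{TP}^n$ (with $j\neq i$) there is an elementary tropical modification $$\delta_j:B(M)\cap U_j\longrightarrow B(M\setminus i)\cap U_j$$ with corresponding divisor $B(M/i)\cap U_j$.
   Context: **Matroids.** A matroid is written $M=(E,r)$ with $E$ the ground set and $r$ the rank function. The deletion $M\setminus i$ is $(E\setminus i,r|_{E\setminus i})$; the restriction $M/i$ is $(E\setminus i,r')$ with $r'(I)=r(I\cup i)-r(i)$. A basis is a subset $B\subseteq E$ with $|B|=r(B)=r(E)$. A loop is an element contained in no basis, a coloop an element contained in every basis. A flat is a subset $F\subseteq E$ with $r(F)<r(F\cup i)$ for all $i\in E\setminus F$ (so $E$ is a flat). **Tropical spaces.** $\mathbb{T}=\mathbb{R}\cup\{-\infty\}$. $\mathbb{TP}^n=(\mathbb{T}^{n+1}\setminus\{(-\infty,\dots,-\infty)\})/\big(x\sim(x_0+\lambda,\dots,x_n+\lambda)\big)$, $\lambda\in\mathbb{R}$, with homogeneous coordinates $[x_0:\dots:x_n]$; $U_j\cong\mathbb{T}^n$ by normalizing $x_j=0$. For the matroids $M\setminus i$ and $M/i$ on $E\setminus i$ one uses $\mathbb{TP}^{n-1}$ with homogeneous coordinates indexed by $E\setminus i$ and its chart $U_j\cong\mathbb{T}^{n-1}$. **Bergman fans.** Let $M$ be loopless.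 Identify $\mathbb{R}^n$ with the points of $\mathbb{TP}^n$ all of whose coordinates are finite, normalized by $x_0=0$. Put $v_l=-e_l$ for $1\le l\le n$, $v_0=\sum_{l=1}^n e_l$ and $v_F=\sum_{l\in F}v_l$. Then $B(M)$ is the closure in $\mathbb{TP}^n$ of the union of the cones spanned by $v_{F_1},\dots,v_{F_s}$ over all chains $\emptyset\neq F_1\subsetneq\dots\subsetneq F_s\neq E$ of flats of $M$. If $M$ has set of loops $I$, then $B(M)$ is contained in the boundary stratum $\{x_l=-\infty,\ l\in I\}\cong\mathbb{TP}^{n-|I|}$ and equals $B(M\setminus I)$ there. All facets have weight $1$. **Cycles in $\mathbb{T}^n$.** A $k$-cycle in $\mathbb{R}^m$ is a finite pure $k$-dimensional rational polyhedral complex with integer facet weights satisfying the balancing condition: at each codimension one face $E$ with adjacent facets $F_1,\dots,F_s$ and primitive integer vectors $v_l$ pointing from $E$ into $F_l$ and generating its lattice together with that of $E$, $\sum_l w_{F_l}v_l$ is parallel to $E$. Put $H_i=\{x_i=-\infty\}\subset\mathbb{T}^n$, $H_I=\bigcap_{i\in I}H_i\cong\mathbb{T}^{n-|I|}$, and let $H_I^\times\cong\mathbb{R}^{n-|I|}$ be the set of points whose $-\infty$ coordinates are exactly those in $I$. A $k$-cycle of sedentarity $I$ is the closure in $\mathbb{T}^n$ of a $k$-cycle in $H_I^\times$; cycles in $\mathbb{T}^n$ are sums of these. A cycle is effective if its weights are positive. *Intersection with $H_i$.* For a $k$-cycle $A\subset\mathbb{T}^m$ of sedentarity $\emptyset$,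 $A.H_i$ is supported on the $(k-1)$-skeleton $(A\cap H_i)^{(k-1)}$; a facet $F$ of it, adjacent to the facets $\tilde F_1,\dots,\tilde F_s$ of $A$, has weight $$w_{A.H_i}(F)=\sum_{l=1}^s w_A(\tilde F_l)\,[\mathbb{Z}^m:\Lambda_{\tilde F_l}+\Lambda_i^\perp],$$ where $\Lambda_{\tilde F_l}$ is the lattice of integer vectors parallel to $\tilde F_l$ and $\Lambda_i^\perp=\{x\in\mathbb{Z}^m\mid\langle x,e_i\rangle=0\}$. For sedentarity $I\neq\emptyset$ with $i\notin I$ the same is done inside $H_I\cong\mathbb{T}^{m-|I|}$; if $i\in I$, $A.H_i=\emptyset$; extended linearly to mixed sedentarity. **Functions, divisors, modifications.** A regular function on $\mathbb{T}^n$ is a tropical polynomial $f(x)=\max_{\alpha\in S}(a_\alpha+\langle\alpha,x\rangle)$ with $S\subset\mathbb{Z}^n_{\ge0}$ finite; a rational function is $h=f-g$ with $f,g$ regular and $g\neq-\infty$. For a cycle $C\subset\mathbb{T}^n$ and a function $f$, the graph $\Gamma_f(C)\subset\mathbb{T}^{n+1}$ inherits weights from $C$; at each codimension one face $E$ where it is not balanced attach the closed facet generated by $E$ and the direction $-e_{n+1}$, with the unique integer weight making the complex balanced at $E$. The result $\tilde C\subset\mathbb{T}^{n+1}$ is a cycle. Let $\delta:\mathbb{T}^{n+1}\to\mathbb{T}^n$ be the projection with kernel generated by $e_{n+1}$. For $f$ regular, $\mathrm{div}_C(f)=\delta(\tilde C.H_{n+1})$, and for $h=f-g$, $\mathrm{div}_C(h)=\mathrm{div}_C(f)-\mathrm{div}_C(g)$.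 If $f$ is regular, or if $C$ is effective and $f$ is rational with $\mathrm{div}_C(f)$ effective, then $\delta:\tilde C\to C$ is the elementary modification of $C$ along $f$, and $\mathrm{div}_C(f)$ is its divisor (up to the labelling of the new coordinate, here $x_i$). *)

(* Defs.v *)
(* Tropical cycles, divisors and elementary modifications in T^n, and Bergman
   fans of matroids (MathComp / MathComp-Analysis).

   Coordinates.  All coordinates are labelled by 'I_N.  For S : {set 'I_N}, the
   spaces R^S, Z^S and T^S are realized inside 'rV[R]_N, 'rV[int]_N and
   'rV[\bar R]_N as the vectors whose coordinates outside S are 0 (and, for
   T = R U {-oo}, without coordinate +oo).  Thus forgetting the coordinate i
   amounts to putting it to 0, and the chart x_j = 0 of the projective space
   with homogeneous coordinates S is T^(S :\ j). *)

From HB Require Import structures.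
From mathcomp Require Import all_boot all_order all_algebra finmap.
From mathcomp Require Import all_classical all_reals all_analysis.

Set Implicit Arguments.
Unset Strict Implicit.
Unset Printing Implicit Defensive.

Import Order.TTheory GRing.Theory Num.Theory.

Local Open Scope classical_set_scope.
Local Open Scope ring_scope.

(* ---------- Matroids ---------- *)

Record rankdata (N : nat) := RankData {
  ground : {set 'I_N};
  rk : {set 'I_N} -> nat }.

Section Matroid.
Context {N : nat}.
Implicit Types (M : rankdata N) (A B F D : {set 'I_N}).

Definition is_matroid M : Prop :=
  [/\ forall A, A \subset ground M -> (rk M A <= #|A|)%N,
      forall A B, A \subset B -> B \subset ground M -> (rk M A <= rk M B)%N &
      forall A B, A \subset ground M -> B \subset ground M ->
        (rk M (A :|: B)%SET + rk M (A :&: B)%SET <= rk M A + rk M B)%N].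

Definition mdelete M D := RankData (ground M :\: D)%SET (rk M).

Definition mcontract M (i : 'I_N) :=
  RankData (ground M :\ i)%SET
    (fun A => (rk M (i |: A)%SET - rk M [set i]%SET)%N).

Definition is_basis M B : bool :=
  [&& B \subset ground M, #|B| == rk M B & rk M B == rk M (ground M)].

Definition is_loop M (l : 'I_N) : bool :=
  (l \in ground M) && [forall B : {set 'I_N}, is_basis M B ==> (l \notin B)].

Definition is_coloop M (l : 'I_N) : bool :=
  (l \in ground M) && [forall B : {set 'I_N}, is_basis M B ==> (l \in B)].

Definition loops M : {set 'I_N} := [set l | is_loop M l]%SET.

Definition is_flat M F : bool :=
  (F \subset ground M) &&
  [forall l in (ground M :\: F)%SET, (rk M F < rk M (l |: F)%SET)%N].

(* The chains 0 <> F_1 < ... < F_s <> ground of flats, as sets of flats; the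
   empty chain (s = 0) is included. *)
Definition is_chain_of_flats M (c : {set {set 'I_N}}) : bool :=
  [forall F in c, [&& is_flat M F, F != finset.set0 & F != ground M]] &&
  [forall F in c, forall G in c, (F \subset G) || (G \subset F)].

End Matroid.

Section Tropical.
Context {R : realType} {N : nat}.

(* ---------- Rational polyhedra in R^A ---------- *)

Definition realspace (A : {set 'I_N}) : set 'rV[R]_N :=
  [set x | forall l, l \notin A -> x 0 l = 0].

Definition intspace (A : {set 'I_N}) : set 'rV[int]_N :=
  [set x | forall l, l \notin A -> x 0 l = 0].

Definition int_vec (v : 'rV[int]_N) : 'rV[R]_N := map_mx intr v.

Definition pairing (a : 'rV[int]_N) (x : 'rV[R]_N) : R :=
  \sum_l (a 0 l)%:~R * x 0 l.

Definition is_polyhedron (A : {set 'I_N}) (P : set 'rV[R]_N) : Prop :=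
  exists s : seq ('rV[int]_N * R),
    P = [set x | realspace A x /\ forall c, c \in s -> pairing c.1 x <= c.2].

Definition is_face (F P : set 'rV[R]_N) : Prop :=
  F !=set0 /\
  exists a : 'rV[int]_N,
    F = [set x | P x /\ forall y, P y -> pairing a y <= pairing a x].

Definition contains_differences (P : set 'rV[R]_N) (U : {vspace 'rV[R]_N}) :=
  forall x y, P x -> P y -> x - y \in U.

(* The linear space parallel to P, that is the least subspace containing all
   differences of points of P. *)
Definition lin (P : set 'rV[R]_N) : {vspace 'rV[R]_N} :=
  xget 0%VS [set U | contains_differences P U /\
                     forall W, contains_differences P W -> (U <= W)%VS].

(* Dimensions are integers, so that "k - 1" makes sense for k = 0. *)
Definition pdim (P : set 'rV[R]_N) : int := (\dim (lin P))%:Z.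

Definition lattice (P : set 'rV[R]_N) : set 'rV[int]_N :=
  [set v | int_vec v \in lin P].

(* ---------- Weighted complexes and cycles in R^A ---------- *)

(* A finite set of cells with a weight function, of which only the values on
   the k-dimensional cells (the facets, k being given separately) matter. *)
Record wcomplex := WComplex {
  cells : set (set 'rV[R]_N);
  weight : set 'rV[R]_N -> int }.

Definition wzero : wcomplex := WComplex set0 (fun=> 0).

Definition facets (k : int) (X : wcomplex) : set (set 'rV[R]_N) :=
  [set P | cells X P /\ pdim P = k].

Definition is_complex (A : {set 'I_N}) (K : set (set 'rV[R]_N)) : Prop :=
  [/\ finite_set K,
      forall P, K P -> is_polyhedron A P /\ P !=set0,
      forall P F, K P -> is_face F P -> K F &
      forall P Q, K P -> K Q -> P `&` Q !=set0 ->
        is_face (P `&` Q) P /\ is_face (P `&` Q) Q].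

(* v points from E into F and generates the lattice of F together with that of
   E; for a face E of codimension one such a v is automatically primitive. *)
Definition normal_vector (E F : set 'rV[R]_N) (v : 'rV[int]_N) : Prop :=
  [/\ lattice F v,
      forall u, lattice F u ->
        exists e (z : int), lattice E e /\ u = e + v *~ z &
      exists x (t : R), [/\ E x, 0 < t & F (x + t *: int_vec v)]].

Definition balanced_at (k : int) (X : wcomplex) (E : set 'rV[R]_N) : Prop :=
  exists v : set 'rV[R]_N -> 'rV[int]_N,
    (forall F, facets k X F -> E `<=` F -> normal_vector E F (v F)) /\
    \sum_(F \in [set F | facets k X F /\ E `<=` F])
       (int_vec (v F) *~ weight X F) \in lin E.

Definition is_cycle (k : int) (A : {set 'I_N}) (X : wcomplex) : Prop :=
  [/\ is_complex A (cells X),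
      forall P, cells X P -> exists2 F, facets k X F & P `<=` F &
      forall E, facets (k - 1) X E -> balanced_at k X E].

(* As usual, cycles are considered up to refinement and up to facets of weight
   0: what matters is the weight at the points outside the cells of dimension
   < k (at such a point of a complex at most one facet contributes). *)
Definition mult (k : int) (X : wcomplex) (x : 'rV[R]_N) : int :=
  \sum_(F \in [set F | facets k X F /\ F x]) weight X F.

Definition generic (k : int) (X : wcomplex) (x : 'rV[R]_N) : Prop :=
  forall P, cells X P -> P x -> k <= pdim P.

Definition same_cycle (k : int) (X Y : wcomplex) : Prop :=
  forall x, generic k X x -> generic k Y x -> mult k X x = mult k Y x.

(* ---------- Cycles in T^S ---------- *)

(* Parametrization of H_I^x by R^(S :\: I). *)
Definition sed (I : {set 'I_N}) (x : 'rV[R]_N) : 'rV[\bar R]_N :=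
  \row_l (if l \in I then -oo else (x 0 l)%:E)%E.

(* A cycle in T^S is a sum of cycles of the various sedentarities I, a cycle
   of sedentarity I being the closure of a cycle X I of H_I^x = R^(S :\: I).
   It is recorded by the family of the X I; the closures, taken in T^S, are
   made explicit in trace below. *)
Definition tcomplex := {set 'I_N} -> wcomplex.

Definition is_tcycle (k : int) (S : {set 'I_N}) (X : tcomplex) : Prop :=
  forall I : {set 'I_N},
    if I \subset S then is_cycle k (S :\: I)%SET (X I)
    else cells (X I) = set0.

Definition is_tcomplex (S : {set 'I_N}) (X : tcomplex) : Prop :=
  forall I : {set 'I_N},
    if I \subset S then is_complex (S :\: I)%SET (cells (X I))
    else cells (X I) = set0.

Definition same_tcycle (k : int) (S : {set 'I_N}) (X Y : tcomplex) : Prop :=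
  forall I : {set 'I_N}, I \subset S -> same_cycle k (X I) (Y I).

Definition effective (k : int) (S : {set 'I_N}) (X : tcomplex) : Prop :=
  forall (I : {set 'I_N}) F,
    I \subset S -> facets k (X I) F -> 0 < weight (X I) F.

(* X = the sum of the Y I over the I satisfying p *)
Definition is_sum (p : pred {set 'I_N}) (k : int) (S : {set 'I_N})
    (Y : {set 'I_N} -> tcomplex) (X : tcomplex) : Prop :=
  forall (J : {set 'I_N}) x, J \subset S ->
    generic k (X J) x -> (forall I, p I -> generic k (Y I J) x) ->
    mult k (X J) x = \sum_(I | p I) mult k (Y I J) x.

(* X = Y - Z *)
Definition is_difference (k : int) (S : {set 'I_N}) (Y Z X : tcomplex) : Prop :=
  forall (J : {set 'I_N}) x, J \subset S ->
    generic k (X J) x -> generic k (Y J) x -> generic k (Z J) x ->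
    mult k (X J) x = mult k (Y J) x - mult k (Z J) x.

(* ---------- Intersection with H_i ---------- *)

(* Number of cosets of the subgroup L of Z^A (0 if there are infinitely many) *)
Definition lattice_index (A : {set 'I_N}) (L : set 'rV[int]_N) : nat :=
  #|` fset_set [set [set x + v | v in L] | x in intspace A] |.

Definition lattice_sum (L L' : set 'rV[int]_N) : set 'rV[int]_N :=
  [set u + v | u in L & v in L'].

(* cl(P) intersected with H_J^x = R^(S :\: J), for P in H_I^x = R^(S :\: I);
   the closure in T^S agrees with that in \bar R^N at points of T^S. *)
Definition trace (S I J : {set 'I_N}) (P : set 'rV[R]_N) : set 'rV[R]_N :=
  [set y | realspace (S :\: J)%SET y /\ closure (sed I @` P) (sed J y)].

(* A . H_i, for A the closure in T^S of the k-dimensional complex X in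
   H_I^x, i \notin I. *)
Definition hyp_weight (k : int) (S : {set 'I_N}) (i : 'I_N) (I : {set 'I_N})
    (X : wcomplex) (J : {set 'I_N}) (Q : set 'rV[R]_N) : int :=
  \sum_(F \in [set F | facets k X F /\ Q `<=` trace S I J F])
    (weight X F *
     (lattice_index (S :\: I)%SET
        (lattice_sum (lattice F)
           [set v | intspace (S :\: I)%SET v /\ v 0 i = 0]))%:Z).

Definition hyp_intersect (k : int) (S : {set 'I_N}) (i : 'I_N) (I : {set 'I_N})
    (X : wcomplex) : tcomplex := fun J =>
  if [&& I \subset J, J \subset S & i \in J] then
    WComplex
      [set Q | [/\ Q !=set0, pdim Q <= k - 1 &
                   exists2 P, cells X P & Q = trace S I J P]]
      (hyp_weight k S i I X J)
  else wzero.

(* D = X . H_i; the formula for the weights refers to the facets of the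
   polyhedral complex (X cap H_i)^(k-1), so that X has to be subdivided finely
   enough for the faces at infinity to form a complex in each stratum. *)
Definition is_hyp_intersect (k : int) (S : {set 'I_N}) (i : 'I_N)
    (X D : tcomplex) : Prop :=
  [/\ is_tcomplex S D,
      forall I : {set 'I_N}, I \subset S -> i \notin I ->
        is_tcomplex S (hyp_intersect k S i I (X I)) &
      is_sum (fun I => (I \subset S) && (i \notin I)) (k - 1) S
        (fun I => hyp_intersect k S i I (X I)) D].

(* ---------- Regular functions, modifications and divisors ---------- *)

(* Tropical polynomials max_(c in p) (c.1 + <c.2, x>) in the coordinates S; in
   \bar R one has -oo *+ 0 = 0, and the empty maximum is -oo. *)
Definition is_regular (S : {set 'I_N}) (f : 'rV[\bar R]_N -> \bar R) : Prop :=
  exists p : seq (R * 'rV[nat]_N),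
    (forall c l, c \in p -> l \notin S -> c.2 0 l = 0%N) /\
    forall x, f x =
      (\big[maxe/-oo]_(c <- p) (c.1%:E + \sum_l (x 0%R l *+ c.2 0%R l)))%E.

(* f - g on H_I^x, where f and g are finite. *)
Definition rational_on (f g : 'rV[\bar R]_N -> \bar R) (I : {set 'I_N})
    (x : 'rV[R]_N) : R := fine (f (sed I x)) - fine (g (sed I x)).

Definition affine_on (h : 'rV[R]_N -> R) (P : set 'rV[R]_N) : Prop :=
  exists (a : 'rV[int]_N) (b : R), forall x, P x -> h x = pairing a x + b.

Definition graph (i : 'I_N) (h : 'rV[R]_N -> R) (P : set 'rV[R]_N) :=
  [set x + h x *: delta_mx 0 i | x in P].

(* The projection with kernel generated by e_i. *)
Definition forget (i : 'I_N) (y : 'rV[R]_N) : 'rV[R]_N :=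
  y - y 0 i *: delta_mx 0 i.

Definition downward (i : 'I_N) (P : set 'rV[R]_N) : set 'rV[R]_N :=
  [set y | exists x (t : R), [/\ P x, 0 <= t & y = x - t *: delta_mx 0 i]].

Definition graph_complex (i : 'I_N) (h : 'rV[R]_N -> R) (C : wcomplex) :=
  WComplex (graph i h @` cells C) (fun Q => weight C (forget i @` Q)).

(* X is the graph of h over C, completed at each codimension one face where it
   is not balanced by the closed facet generated by this face and -e_i (and by
   its faces), weighted so that X is balanced there. *)
Definition is_completed_graph (k : int) (i : 'I_N) (h : 'rV[R]_N -> R)
    (C X : wcomplex) : Prop :=
  let G := graph_complex i h C in
  [/\ forall P, cells C P -> affine_on h P,
      cells X = cells G `|`
        [set downward i Q | Q in
           [set Q | exists E, [/\ facets (k - 1) G E,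
                                  ~ balanced_at k G E & is_face Q E]]],
      forall F, facets k G F -> weight X F = weight G F &
      forall E, facets (k - 1) G E -> balanced_at k X E].

Definition is_modification_complex (k : int) (S : {set 'I_N}) (i : 'I_N)
    (f g : 'rV[\bar R]_N -> \bar R) (C X : tcomplex) : Prop :=
  forall I : {set 'I_N}, if I \subset S then
      (forall P x, cells (C I) P -> P x ->
         f (sed I x) \is a fin_num /\ g (sed I x) \is a fin_num) /\
      is_completed_graph k i (rational_on f g I) (C I) (X I)
    else cells (X I) = set0.

(* X, a cycle in T^(i |: S), is the modification of the cycle C in T^S along
   f - g; the construction is applied to a subdivision of C on the cells of
   which f - g is affine. *)
Definition is_modification (k : int) (S : {set 'I_N}) (i : 'I_N)
    (f g : 'rV[\bar R]_N -> \bar R) (C X : tcomplex) : Prop :=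
  exists C' X', [/\ is_tcycle k S C', same_tcycle k S C' C,
    is_modification_complex k S i f g C' X' &
    same_tcycle k (i |: S)%SET X' X].

(* The image under the projection T^(i |: S) -> T^S of a cycle contained in
   H_i: the stratum (i |: J) of H_i is identified with the stratum J. *)
Definition project (i : 'I_N) (D : tcomplex) : tcomplex :=
  fun J => if i \in J then wzero else D (i |: J)%SET.

(* div_C(f) = delta (C~ . H_i), for f regular. *)
Definition is_divisor_regular (k : int) (S : {set 'I_N}) (i : 'I_N)
    (f : 'rV[\bar R]_N -> \bar R) (C D : tcomplex) : Prop :=
  exists C' X' D',
    [/\ is_tcycle k S C', same_tcycle k S C' C &
        is_modification_complex k S i f (cst 0%E) C' X'] /\
    [/\ is_hyp_intersect k (i |: S)%SET i X' D', is_tcomplex S D &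
        same_tcycle (k - 1) S (project i D') D].

Definition is_divisor (k : int) (S : {set 'I_N}) (i : 'I_N)
    (f g : 'rV[\bar R]_N -> \bar R) (C D : tcomplex) : Prop :=
  exists Df Dg, [/\ is_divisor_regular k S i f C Df,
    is_divisor_regular k S i g C Dg & is_difference (k - 1) S Df Dg D].

(* Forgetting the coordinate x_i, i \notin S, is an elementary modification
   X -> C of the k-cycle C in T^S, with divisor D; the function is f - g, which
   is regular if g = 0. *)
Definition elementary_modification (k : int) (S : {set 'I_N}) (i : 'I_N)
    (X C D : tcomplex) : Prop :=
  [/\ is_tcycle k S C, is_tcycle k (i |: S)%SET X & is_tcycle (k - 1) S D] /\
  exists f g : 'rV[\bar R]_N -> \bar R,
    [/\ is_regular S f, is_regular S g &
        exists x, g (sed finset.set0 x) != -oo%E] /\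
    [/\ is_modification k S i f g C X, is_divisor k S i f g C D &
        g = cst 0%E \/ (effective k S C /\ effective (k - 1) S D)].

(* ---------- Bergman fans ---------- *)

(* The chart x_j = 0 of R^A / R(1,...,1). *)
Definition affine_chart (A : {set 'I_N}) (j : 'I_N) (x : 'rV[R]_N) : 'rV[R]_N :=
  \row_l (if l \in A then x 0 l - x 0 j else 0).

(* v_F in homogeneous coordinates: v_l is the class of -e_l.  In the chart
   x_j = 0 this is -e_l for l <> j, and the sum of the e_l, l <> j, for v_j. *)
Definition flat_vec (F : {set 'I_N}) : 'rV[R]_N := - \sum_(l in F) delta_mx 0 l.

Definition chain_cone (c : {set {set 'I_N}}) : set 'rV[R]_N :=
  [set x | exists a : {set 'I_N} -> R,
     (forall F, F \in c -> 0 <= a F) /\ x = \sum_(F in c) a F *: flat_vec F].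

(* The trace of B(M) on R^A, A = ground M, M loopless, in the chart x_j = 0. *)
Definition loopless_fan (M : rankdata N) (j : 'I_N) : wcomplex :=
  WComplex
    [set affine_chart (ground M) j @` chain_cone c | c in
       [set c : {set {set 'I_N}} | is_chain_of_flats M c]]
    (fun=> 1).

(* B(M) cap U_j in T^(ground M :\ j): pure of sedentarity the set of loops, and
   empty if j is a loop. *)
Definition bergman (M : rankdata N) (j : 'I_N) : tcomplex := fun I =>
  if (I == loops M) && (j \notin loops M)
  then loopless_fan (mdelete M (loops M)) j else wzero.

End Tropical.

Arguments wcomplex : clear implicits.
Arguments tcomplex : clear implicits.
Arguments bergman R {N} M j.

(* Main.v *)
(* Deleting the set of loops reduces everything to a loopless matroid M.  Let AA
   be the set of flats A of M \ i that span i in M.  On B(M), away from infinity,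
   the coordinate x_i is the function h = min_(A in AA) max_(l in A) x_l of the
   other coordinates (with x_j = 0) wherever it is determined by them: h is
   linear on the cone of every chain of flats of M \ i, and at v_F it takes the
   value [j in F] - [i in cl F], so that the graph of h maps this cone onto the
   cone of the closures in M of the members of the chain.  The graph of h is
   unbalanced exactly at the cones of the chains of codimension one all of whose
   members F, and the empty set, yield flats i |: F of M; then the facet in
   direction - e_i has weight 1, and these facets complete the graph to B(M).

   As a rational function h is f - g, where f is the sum of the
   p_A = max_(l in A) x_l, A in AA, and g is the maximum of the sums of all but
   one of the p_A.  Because the divisors of f and g are computed from their own completed graphs,
   they have to be compared stratum by stratum.  In the finite stratum the
   weights of the new facets are additive in the function, so their difference is
   1 on the chains of flats of M / i and 0 elsewhere.  At infinity a graph cone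
   over a chain through G meets x_i = -oo in the stratum of G iff the function is
   negative at v_G, and contributes in dimension k - 1 only if G has rank one;
   there g vanishes, and f is - 1 if G is the parallel class of i without i, and
   0 otherwise.  This parallel class is the set of loops of M / i. *)

(* A minimum of maxima is in general not convex, which is why h appears as a difference. The pair f,
   g comes from the identity: minimum = sum of all - maximum of the sums of all but one. The
   definition then asks for effective cycles instead of g = 0; Bergman fans have weights 1.

   All cones are spanned by chains of subsets of the ground set, so they belong to the braid fan, on
   whose cones each max_(l in A) x_l is linear. Hence B(M \ i) serves as its own subdivision for f
   and g, and integral dual vectors of the generators reduce faces, lattices and balancing to finite
   sets.

   The completed graph and B(M) have different cells: B(M) cuts the cones in direction - e_i
   according to the position of x_i among the other coordinates. They are therefore compared
   pointwise, by supports and generic multiplicities. At infinity the traces of all cells are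
   determined, not only those of facets, because the faces at infinity have to form a complex. The
   tools are inequalities between coordinates, which survive closure, and explicit rays. *)
Require Import Defs.
From mathcomp Require Import all_boot all_order all_algebra finmap.
From mathcomp Require Import all_classical all_reals all_analysis.
From mathcomp Require Import zify lra ring fintype finset.

Set Implicit Arguments.
Unset Strict Implicit.
Unset Printing Implicit Defensive.

Import Order.TTheory GRing.Theory Num.Theory.

(** * Matroids *)

(* Identifies terms that differ only by the spelling of the index type, which
   lia would treat as distinct atoms. *)
Ltac ulia := try unfold reverse_coercion in *; simpl Finite.sort in *; lia.

Lemma set_ind (T : finType) (P : {set T} -> Prop) : P set0 ->
  (forall x (A : {set T}), x \notin A -> P A -> P (x |: A)%SET) -> forall A, P A.
Proof.
move=> P0 PU A; have [m] := ubnP #|A|; elim: m A => // m IH A.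
have [->//|[x xA] Am] := set_0Vmem A.
rewrite -(finset.setD1K xA); apply: PU; first by rewrite !inE eqxx.
by apply: IH; move: Am; rewrite (cardsD1 x) xA.
Qed.

Section MatroidTheory.
Local Open Scope nat_scope.
Local Open Scope set_scope.
Context {N : nat} (M : rankdata N) (mM : is_matroid M).
Notation E := (ground M).
Notation r := (rk M).
Implicit Types (A B D F G H K : {set 'I_N}) (c : {set {set 'I_N}}) (l i a b : 'I_N).

Definition mcl A := [set l in E | r (l |: A) == r A].

Lemma rk_le_card A : A \subset E -> r A <= #|A|. Proof. by case: mM => h _ _; apply: h. Qed.
Lemma rk_sub A B : A \subset B -> B \subset E -> r A <= r B.
Proof. by case: mM => _ h _; apply: h. Qed.
Lemma rk_submod A B : A \subset E -> B \subset E ->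
  r (A :|: B) + r (A :&: B) <= r A + r B.
Proof. by case: mM => _ _ h; apply: h. Qed.

Lemma rk_set0 : r set0 = 0.
Proof. by apply/eqP; rewrite -leqn0 -(@cards0 'I_N) rk_le_card ?sub0set. Qed.

Lemma setU1_subE l A : l \in E -> A \subset E -> l |: A \subset E.
Proof. by move=> lE AE; rewrite subUset sub1set lE. Qed.

Lemma rk_setU1_le l A : l \in E -> A \subset E -> r (l |: A) <= (r A).+1.
Proof.
move=> lE AE; have lE1 : [set l] \subset E by rewrite sub1set.
have := rk_submod lE1 AE; have := rk_le_card lE1; rewrite cards1; ulia.
Qed.

Lemma rk_setU1_ge l A : l \in E -> A \subset E -> r A <= r (l |: A).
Proof. by move=> lE AE; apply: rk_sub (setU1_subE lE AE); apply: subsetUr. Qed.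

(** Submodularity for [l |: A] and [B], whose union is [l |: B] and whose intersection contains [A]:
    the gain in rank from [l] can only shrink. *)
Lemma rk_setU1_mono l A B : l \in E -> A \subset B -> B \subset E ->
  r (l |: A) = r A -> r (l |: B) = r B.
Proof.
move=> lE AB BE e; have AE := subset_trans AB BE.
have := rk_submod (setU1_subE lE AE) BE.
rewrite -setUA (setUidPr AB) e => h.
have : r A <= r ((l |: A) :&: B).
  apply: rk_sub; last by rewrite subIset // BE orbT.
  by rewrite subsetI AB subsetUr.
have := rk_setU1_ge lE BE; ulia.
Qed.

Lemma rk_setU_closure A D : A \subset E -> D \subset E ->
  (forall l, l \in D -> r (l |: A) = r A) -> r (D :|: A) = r A.
Proof.
move=> AE; elim/(@set_ind 'I_N) : D => [|l D lD IH] DE h; first by rewrite set0U.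
have DE' : D \subset E by apply: subset_trans DE; apply: subsetUr.
have lE : l \in E by apply: (subsetP DE); rewrite !inE eqxx.
rewrite -setUA (@rk_setU1_mono _ A) ?subsetUr ?subUset ?DE' //.
  by apply: IH => // a aD; apply: h; rewrite !inE aD orbT.
by apply: h; rewrite !inE eqxx.
Qed.

Lemma mcl_subE A : mcl A \subset E.
Proof. by apply/subsetP => l; rewrite inE => /andP[]. Qed.

Lemma sub_mcl A : A \subset E -> A \subset mcl A.
Proof.
move=> /subsetP AE; apply/subsetP => l lA.
by rewrite inE AE //= (setUidPr _) // sub1set.
Qed.

Lemma rk_mcl A : A \subset E -> r (mcl A) = r A.
Proof.
move=> AE; rewrite -{1}(setUidPl (sub_mcl AE)) rk_setU_closure ?mcl_subE //.
by move=> l; rewrite inE => /andP[_ /eqP].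
Qed.

Lemma mcl_mono A B : A \subset B -> B \subset E -> mcl A \subset mcl B.
Proof.
move=> AB BE; apply/subsetP => l; rewrite !inE => /andP[lE /eqP e].
by rewrite lE (rk_setU1_mono lE AB BE e) eqxx.
Qed.

Lemma is_flatP F : reflect (F \subset E /\ (forall l, l \in E -> r (l |: F) = r F -> l \in F))
  (is_flat M F).
Proof.
apply: (iffP andP) => -[FE].
  move=> /'forall_implyP h; split=> // l lE e; apply: contraT => lF.
  by have := h l; rewrite !inE lE lF e ltnn => /(_ isT).
move=> h; split=> //; apply/'forall_implyP => l; rewrite inE => /andP[lF lE].
rewrite ltn_neqAle rk_setU1_ge // andbT; apply: contra lF => /eqP e.
exact: h.
Qed.

Lemma flat_subE F : is_flat M F -> F \subset E.
Proof. by case/andP. Qed.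

Lemma mcl_flat A : A \subset E -> is_flat M (mcl A).
Proof.
move=> AE; apply/is_flatP; split=> [|l lE e]; first exact: mcl_subE.
rewrite inE lE eqn_leq rk_setU1_ge // andbT -(rk_mcl AE) -e.
by rewrite rk_sub ?setU1_subE ?mcl_subE // setUS ?sub_mcl.
Qed.

Lemma flat_mcl F : is_flat M F -> mcl F = F.
Proof.
move=> fF; apply/eqP; rewrite eqEsubset sub_mcl ?flat_subE // andbT.
apply/subsetP => l; rewrite inE => /andP[lE /eqP e].
by case/is_flatP: fF => _; apply.
Qed.

Lemma mcl_min A F : A \subset F -> is_flat M F -> mcl A \subset F.
Proof. by move=> AF fF; rewrite -(flat_mcl fF) mcl_mono // flat_subE. Qed.

Lemma flat_ground : is_flat M E.
Proof. by apply/is_flatP. Qed.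

Lemma flat_lt F G : is_flat M F -> F \proper G -> G \subset E -> r F < r G.
Proof.
move=> fF /properP[FG [l lG lF]] GE.
have lE := subsetP GE _ lG.
rewrite ltnNge; apply: contra lF => h.
case/is_flatP: fF => FE; apply=> //.
apply/eqP; rewrite eqn_leq rk_setU1_ge // andbT (leq_trans _ h) //.
by apply: rk_sub => //; rewrite subUset sub1set lG.
Qed.

Lemma flat_eq F G : is_flat M F -> F \subset G -> G \subset E -> r G <= r F -> F = G.
Proof.
move=> fF FG GE h; apply/eqP; apply: contraTT h => FneG.
by rewrite -ltnNge flat_lt // properEneq FneG.
Qed.

(** The Mac Lane-Steinitz exchange property: single gains are 0 or 1, and adding [a] and [b] to [A]
    in either order gives the same rank. *)
Lemma mcl_exchange A a b : A \subset E -> b \in E ->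
  a \notin mcl A -> a \in mcl (b |: A) -> b \in mcl (a |: A).
Proof.
move=> AE bE; rewrite !inE => + /andP[aE /eqP e]; rewrite aE bE /= => ne.
rewrite setUCA e eqn_leq.
have := rk_setU1_ge aE AE; have := rk_setU1_le bE AE.
have := rk_setU1_ge bE (setU1_subE aE AE); rewrite setUCA e.
move: ne; ulia.
Qed.

(** Pigeonhole: if all of 1, ..., [r E] - 1 were ranks of members, [c] would have at least
    [(r E).-1] members. *)
Lemma chain_missing_rank c : is_chain_of_flats M c -> #|c| < (r E).-1 ->
  exists r0, [/\ 0 < r0, r0 < r E & forall F, F \in c -> r F != r0].
Proof.
move=> cc h.
have [//|/hasPn hn] := boolP (has (fun m => [forall F in c, r F != m]) (iota 1 (r E).-1)).
  move=> /hasP[m]; rewrite mem_iota => hm /'forall_implyP hF; exists m; split=> //; lia.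
suff : (r E).-1 <= #|c| by lia.
rewrite -(size_iota 1 (r E).-1) cardE -(size_map r); apply: uniq_leq_size; first exact: iota_uniq.
move=> m /hn /forallPn[F]; rewrite negb_imply negbK => /andP[Fc /eqP <-].
by apply/mapP; exists F => //; rewrite mem_enum.
Qed.

Hypothesis loopless : is_flat M set0.

Lemma chain_flat c F : is_chain_of_flats M c -> F \in c -> is_flat M F.
Proof. by case/andP => /'forall_implyP h _ /h /and3P[]. Qed.
Lemma chain_neq0 c F : is_chain_of_flats M c -> F \in c -> F != set0.
Proof. by case/andP => /'forall_implyP h _ /h /and3P[]. Qed.
Lemma chain_neqE c F : is_chain_of_flats M c -> F \in c -> F != E.
Proof. by case/andP => /'forall_implyP h _ /h /and3P[]. Qed.
Lemma chain_total c F G : is_chain_of_flats M c -> F \in c -> G \in c ->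
  (F \subset G) || (G \subset F).
Proof.
by case/andP => _ /'forall_implyP h /h /'forall_implyP; apply.
Qed.

Lemma is_chainP c : (forall F, F \in c -> [/\ is_flat M F, F != set0 & F != E]) ->
  {in c &, forall F G, (F \subset G) || (G \subset F)} -> is_chain_of_flats M c.
Proof.
move=> h1 h2; apply/andP; split; apply/'forall_implyP => F Fc.
  by apply/and3P; apply: h1.
by apply/'forall_implyP => G Gc; apply: h2.
Qed.

Lemma sub_chain c c' : c' \subset c -> is_chain_of_flats M c -> is_chain_of_flats M c'.
Proof.
move=> /subsetP s cc; apply: is_chainP => [F /s Fc|F G /s Fc /s Gc].
  by rewrite (chain_flat cc) // (chain_neq0 cc) // (chain_neqE cc).
exact: (chain_total cc).
Qed.

Lemma chain_rk_gt0 c F : is_chain_of_flats M c -> F \in c -> 0 < r F.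
Proof.
move=> cc Fc; rewrite -rk_set0; apply: flat_lt => //.
  by rewrite properEneq sub0set eq_sym (chain_neq0 cc).
by rewrite flat_subE ?(chain_flat cc).
Qed.

Lemma chain_rk_lt c F : is_chain_of_flats M c -> F \in c -> r F < r E.
Proof.
move=> cc Fc; apply: flat_lt => //; first exact: chain_flat cc Fc.
by rewrite properEneq (chain_neqE cc) // flat_subE // (chain_flat cc).
Qed.

Lemma chain_sub_rk c F G : is_chain_of_flats M c -> F \in c -> G \in c ->
  r F <= r G -> F \subset G.
Proof.
move=> cc Fc Gc h; have fF := chain_flat cc Fc; have fG := chain_flat cc Gc.
case/orP: (chain_total cc Fc Gc) => // GF.
by rewrite (flat_eq fG GF (flat_subE fF)).
Qed.

Lemma chain_rk_inj c : is_chain_of_flats M c -> {in c &, injective r}.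
Proof.
move=> cc F G Fc Gc e; apply/eqP; rewrite eqEsubset.
by rewrite !(chain_sub_rk cc) // e.
Qed.

Lemma card_rk_range (c : {set {set 'I_N}}) m p : {in c &, injective r} ->
  (forall F, F \in c -> m <= r F < p) -> #|c| <= p - m.
Proof.
move=> inj h; rewrite cardE -(size_map r) -(size_iota m (p - m)).
apply: uniq_leq_size => [|x /mapP[F]].
  by rewrite map_inj_in_uniq ?enum_uniq // => F G; rewrite !mem_enum; apply: inj.
by rewrite mem_enum mem_iota => /h + ->; ulia.
Qed.

Lemma chain_card_below c G : is_chain_of_flats M c -> G \subset E ->
  #|[set F in c | F \subset G]| <= r G.
Proof.
move=> cc GE; have <- : (r G).+1 - 1 = r G by rewrite subn1.
apply: card_rk_range.
  by move=> F H; rewrite !inE => /andP[Fc _] /andP[Hc _]; apply: (chain_rk_inj cc).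
move=> F; rewrite !inE => /andP[Fc FG].
by rewrite (chain_rk_gt0 cc) //= ltnS rk_sub.
Qed.

Lemma chain_card_above c G : is_chain_of_flats M c ->
  #|[set F in c | G \subset F]| <= r E - r G.
Proof.
move=> cc; apply: card_rk_range.
  by move=> F H; rewrite !inE => /andP[Fc _] /andP[Hc _]; apply: (chain_rk_inj cc).
move=> F; rewrite !inE => /andP[Fc FG].
by rewrite (chain_rk_lt cc) // rk_sub // flat_subE // (chain_flat cc).
Qed.

Lemma chain_card c : is_chain_of_flats M c -> #|c| <= (r E).-1.
Proof.
move=> cc; rewrite -subn1; apply: card_rk_range; first exact: chain_rk_inj.
by move=> F Fc; rewrite (chain_rk_gt0 cc) ?(chain_rk_lt cc).
Qed.

(** [G1] is the largest member of rank below [r0] and [G2] the smallest of rank above it; [set0] and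
    [E] stand in when there is none, which treats the ends of the chain like its interior. *)
Lemma chain_gap c r0 : is_chain_of_flats M c -> 0 < r0 -> r0 < r E ->
  (forall F, F \in c -> r F != r0) ->
  exists G1 G2, [/\ [/\ is_flat M G1, is_flat M G2 & G1 \proper G2],
    G1 \in set0 |: c, G2 \in E |: c,
    r G1 < r0 < r G2 & forall F, F \in c -> (F \subset G1) || (G2 \subset F)].
Proof.
move=> cc r0_gt r0_lt hr.
have [G1 [G1c r1 m1]] : exists G1, [/\ G1 \in set0 |: c, r G1 < r0 &
    forall F, F \in c -> r F < r0 -> F \subset G1].
  have [/existsP[F0 /andP[F0c F0r]]|/existsPn hn] := boolP [exists F in c, r F < r0].
    case: (@arg_maxnP _ F0 (fun F => (F \in c) && (r F < r0)) r); first by apply/andP.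
    move=> G /andP[Gc Gr] Gm; exists G; split=> //; first by rewrite !inE Gc orbT.
    move=> F Fc Fr; apply: (chain_sub_rk cc) => //; apply: Gm; exact/andP.
  exists set0; rewrite !inE eqxx rk_set0; split=> // F Fc Fr.
  by have := hn F; rewrite Fc Fr.
have [G2 [G2c r2 m2]] : exists G2, [/\ G2 \in E |: c, r0 < r G2 &
    forall F, F \in c -> r0 < r F -> G2 \subset F].
  have [/existsP[F0 /andP[F0c F0r]]|/existsPn hn] := boolP [exists F in c, r0 < r F].
    case: (@arg_minnP _ F0 (fun F => (F \in c) && (r0 < r F)) r); first by apply/andP.
    move=> G /andP[Gc Gr] Gm; exists G; split=> //; first by rewrite !inE Gc orbT.
    move=> F Fc Fr; apply: (chain_sub_rk cc) => //; apply: Gm; exact/andP.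
  exists E; rewrite !inE eqxx; split=> // F Fc Fr.
  by have := hn F; rewrite Fc Fr.
have f1 : is_flat M G1 by move: G1c; rewrite !inE => /orP[/eqP->//|]; apply: chain_flat.
have f2 : is_flat M G2.
  by move: G2c; rewrite !inE => /orP[/eqP->|]; [exact: flat_ground|apply: chain_flat].
exists G1, G2; split=> //; [|by rewrite r1|]; last first.
  move=> F Fc; case: (ltngtP (r F) r0) (hr _ Fc) => // h _; first by rewrite m1.
  by rewrite m2 ?orbT.
split=> //; rewrite properEneq; apply/andP; split.
  by apply: contraTneq r2 => <-; rewrite -leqNgt ltnW.
move: G1c; rewrite !inE => /orP[/eqP->|G1c]; first exact: sub0set.
move: G2c; rewrite !inE => /orP[/eqP->|G2c]; first exact: flat_subE.
by apply: (chain_sub_rk cc) => //; ulia.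
Qed.

Lemma chain_insert c G1 G2 F : is_chain_of_flats M c ->
  (forall H, H \in c -> (H \subset G1) || (G2 \subset H)) ->
  is_flat M G2 -> is_flat M F -> G1 \proper F -> F \proper G2 ->
  F \notin c /\ is_chain_of_flats M (F |: c).
Proof.
move=> cc h fG2 fF G1F FG2; have G2E := flat_subE fG2; split.
  apply/negP => /h /orP[].
    by rewrite properE in G1F; case/andP: G1F => _ /negP.
  by rewrite properE in FG2; case/andP: FG2 => _ /negP.
have hF H : H \in c -> (H \subset F) || (F \subset H).
  move=> /h/orP[] s; first by rewrite (subset_trans s) // proper_sub.
  by rewrite (subset_trans _ s) ?orbT // proper_sub.
apply: is_chainP => [H|H K]; rewrite !inE => /orP[/eqP->|Hc].
- split=> //; first by apply: contraTneq G1F => ->; rewrite properE sub0set andbF.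
  by apply: contraTneq FG2 => ->; rewrite properE G2E andbF.
- by rewrite (chain_flat cc) // (chain_neq0 cc) // (chain_neqE cc).
- by move=> /orP[/eqP->|Kc]; rewrite ?subxx // orbC hF.
- by move=> /orP[/eqP->|Kc]; [rewrite hF|exact: (chain_total cc)].
Qed.

Lemma flat_between G1 G2 l : is_flat M G1 -> is_flat M G2 -> G1 \subset G2 ->
  l \in G2 -> l \notin G1 ->
  [/\ is_flat M (mcl (l |: G1)), r (mcl (l |: G1)) = (r G1).+1,
      G1 \proper mcl (l |: G1) & mcl (l |: G1) \subset G2].
Proof.
move=> f1 f2 s l2 l1; have G1E := flat_subE f1; have G2E := flat_subE f2.
have lE := subsetP G2E _ l2; have lG1E := setU1_subE lE G1E.
have rl : r (l |: G1) = (r G1).+1.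
  apply/eqP; rewrite eqn_leq rk_setU1_le // flat_lt //.
  by rewrite properUr // sub1set.
split; first exact: mcl_flat.
- by rewrite rk_mcl.
- apply: proper_sub_trans (sub_mcl lG1E).
  by rewrite properUr // sub1set.
- by apply: mcl_min => //; rewrite subUset sub1set l2.
Qed.

(** Purity of the Bergman fan. In the gap at a missing rank, the closure of [G1] with one element of
    [G2] has rank [r G1] + 1, less than [r G2], and can be inserted. *)
Lemma chain_extend c : is_chain_of_flats M c ->
  exists c', [/\ is_chain_of_flats M c', c \subset c' & #|c'| = (r E).-1].
Proof.
have [m] := ubnP ((r E).-1 - #|c|); elim: m c => // m IH c hm cc.
have := chain_card cc; rewrite leq_eqVlt => /orP[/eqP e|h]; first by exists c.
have [r0 [r0_gt r0_lt hr]] := chain_missing_rank cc h.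
have [G1 [G2 [[f1 f2 s12] _ _ /andP[rG1 rG2] hc]]] := chain_gap cc r0_gt r0_lt hr.
have [s12' [l l2 l1]] := properP s12.
have [fF rF G1F FG2] := flat_between f1 f2 s12' l2 l1.
have [|Fc cc'] := chain_insert cc hc f2 fF G1F.
  rewrite properEneq FG2 andbT; apply: contraTneq rG2 => <-.
  by rewrite rF -leqNgt; apply: leq_trans rG1 _.
have [|c' [c'c sc hc']] := IH _ _ cc'.
  by rewrite cardsU1 Fc; move: hm h; clear; ulia.
by exists c'; split=> //; apply: subset_trans sc; apply: subsetUr.
Qed.

End MatroidTheory.

(** * Deletions, contractions and loops *)

Section MatroidConstructions.
Local Open Scope nat_scope.
Local Open Scope set_scope.
Context {N : nat}.
Implicit Types (M : rankdata N) (A B D F G H K : {set 'I_N}) (c e : {set {set 'I_N}}) (l i : 'I_N).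

Lemma matroid_mdelete M D : is_matroid M -> is_matroid (mdelete M D).
Proof.
have s A : A \subset ground M :\: D -> A \subset ground M.
  by move=> /subset_trans; apply; apply: subsetDl.
case=> h1 h2 h3; split=> /= [A /s|A B AB /s|A B /s + /s]; [exact: h1|exact: h2|exact: h3].
Qed.

Lemma matroid_mcontract M i : is_matroid M -> i \in ground M -> is_matroid (mcontract M i).
Proof.
move=> mM iE.
have s A : A \subset ground M :\ i -> A \subset ground M.
  by move=> /subset_trans; apply; apply: subD1set.
have i1 : [set i] \subset ground M by rewrite sub1set.
have si A : A \subset ground M -> i |: A \subset ground M by exact: setU1_subE.
have ge A : A \subset ground M -> rk M [set i] <= rk M (i |: A).
  by move=> /si; apply: rk_sub => //; apply: subsetUl.
split=> /= [A /s AE|A B AB /s BE|A B /s AE /s BE].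
- rewrite leq_subLR; have := rk_submod mM i1 AE; have := rk_le_card mM AE; ulia.
- by apply: leq_sub2r; apply: rk_sub (si _ BE) => //; apply: setUS.
- have -> : i |: (A :&: B) = (i |: A) :&: (i |: B) by rewrite setUIr.
  have -> : i |: (A :|: B) = (i |: A) :|: (i |: B).
    by apply/setP => x; rewrite !inE; case: (x == i); case: (x \in A).
  have := rk_submod mM (si _ AE) (si _ BE).
  have I : (i |: A) :&: (i |: B) \subset ground M by rewrite subIset // si.
  have := rk_sub mM (_ : [set i] \subset (i |: A) :&: (i |: B)) I.
  rewrite subsetI !subsetUl => /(_ isT).
  have := ge _ AE; have := ge _ BE.
  have U : (i |: A) :|: (i |: B) \subset ground M by rewrite subUset !si.
  have := rk_sub mM (_ : [set i] \subset (i |: A) :|: (i |: B)) U.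
  rewrite subsetU ?subsetUl // => /(_ isT).
  ulia.
Qed.

Lemma notcoloop_rk M i : is_matroid M -> i \in ground M -> ~~ is_coloop M i ->
  rk M (ground M :\ i) = rk M (ground M).
Proof.
move=> mM iE; rewrite /is_coloop iE => /forallPn[B].
rewrite negb_imply => /andP[/and3P[BE _ /eqP rB] iB].
apply/eqP; rewrite eqn_leq rk_sub ?subD1set //= -rB rk_sub ?subD1set //.
by rewrite subsetD1 BE.
Qed.

(** Take an independent set containing [l] of maximal size: an element raising its rank could be
    added, so it spans. *)
Lemma basis_extension M l : is_matroid M -> l \in ground M -> 0 < rk M [set l] ->
  exists2 B, is_basis M B & l \in B.
Proof.
move=> mM lE rl.
pose P B := [&& B \subset ground M, #|B| == rk M B & l \in B].
have P0 : P [set l].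
  rewrite /P sub1set lE cards1 inE eqxx eqn_leq rl /= andbT.
  by rewrite -(cards1 l) rk_le_card // sub1set.
case: (arg_maxnP (fun B => #|B|) P0) => B /and3P[BE /eqP cB lB] Bmax.
exists B => //; rewrite /is_basis BE cB eqxx /=; apply/eqP.
rewrite -[in RHS](setUidPl BE) rk_setU_closure // => a aE.
apply/eqP; rewrite eqn_leq rk_setU1_ge // andbT leqNgt; apply/negP => h.
have aB : a \notin B by apply: contraTN h => aB; rewrite (setUidPr _) ?ltnn // sub1set.
have : P (a |: B).
  by rewrite /P setU1_subE //= cardsU1 aB cB add1n eqn_leq h rk_setU1_le // inE lB orbT.
by move=> /Bmax; rewrite cardsU1 aB; ulia.
Qed.

(** Replaces the definition through bases by a rank condition, which is easy to follow through
    deletions and contractions. *)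
Lemma loopE M l : is_matroid M -> is_loop M l = (l \in ground M) && (rk M [set l] == 0).
Proof.
move=> mM; rewrite /is_loop; case: (boolP (l \in ground M)) => //= lE; apply/idP/idP.
  move=> /forallP h; rewrite -leqn0 leqNgt; apply/negP => /(basis_extension mM lE)[B bB lB].
  by have := h B; rewrite bB lB.
move=> /eqP rl; apply/forallP => B; apply/implyP => /and3P[BE /eqP cB _].
apply/negP => lB; have BlE : B :\ l \subset ground M by apply: subset_trans BE; apply: subD1set.
have l1 : [set l] \subset ground M by rewrite sub1set.
have := rk_submod mM l1 BlE; rewrite setD1K // -cB rl.
by have := rk_le_card mM BlE; have := cardsD1 l B; rewrite lB; ulia.
Qed.

Lemma loops_subE M : loops M \subset ground M.
Proof. by apply/subsetP => l; rewrite inE => /andP[]. Qed.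

Lemma loops_mcl M : is_matroid M -> loops M = mcl M set0.
Proof.
by move=> mM; apply/setP => l; rewrite !inE loopE // setU0 rk_set0.
Qed.

Lemma rk_ground_noloops M : is_matroid M ->
  rk M (ground M :\: loops M) = rk M (ground M).
Proof.
move=> mM; have s : ground M :\: loops M \subset ground M by apply: subsetDl.
have -> : rk M (ground M) = rk M (loops M :|: (ground M :\: loops M)).
  by congr (rk M _); rewrite -[LHS](setID _ (loops M)) (setIidPr (loops_subE M)).
apply/esym/rk_setU_closure => //; first exact: loops_subE.
move=> l ll; have : l \in mcl M set0 by rewrite -loops_mcl.
rewrite inE => /andP[lE /eqP e].
exact: (rk_setU1_mono mM lE (sub0set _) s e).
Qed.

Lemma loopless_mdelete M : is_matroid M -> is_flat (mdelete M (loops M)) set0.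
Proof.
move=> mM; apply/(is_flatP (matroid_mdelete _ mM)); split; first exact: sub0set.
move=> l /=; rewrite loops_mcl // !inE => /andP[+ lE] e.
by rewrite lE e eqxx.
Qed.

(** * Codimension one chains of flats *)

Section Codim1.
Context (M : rankdata N) (mM : is_matroid M) (loopless : is_flat M set0).
Notation E := (ground M).
Notation r := (rk M).

Lemma chain_split_card c G1 G2 : is_chain_of_flats M c -> G1 \subset E ->
  (forall F, F \in c -> (F \subset G1) || (G2 \subset F)) ->
  #|c| <= r G1 + (r E - r G2).
Proof.
move=> cc s h.
have : c \subset [set F in c | F \subset G1] :|: [set F in c | G2 \subset F].
  by apply/subsetP => F Fc; rewrite !inE Fc h.
move=> /subset_leq_card /leq_trans; apply; apply: leq_trans (leq_card_setU _ _) _.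
by rewrite leq_add ?chain_card_below ?chain_card_above.
Qed.

(** For [e] of codimension one these index the facets of the Bergman fan adjacent to the cone of
    [e]. *)
Definition fillers e := [set F | (F \notin e) && is_chain_of_flats M (F |: e)].

(** With [r E] - 2 members, the bound of [chain_split_card] leaves room for a single gap, of height
    exactly two. A filler outside this gap would give a chain violating the same bound. *)
Lemma chain_codim1 e : is_chain_of_flats M e -> #|e|.+2 = r E ->
  exists G1 G2, [/\ [/\ is_flat M G1, is_flat M G2 & G1 \proper G2],
    G1 \in set0 |: e, G2 \in E |: e, r G2 = (r G1).+2 &
    fillers e = [set F | [&& is_flat M F, G1 \proper F & F \proper G2]]].
Proof.
move=> ec ek.
have [|r0 [r0_gt r0_lt hr]] := chain_missing_rank ec; first by ulia.
have [G1 [G2 [[f1 f2 s12] G1e G2e /andP[r1 r2] h]]] := chain_gap mM loopless ec r0_gt r0_lt hr.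
have G1E := flat_subE f1; have G2E := flat_subE f2.
have rG2E : r G2 <= r E by apply: rk_sub.
have r12 : r G2 = (r G1).+2.
  have := chain_split_card ec G1E h; ulia.
exists G1, G2; split=> //.
apply/setP => F; rewrite !inE; apply/andP/and3P => -[]; last first.
  by move=> fF s1 s2; apply: (chain_insert ec h).
move=> Fe Fc; have fF : is_flat M F by apply: (chain_flat Fc); rewrite !inE eqxx.
have F0 : F != set0 by apply: (chain_neq0 Fc); rewrite !inE eqxx.
have FE : F != E by apply: (chain_neqE Fc); rewrite !inE eqxx.
have nh : ~~ ((F \subset G1) || (G2 \subset F)).
  apply/negP => hF; have : #|F |: e| <= r G1 + (r E - r G2).
    by apply: chain_split_card => // H; rewrite !inE => /orP[/eqP->|/h].
  rewrite cardsU1 Fe add1n r12; clear -ek rG2E r12; rewrite r12 in rG2E; ulia.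
have FFe : F \in F |: e by rewrite !inE eqxx.
move: nh; rewrite negb_or => /andP[n1 n2]; split=> //; rewrite properE ?n1 ?n2 andbT.
  move: G1e; rewrite !inE => /orP[/eqP->|G1e]; first exact: sub0set.
  by have := chain_total Fc FFe (setU1r _ G1e); rewrite (negbTE n1).
move: G2e; rewrite !inE => /orP[/eqP->|G2e]; first exact: flat_subE.
by have := chain_total Fc FFe (setU1r _ G2e); rewrite (negbTE n2) orbF.
Qed.

(* The sets F :\: G1, F strictly between G1 and G2, partition G2 :\: G1. *)
Lemma fillers_count e G1 G2 l : is_flat M G1 -> is_flat M G2 -> G1 \proper G2 ->
  r G2 = (r G1).+2 ->
  fillers e = [set F | [&& is_flat M F, G1 \proper F & F \proper G2]] ->
  #|[set F in fillers e | l \in F]| + (l \in G1) = (l \in G2) + #|fillers e| * (l \in G1).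
Proof.
move=> f1 f2 s12 r12 ->; have G1E := flat_subE f1; have G2E := flat_subE f2.
have [l1|l1] := boolP (l \in G1).
  rewrite muln1 addnC (subsetP (proper_sub s12)) //; congr (_ + _).
  apply: eq_card => F; rewrite !inE; case: is_flat => //=.
  case s : (G1 \proper F) => //=; case: (F \proper G2) => //=.
  by rewrite (subsetP (proper_sub s)).
rewrite muln0 !addn0; have [l2|l2] := boolP (l \in G2); last first.
  apply: eq_card0 => F; rewrite !inE; apply/negP => /andP[/and3P[_ _ s] lF].
  by move: l2; rewrite (subsetP (proper_sub s)).
have [fF rF s1 s2] := flat_between mM f1 f2 (proper_sub s12) l2 l1.
have lE := subsetP G2E _ l2.
(* By ranks, the only flat strictly between [G1] and [G2] that contains [l] is the closure of
   [l |: G1]. *)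
rewrite (_ : [set F in _ | _] = [set mcl M (l |: G1)]) ?cards1 //.
apply/setP => F; rewrite !inE; apply/andP/eqP => [[/and3P[gF t1 t2] lF]|->]; last first.
  rewrite fF s1 properEneq s2 andbT (subsetP (sub_mcl _)) ?setU1_subE ?setU11 //.
  by split=> //; apply/eqP => e'; move: rF; rewrite e' r12; clear; ulia.
apply/esym/(flat_eq mM) => //; rewrite ?flat_subE //.
  by rewrite mcl_min // subUset sub1set lF proper_sub.
by rewrite rF -ltnS -r12 flat_lt.
Qed.

End Codim1.
End MatroidConstructions.

(** * Deletion and contraction of one element *)

Section SingleElement.
Local Open Scope nat_scope.
Local Open Scope set_scope.
Context {N : nat} (M : rankdata N) (mM : is_matroid M) (loopless : is_flat M set0).
Context (i : 'I_N) (iE : i \in ground M) (i_notcoloop : rk M (ground M :\ i) = rk M (ground M)).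
Implicit Types (A B D F G H K : {set 'I_N}) (c e : {set {set 'I_N}}) (l : 'I_N).
Notation E := (ground M).
Notation r := (rk M).
Notation Mdel := (mdelete M [set i]).
Notation Mcon := (mcontract M i).

Let mD : is_matroid Mdel := matroid_mdelete _ mM.
Let mC : is_matroid Mcon := matroid_mcontract mM iE.

Lemma rk_set1_loopless l : l \in E -> r [set l] = 1.
Proof.
move=> lE; have l1 : [set l] \subset E by rewrite sub1set.
apply/eqP; rewrite eqn_leq -{1}(cards1 l) rk_le_card //= -(rk_set0 mM).
by apply: flat_lt => //; rewrite properE sub0set sub1set inE.
Qed.

Lemma groundDP F : F \subset E :\ i = (F \subset E) && (i \notin F).
Proof. by rewrite subsetD1. Qed.

Lemma mdelete_flatP F : reflect [/\ F \subset E, i \notin F &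
    forall l, l \in E -> l != i -> r (l |: F) = r F -> l \in F] (is_flat Mdel F).
Proof.
apply: (iffP (is_flatP mD _)) => /=; rewrite groundDP.
  by case=> /andP[FE iF] h; split=> // l lE li; apply: h; rewrite !inE li.
by case=> FE iF h; rewrite FE iF; split=> // l; rewrite !inE => /andP[]; auto.
Qed.

Lemma flat_mdelete F : is_flat M F -> is_flat Mdel (F :\ i).
Proof.
move=> /(is_flatP mM)[FE h]; apply/mdelete_flatP; split.
- by apply: subset_trans FE; apply: subD1set.
- by rewrite !inE eqxx.
move=> l lE li e; rewrite !inE li /=; apply: h => //.
by apply: (rk_setU1_mono mM lE (subD1set _ _) FE e).
Qed.

Lemma mcl_mdelete_flat F : is_flat Mdel F ->
  mcl M F = if i \in mcl M F then i |: F else F.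
Proof.
case/mdelete_flatP => FE iF h; apply/setP => l.
have hl : l != i -> (l \in mcl M F) = (l \in F).
  move=> li; apply/idP/idP => [|lF]; last exact: subsetP (sub_mcl FE) _ lF.
  by rewrite inE => /andP[lE /eqP]; apply: h.
case: (eqVneq l i) => [->|li]; first by case: ifP; rewrite ?inE ?eqxx // (negbTE iF).
by rewrite hl //; case: ifP => _ //; rewrite !inE (negbTE li).
Qed.

Lemma mdelete_flat_cl F : is_flat Mdel F -> i \in mcl M F -> is_flat M (i |: F).
Proof.
move=> fF iF; have := mcl_mdelete_flat fF; rewrite iF => <-.
by apply: mcl_flat => //; case/mdelete_flatP: fF.
Qed.

Lemma mdelete_flat_notcl F : is_flat Mdel F -> i \notin mcl M F -> is_flat M F.
Proof.
move=> fF iF; have := mcl_mdelete_flat fF; rewrite (negbTE iF) => <-.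
by apply: mcl_flat => //; case/mdelete_flatP: fF.
Qed.

Lemma mcontract_flatE F : is_flat Mcon F = (F \subset E :\ i) && is_flat M (i |: F).
Proof.
apply/(is_flatP mC)/andP => /= -[FE].
  all: have /andP[FE' iF] : (F \subset E) && (i \notin F) by rewrite -groundDP.
  move=> h; split=> //. apply/(is_flatP mM); split; first exact: setU1_subE.
  move=> l lE e; rewrite !inE; case: (eqVneq l i) => //= li.
  by apply: h; rewrite ?inE ?li // setUCA e.
move=> /(is_flatP mM)[FE'' h]; split=> // l; rewrite !inE => /andP[li lE].
rewrite setUCA => e; have : l \in i |: F.
  apply: h => //; have := rk_setU1_ge mM lE FE''.
  have := rk_sub mM (subsetUl [set i] F) FE''; clear -e; ulia.
by rewrite !inE (negbTE li).
Qed.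

Lemma mcontract_flat_mdelete F : is_flat Mcon F -> is_flat Mdel F.
Proof.
rewrite mcontract_flatE => /andP[+ /flat_mdelete]; rewrite groundDP => /andP[_ iF].
by rewrite setU1K.
Qed.

Lemma rk_mcontract F : F \subset E -> i \in mcl M F -> rk Mcon F = (r F).-1.
Proof. by move=> FE; rewrite /= rk_set1_loopless // inE subn1 => /andP[_ /eqP->]. Qed.

Lemma rk_mcontract_notin F : F \subset E -> i \notin mcl M F -> rk Mcon F = r F.
Proof.
move=> FE; rewrite /= rk_set1_loopless // inE iE /= => ne.
have := rk_setU1_le mM iE FE; have := rk_setU1_ge mM iE FE; move: ne; ulia.
Qed.

Lemma rk_ground_mcontract : rk Mcon (ground Mcon) = (r E).-1.
Proof. by rewrite /= setD1K // rk_set1_loopless // subn1. Qed.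

Lemma groundD_cl : i \in mcl M (E :\ i).
Proof. by rewrite inE iE setD1K // i_notcoloop eqxx. Qed.

Lemma loopless_mdelete1 : is_flat Mdel set0.
Proof. by have := flat_mdelete loopless; rewrite set0D. Qed.

(** By exchange: an [l] in the closure of [i |: F] but outside [i |: F] would lie in [F'] and put
    [i] into the closure of [l |: F], hence of [F']. This lets flatness after adding [i] descend
    along a chain. *)
Lemma flat_setU1_sub F F' : is_flat M F -> F \subset F' -> F' \subset E ->
  i \notin mcl M F' -> is_flat M (i |: F') -> is_flat M (i |: F).
Proof.
move=> fF FF' F'E iF' fiF'; have FE := flat_subE fF; have iFE := setU1_subE iE FE.
apply/(is_flatP mM); split=> // l lE e.
have lcl : l \in mcl M (i |: F) by rewrite inE lE e eqxx.
have : l \in i |: F' by apply: subsetP lcl; apply: (mcl_min mM) => //; apply: setUS.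
rewrite !inE; case: eqP => //= _ lF'.
apply: contraNT iF' => lF; have : i \in mcl M (l |: F).
  by apply: mcl_exchange => //; rewrite flat_mcl.
by apply: subsetP; apply: mcl_mono => //; rewrite subUset sub1set lF'.
Qed.

(** * Codimension one chains and the contraction *)

Section Codim1Contract.
Context (e : {set {set 'I_N}}) (ec : is_chain_of_flats Mdel e).
Context (G1 G2 : {set 'I_N}).
Context (f1 : is_flat Mdel G1) (f2 : is_flat Mdel G2) (s12 : G1 \proper G2).
Context (G1e : G1 \in set0 |: e) (G2e : G2 \in E :\ i |: e) (r12 : r G2 = (r G1).+2).
Context (he : fillers Mdel e = [set F | [&& is_flat Mdel F, G1 \proper F & F \proper G2]]).
Context (ek : #|e|.+2 = r E).
Notation q F := (i \in mcl M F).

(** [set0] is included because flatness of [i |: set0] says that no other element is parallel to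
    [i], that is, that M / i has no loops. *)
Definition contract_chain e := [forall G in set0 |: e, is_flat M (i |: G)].

Let delE F : is_flat Mdel F -> F \subset E.
Proof. by case/mdelete_flatP. Qed.

Let q_mono F G : F \subset G -> G \subset E -> q F -> q G.
Proof. by move=> s GE; apply: subsetP; apply: mcl_mono. Qed.

(** A filler spanning [i] becomes, after adding [i], a flat of rank [r G1] + 1 containing [i |: G1];
    the closure of [i |: G1] is the only one. *)
Let filler_uniq F F' : ~~ q G1 -> F \in fillers Mdel e -> F' \in fillers Mdel e ->
  q F -> q F' -> F = F'.
Proof.
move=> q1; suff h G : G \in fillers Mdel e -> q G -> i |: G = mcl M (i |: G1).
  move=> Ff F'f qF qF'; have := h _ Ff qF; rewrite -(h _ F'f qF').
  move: Ff F'f; rewrite he !inE => /and3P[/mdelete_flatP[_ iF _] _ _].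
  by move=> /and3P[/mdelete_flatP[_ iF' _] _ _] /(congr1 (fun A => A :\ i)); rewrite !setU1K.
rewrite he inE => /and3P[fG s1 s2] qG; have G1E := delE f1; have GE := delE fG.
have iG1E := setU1_subE iE G1E.
apply/esym/(flat_eq mM).
- exact: mcl_flat.
- by apply: (mcl_min mM); [apply: setUS; apply: proper_sub|apply: mdelete_flat_cl].
- exact: setU1_subE.
rewrite rk_mcl //; move: qG; rewrite inE iE => /eqP ->.
have : r G < r G2 by apply: (flat_lt mD); rewrite ?flat_subE.
have : r (i |: G1) != r G1 by move: q1; rewrite inE iE.
have := rk_setU1_ge mM iE G1E; clear -r12; ulia.
Qed.

(** The condition on all members is concentrated in the gap: the change from not spanning [i] to
    spanning it must happen between [G1] and [G2], and not already at a filler. *)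
Let contract_chainE :
  contract_chain e = [&& ~~ q G1, q G2 & [forall F in fillers Mdel e, ~~ q F]].
Proof.
have G1E := delE f1; have G2E := delE f2.
have below G : G \in set0 |: e -> [/\ is_flat Mdel G & (G \subset G1) || (G2 \subset G)].
  rewrite !inE => /orP[/eqP->|Ge]; first by rewrite loopless_mdelete1 sub0set.
  have fG := chain_flat ec Ge; split=> //; apply: contraT; rewrite negb_or => /andP[n1 n2].
  suff : G \in fillers Mdel e by rewrite inE Ge.
  rewrite he inE fG !properE n1 n2 !andbT /=; apply/andP; split.
        move: G1e; rewrite !inE => /orP[/eqP->|G1e']; first exact: sub0set.
    by have := chain_total ec Ge G1e'; rewrite (negbTE n1).
  move: G2e; rewrite !inE => /orP[/eqP->|G2e']; first exact: flat_subE fG.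
  by have := chain_total ec Ge G2e'; rewrite (negbTE n2) orbF.
apply/'forall_implyP/and3P; last first.
  (* Members above [G2] span [i]. For those below [G1] it suffices that [i |: G1] is flat; a further
     [l] in its closure would produce, by exchange, a filler spanning [i]. *)
  case=> q1 q2 /'forall_implyP hq G /below[fG /orP[s|s]]; last first.
    by apply: mdelete_flat_cl => //; apply: q_mono q2 => //; apply: delE.
  have gG1 := mdelete_flat_notcl f1 q1.
  have gG : is_flat M G by apply: mdelete_flat_notcl => //; apply: contra q1; apply: q_mono.
  apply: (flat_setU1_sub gG s G1E q1).
  apply/(is_flatP mM); split; first exact: setU1_subE.
  move=> l lE el; have lcl : l \in mcl M (i |: G1) by rewrite inE lE el eqxx.
  rewrite !inE; case: (eqVneq l i) => //= li; apply: contraT => l1.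
  have lG1E := setU1_subE lE G1E.
  have icl : i \in mcl M (l |: G1) by apply: mcl_exchange => //; rewrite flat_mcl.
  have l2 : l \in G2.
    have : l \in mcl M G2.
      apply: subsetP lcl; apply: (mcl_min mM) (mcl_flat mM _) => //.
      by rewrite subUset sub1set q2 (subset_trans (proper_sub s12)) ?sub_mcl.
    by rewrite mcl_mdelete_flat // q2 !inE (negbTE li).
  have [fF rF t1 t2] := flat_between mD f1 f2 (proper_sub s12) l2 l1.
  have := hq (mcl Mdel (l |: G1)); rewrite he inE fF t1 properEneq t2 andbT /=.
  have -> : mcl Mdel (l |: G1) != G2.
    by apply/eqP => eF; move: rF; rewrite eF /= r12; clear; ulia.
  rewrite (@q_mono (l |: G1)) ?delE //; first by move=> /(_ isT).
  apply: (sub_mcl (M := Mdel)); rewrite groundDP lG1E !inE negb_or eq_sym li.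
  by case/mdelete_flatP: f1.
(* Conversely [e] is a chain in M / i, whose total rank is one smaller. The bound on its size is
   violated if [G1] already spans [i], and also if [G2] does not yet span it. *)
move=> h; have hC G : G \in set0 |: e -> is_flat Mcon G.
  move=> Ge; rewrite mcontract_flatE h // andbT; case: (below _ Ge) => fG _.
  exact: flat_subE fG.
have C0 : is_flat Mcon set0 by apply: hC; rewrite !inE eqxx.
have cC : is_chain_of_flats Mcon e.
  apply: is_chainP => [F Fe|]; last by move=> F G Fe Ge; apply: (chain_total ec).
  rewrite hC ?inE ?Fe ?orbT // (chain_neq0 ec) //; split=> //.
  exact: chain_neqE ec Fe.
have G1E' : G1 \subset ground Mcon := flat_subE f1.
have G2E' : G2 \subset ground Mcon := flat_subE f2.
have eh G : G \in e -> (G \subset G1) || (G2 \subset G).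
  by move=> Ge; case: (below G) => //; rewrite !inE Ge orbT.
have card := chain_split_card mC C0 cC G1E' eh.
have rG2le := rk_sub mC G2E' (subxx _); rewrite rk_ground_mcontract in card rG2le.
have rG2ge := rk_sub mM G2E (subxx _).
have [q1|q1] := boolP (q G1).
  move: card; rewrite (rk_mcontract G1E q1).
  have q2 : q G2 by apply: q_mono q1 => //; apply: proper_sub.
  have : G1 != set0.
    apply: contraTneq q1 => ->; rewrite inE iE setU0 rk_set1_loopless //=.
    by rewrite (rk_set0 mM).
  rewrite (rk_mcontract G2E q2) in rG2le *; rewrite r12.
  have f0 := loopless_mdelete1.
  move=> nz; have : r set0 < r G1.
    by apply: (flat_lt mD f0); rewrite ?properEneq ?sub0set 1?eq_sym ?nz //.
  rewrite (rk_set0 mM); clear -rG2ge r12 ek; ulia.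
have [q2|q2] := boolP (q G2); last first.
  move: card rG2le; rewrite (rk_mcontract_notin G1E q1) (rk_mcontract_notin G2E q2) r12.
  clear -rG2ge r12 ek; ulia.
split=> //; apply/'forall_implyP => F Ff; apply/negP => qF.
have fG1 : is_flat M (i |: G1) by apply: h.
move: (Ff); rewrite he inE => /and3P[fF t1 t2].
have : i |: G1 = i |: F.
  apply: (flat_eq mM fG1); first by apply: setUS; apply: proper_sub.
    by apply: setU1_subE => //; apply: delE.
  move: (qF); rewrite inE iE => /eqP ->.
  have : r F < r G2 by apply: (flat_lt mD); rewrite ?flat_subE.
  have : r (i |: G1) != r G1 by move: q1; rewrite inE iE.
  have := rk_setU1_ge mM iE G1E; clear -r12; ulia.
move=> /(congr1 (fun A => A :\ i)); case/mdelete_flatP: f1 => _ iG1 _; case/mdelete_flatP: fF => _ iF _.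
by rewrite !setU1K // => eF; move: t1; rewrite eF properE subxx.
Qed.

(** The analogue of [fillers_count] with spanning [i] in place of containing [l]. When [G2] spans
    [i] and [G1] does not, there is one spanning filler or none, and [contract_chain] makes up for
    the missing one. *)
Lemma codim1_contract_count :
  #|[set F in fillers Mdel e | q F]| + contract_chain e + q G1 =
    q G2 + #|fillers Mdel e| * q G1.
Proof.
rewrite contract_chainE; have G2E := delE f2.
have [q1|q1] /= := boolP (q G1).
  rewrite (q_mono (proper_sub s12) G2E q1) addn0 muln1 addnC; congr (_ + _).
  apply: eq_card => F; rewrite in_set; apply: andb_idr.
  by rewrite he in_set => /and3P[fF t1 _]; apply: q_mono q1 => //; [apply: proper_sub|apply: delE].
rewrite muln0 !addn0; have [q2|q2] /= := boolP (q G2); last first.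
  rewrite addn0; apply: eq_card0 => F; rewrite inE; apply/negP => /andP[+ qF].
  by rewrite he inE => /and3P[_ _ t2]; move: q2; rewrite (q_mono (proper_sub t2)).
have [/'forall_implyP h|] := boolP [forall F in fillers Mdel e, ~~ q F].
  rewrite (_ : [set F in _ | _] = set0) ?cards0 //.
  by apply/setP => F; rewrite [RHS]inE in_set; apply/negP => /andP[/h/negP].
move=> /forallPn[F]; rewrite negb_imply negbK => /andP[Ff qF].
rewrite addn0 (_ : [set F in _ | _] = [set F]) ?cards1 //.
apply/setP => F'; rewrite [RHS]inE in_set; apply/andP/eqP => [[F'f qF']|->] //.
exact: filler_uniq.
Qed.

End Codim1Contract.
End SingleElement.

(** * Unimodular cones *)

Section Pairing.
Local Open Scope ring_scope.
Context {R : realType} {N : nat}.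
Implicit Types (a d : 'rV[int]_N) (x y : 'rV[R]_N) (u v : 'rV[int]_N).

Definition ipair a v : int := \sum_l a 0 l * v 0 l.

Lemma int_vecD u v : @int_vec R N (u + v) = int_vec u + int_vec v.
Proof. by apply/rowP => l; rewrite !mxE intrD. Qed.
Lemma int_vecN u : @int_vec R N (- u) = - int_vec u.
Proof. by apply/rowP => l; rewrite !mxE intrN. Qed.
Lemma int_vecB u v : @int_vec R N (u - v) = int_vec u - int_vec v.
Proof. by rewrite int_vecD int_vecN. Qed.
Lemma int_vec0 : @int_vec R N 0 = 0.
Proof. by apply/rowP => l; rewrite !mxE. Qed.
Lemma mulrz_rowE u (z : int) l : (u *~ z) 0 l = z * u 0 l.
Proof. by rewrite -(scaler_int z u) mxE intz. Qed.
Lemma int_vecMz u z : @int_vec R N (u *~ z) = z%:~R *: int_vec u.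
Proof.
by apply/rowP => l; rewrite !mxE mulrz_rowE rmorphM.
Qed.
Lemma int_vec_sum (T : finType) (P : pred T) (F : T -> 'rV[int]_N) :
  @int_vec R N (\sum_(t | P t) F t) = \sum_(t | P t) int_vec (F t).
Proof. exact: (big_morph _ int_vecD int_vec0). Qed.
Lemma int_vec_inj : injective (@int_vec R N).
Proof.
by move=> u v /rowP e; apply/rowP => l; have := e l; rewrite !mxE => /intr_inj.
Qed.

Lemma pairingDr a x y : pairing a (x + y) = pairing a x + pairing a y.
Proof. by rewrite -big_split; apply: eq_bigr => l _; rewrite mxE mulrDr. Qed.
Lemma pairingZr a (t : R) x : pairing a (t *: x) = t * pairing a x.
Proof. by rewrite mulr_sumr; apply: eq_bigr => l _; rewrite mxE mulrCA. Qed.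
Lemma pairing0r a : @pairing R N a 0 = 0.
Proof. by rewrite -(scale0r 0) pairingZr mul0r. Qed.
Lemma pairing_sumr (T : finType) (P : pred T) a (F : T -> 'rV[R]_N) :
  pairing a (\sum_(t | P t) F t) = \sum_(t | P t) pairing a (F t).
Proof. exact: (big_morph _ (pairingDr a) (pairing0r a)). Qed.
Lemma pairingDl a d x : pairing (a + d) x = pairing a x + pairing d x.
Proof. by rewrite -big_split; apply: eq_bigr => l _; rewrite mxE intrD mulrDl. Qed.
Lemma pairing0l x : pairing 0 x = 0.
Proof. by apply: big1 => l _; rewrite mxE mul0r. Qed.
Lemma pairingNl a x : pairing (- a) x = - pairing a x.
Proof. by rewrite /pairing -sumrN; apply: eq_bigr => l _; rewrite mxE intrN mulNr. Qed.
Lemma pairing_suml (T : finType) (P : pred T) (F : T -> 'rV[int]_N) x :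
  pairing (\sum_(t | P t) F t) x = \sum_(t | P t) pairing (F t) x.
Proof. exact: (big_morph (fun a => pairing a x) (fun a d => pairingDl a d x) (pairing0l x)). Qed.
Lemma pairingMzl a (z : int) x : pairing (a *~ z) x = z%:~R * pairing a x.
Proof.
rewrite mulr_sumr; apply: eq_bigr => l _.
by rewrite mulrz_rowE rmorphM mulrA.
Qed.
Lemma pairing_int a v : @pairing R N a (int_vec v) = (ipair a v)%:~R.
Proof. by rewrite rmorph_sum; apply: eq_bigr => l _; rewrite mxE rmorphM. Qed.
Lemma pairing_delta l x : pairing (delta_mx 0 l) x = x 0 l.
Proof.
rewrite /pairing (bigD1 l) //= big1 ?addr0; first by rewrite mxE !eqxx mul1r.
by move=> m ml; rewrite mxE eqxx (negbTE ml) mul0r.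
Qed.

End Pairing.

Section UCone.
Local Open Scope ring_scope.
Context {R : realType} {N : nat} {T : finType}.
Implicit Types (u : T -> 'rV[int]_N) (c e : {set T}) (s t : T) (x y : 'rV[R]_N).

Definition ucone u c : set 'rV[R]_N := [set x | exists a : T -> R,
  (forall t, t \in c -> 0 <= a t) /\ x = \sum_(t in c) a t *: int_vec (u t)]%classic.

Definition dual_basis u c (d : T -> 'rV[int]_N) :=
  {in c &, forall s t, ipair (d s) (u t) = (s == t)%:R}.

(** Equivalently, the [u t] are part of a lattice basis. The dual vectors read off coefficients,
    which gives the dimension, the lattice and the faces of the cone. *)
Definition unimodular u c := exists d, dual_basis u c d.

Definition ucspan u c : {vspace 'rV[R]_N} := (\sum_(t in c) <[int_vec (u t)]>)%VS.

Lemma ucspanP u c x : reflect (exists a : T -> R, x = \sum_(t in c) a t *: int_vec (u t))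
  (x \in ucspan u c).
Proof.
apply: (iffP memv_sumP) => [[vs vsP ->]|[a ->]].
  have /choice [a ha] : forall t, exists k, t \in c -> vs t = k *: int_vec (u t).
    move=> t; have [tc|tc] := boolP (t \in c); last by exists 0.
    by have /vlineP[k e] := vsP t tc; exists k.
  by exists a; apply: eq_bigr => t tc; apply: ha.
by exists (fun t => a t *: int_vec (u t)) => // t tc; apply/vlineP; exists (a t).
Qed.

Lemma dual_pairing u c d (a : T -> R) s : dual_basis u c d -> s \in c ->
  pairing (d s) (\sum_(t in c) a t *: int_vec (u t)) = a s.
Proof.
move=> du sc; rewrite pairing_sumr (bigD1 s) //= big1 ?addr0.
  by rewrite pairingZr pairing_int du // eqxx mulr1.
move=> t /andP[tc ts]; rewrite pairingZr pairing_int du // eq_sym (negbTE ts).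
by rewrite mulr0.
Qed.

Lemma unimodular_coef u c (a b : T -> R) : unimodular u c ->
  \sum_(t in c) a t *: @int_vec R N (u t) = \sum_(t in c) b t *: int_vec (u t) ->
  forall t, t \in c -> a t = b t.
Proof.
by case=> d du e t tc; rewrite -(dual_pairing a du tc) e (dual_pairing b du tc).
Qed.

Lemma unimodular_sub u c c' : c' \subset c -> unimodular u c -> unimodular u c'.
Proof.
by move=> /subsetP s [d du]; exists d => t t' /s tc /s tc'; apply: du.
Qed.

Lemma dim_ucspan u c : unimodular u c -> \dim (ucspan u c) = #|c|.
Proof.
move=> uc; have /directvP -> : directv (\sum_(t in c) <[@int_vec R N (u t)]>)%VS.
  apply/directv_sum_independent => us usP e0 t tc.
  have /choice [a ha] : forall t, exists k, t \in c -> us t = k *: int_vec (u t).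
    move=> t'; have [tc'|tc'] := boolP (t' \in c); last by exists 0.
    by have /vlineP[k e] := usP t' tc'; exists k.
  rewrite ha //; have -> : a t = (fun=> 0) t.
    apply: (unimodular_coef uc) tc; rewrite [RHS]big1; last by move=> *; rewrite scale0r.
    by rewrite -[RHS]e0; apply: eq_bigr => t' tc'; rewrite ha.
  by rewrite scale0r.
rewrite /= -sum1_card; apply: eq_bigr => t tc; rewrite dim_vline.
suff -> : @int_vec R N (u t) != 0 by [].
case: uc => d du; apply/eqP => e.
have := @pairing_int R N (d t) (u t); rewrite e pairing0r du // eqxx => /esym/eqP.
by rewrite oner_eq0.
Qed.

Lemma ucone_gen u c t : t \in c -> ucone u c (int_vec (u t)).
Proof.
move=> tc; exists (fun s => (s == t)%:R); split; first by move=> *; rewrite ler0n.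
rewrite (bigD1 t) //= eqxx scale1r big1 ?addr0 // => s /andP[_ /negbTE->].
by rewrite scale0r.
Qed.

Lemma ucone0 u c : ucone u c 0.
Proof.
by exists (fun=> 0); split=> //; rewrite big1 // => t _; rewrite scale0r.
Qed.

Lemma lin_unique (P : set 'rV[R]_N) (U : {vspace 'rV[R]_N}) : contains_differences P U ->
  (forall W, contains_differences P W -> (U <= W)%VS) -> lin P = U.
Proof.
move=> h1 h2; apply: xget_unique => // W [w1 w2]; apply: subv_anti.
by rewrite w2 // h2.
Qed.

Lemma lin_ucone u c : lin (ucone u c) = ucspan u c.
Proof.
apply: lin_unique => [x y [a [_ ->]] [b [_ ->]]|W hW].
  apply/ucspanP; exists (fun t => a t - b t); rewrite -sumrB.
  by apply: eq_bigr => t _; rewrite scalerBl.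
apply/subv_sumP => t tc; rewrite -memvE -[int_vec _]subr0.
by apply: hW; [apply: ucone_gen|apply: ucone0].
Qed.

Lemma pdim_ucone u c : unimodular u c -> pdim (ucone u c) = #|c|%:Z.
Proof. by move=> uc; rewrite /pdim lin_ucone dim_ucspan. Qed.

Lemma lattice_uconeP u c v : unimodular u c ->
  lattice (ucone u c) v <-> exists z : T -> int, v = \sum_(t in c) u t *~ z t.
Proof.
move=> [d du]; rewrite /lattice /= lin_ucone; split.
  move=> /ucspanP[a e]; exists (fun t => ipair (d t) v); apply: (@int_vec_inj R N).
  rewrite int_vec_sum e; apply: eq_bigr => t tc; rewrite int_vecMz -pairing_int e.
  by rewrite (dual_pairing a du tc).
move=> [z ->]; apply/ucspanP; exists (fun t => (z t)%:~R).
by rewrite int_vec_sum; apply: eq_bigr => t _; rewrite int_vecMz.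
Qed.

Lemma ucone_mono u c c' : c' \subset c -> (ucone u c' `<=` ucone u c)%classic.
Proof.
move=> /subsetP s x [a [a0 ->]]; exists (fun t => if t \in c' then a t else 0); split.
  by move=> t tc; case: ifP => // /a0.
rewrite [RHS](big_setID c') /= (setIidPr (introT subsetP s)) [X in _ + X]big1 ?addr0.
  by apply: eq_bigr => t ->.
by move=> t; rewrite inE => /andP[/negbTE-> _]; rewrite scale0r.
Qed.

Lemma ucone_lin u c x : ucone u c x -> x \in ucspan u c.
Proof. by case=> a [_ ->]; apply/ucspanP; exists a. Qed.

Lemma ucone_face u c c' : unimodular u c -> c' \subset c ->
  is_face (ucone u c') (ucone u c).
Proof.
move=> [d du] sc; split; first by exists 0; apply: ucone0.
(* This functional is minus the sum of the coefficients outside [c']: its maximum on the cone is 0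
   and is attained exactly on the smaller cone. *)
pose a := - \sum_(t in c :\: c') d t.
have pa x b : x = \sum_(t in c) b t *: int_vec (u t) ->
    pairing a x = - \sum_(t in c :\: c') b t.
  move=> ->; rewrite /a pairingNl pairing_suml; congr (- _); apply: eq_bigr => t.
  by rewrite inE => /andP[_ tc]; rewrite (dual_pairing b du tc).
exists a; apply/classical_sets.seteqP; split=> x.
  move=> xc'; have xc := ucone_mono sc xc'; split=> // y [b [b0 yb]].
  rewrite (pa _ _ yb); case: xc' => b' [b'0 ->].
  have -> : pairing a (\sum_(t in c') b' t *: int_vec (u t)) = 0.
    rewrite pairing_sumr big1 // => s sc'; rewrite pairingZr pairing_int.
    have -> : ipair a (u s) = 0; last by rewrite mulr0.
    have /eqP : pairing a (@int_vec R N (u s)) = 0.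
      rewrite (pa _ (fun t => (t == s)%:R)).
        rewrite big1 ?oppr0 // => t; rewrite inE => /andP[tc' _].
        by case: eqP tc' => // ->; rewrite sc'.
      rewrite (bigD1 s) ?(subsetP sc) //= eqxx scale1r big1 ?addr0 // => t /andP[_ /negbTE->].
      by rewrite scale0r.
    by rewrite pairing_int intr_eq0 => /eqP.
  rewrite oppr_le0 sumr_ge0 // => t; rewrite inE => /andP[_ tc]; exact: b0.
case=> -[b [b0 xb]] /(_ 0 (ucone0 _ _)); rewrite pairing0r (pa _ _ xb) oppr_ge0 => h.
have b00 t : t \in c :\: c' -> 0 <= b t by rewrite inE => /andP[_ /b0].
have /eqP : \sum_(t in c :\: c') b t = 0.
  by apply/eqP; rewrite eq_le h sumr_ge0.
rewrite psumr_eq0 // => /allP z.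
exists b; split; first by move=> t /(subsetP sc)/b0.
rewrite xb (big_setID c') /= (setIidPr sc) [X in _ + X]big1 ?addr0 // => t tc.
have := z t; rewrite mem_index_enum tc => /(_ isT)/eqP ->; exact: scale0r.
Qed.

(** A functional attaining a maximum on the cone is nonpositive on every generator, since generators
    can be added to a maximal point. The maximum is then 0, attained on the cone of the generators
    where the functional vanishes. *)
Lemma ucone_faceP u c F : unimodular u c ->
  is_face F (ucone u c) <-> exists2 c' : {set T}, c' \subset c & F = ucone u c'.
Proof.
move=> uc; split; last by case=> c' sc ->; apply: ucone_face.
case=> -[x0 Fx0] [a eF].
have aneg t : t \in c -> ipair a (u t) <= 0.
  move=> tc; move: Fx0; rewrite eF => -[x0c /(_ (x0 + int_vec (u t)))].
  rewrite pairingDr pairing_int gerDl lerz0; apply.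
  case: x0c => b [b0 ->]; exists (fun s => b s + (s == t)%:R); split.
    by move=> s sc; rewrite addr_ge0 ?b0.
  rewrite (eq_bigr _ (fun s _ => scalerDl _ _ _)) big_split /=; congr (_ + _).
  rewrite (bigD1 t) //= eqxx scale1r big1 ?addr0 // => s /andP[_ /negbTE->].
  by rewrite scale0r.
exists [set t in c | ipair a (u t) == 0].
  by apply/subsetP => t; rewrite inE => /andP[].
have pE b : pairing a (\sum_(t in c) b t *: @int_vec R N (u t)) =
    \sum_(t in c) b t * (ipair a (u t))%:~R.
  by rewrite pairing_sumr; apply: eq_bigr => t _; rewrite pairingZr pairing_int.
have npos x : ucone u c x -> pairing a x <= 0.
  case=> b [b0 ->]; rewrite pE sumr_le0 // => t tc.
  by rewrite mulr_ge0_le0 ?b0 // lerz0 aneg.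
rewrite eF; apply/classical_sets.seteqP; split=> x.
  case=> -[b [b0 xb]] /(_ 0 (ucone0 _ _)); rewrite pairing0r xb pE => h.
  have s0 t : t \in c -> 0 <= - (b t * (ipair a (u t))%:~R).
    by move=> tc; rewrite oppr_ge0 mulr_ge0_le0 ?b0 // lerz0 aneg.
  have : \sum_(t in c) - (b t * (ipair a (u t))%:~R) == 0.
    by rewrite eq_le sumr_ge0 // andbT sumrN oppr_le0.
  rewrite psumr_eq0 // => /allP z.
  exists b; split; first by move=> t; rewrite inE => /andP[/b0].
  rewrite (big_setID [set t in c | ipair a (u t) == 0]) /= [X in _ + X]big1 ?addr0.
    rewrite (setIidPr _) //; apply/subsetP => t; rewrite inE => /andP[] //.
  move=> t; rewrite !inE => /andP[nz tc]; rewrite tc /= in nz.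
  have := z t; rewrite mem_index_enum tc => /(_ isT).
  by rewrite oppr_eq0 mulf_eq0 intr_eq0 (negbTE nz) orbF => /eqP->; rewrite scale0r.
move=> xc'; have sc : [set t in c | ipair a (u t) == 0] \subset c.
  by apply/subsetP => t; rewrite inE => /andP[].
split; first exact: ucone_mono sc _ xc'.
move=> y /npos /le_trans; apply; case: xc' => b [b0 ->].
rewrite pairing_sumr sumr_ge0 // => t; rewrite inE => /andP[tc /eqP e].
by rewrite pairingZr pairing_int e mulr0.
Qed.

Lemma normal_vector_ucone u e t : t \notin e -> unimodular u (t |: e) ->
  normal_vector (ucone u e) (ucone u (t |: e)) (u t).
Proof.
move=> te uc; have ue : unimodular u e by apply: unimodular_sub uc; apply: subsetUr.
split.
- apply/(lattice_uconeP _ uc); exists (fun s => (s == t)%:Z).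
  rewrite (bigD1 t) ?setU11 //= eqxx mulr1z big1 ?addr0 // => s /andP[_ /negbTE->].
  by rewrite mulr0z.
- move=> v /(lattice_uconeP _ uc)[z ->]; rewrite big_setU1 //= addrC.
  exists (\sum_(s in e) u s *~ z s), (z t); split=> //.
  by apply/(lattice_uconeP _ ue); exists z.
exists 0, 1; split=> //; first exact: ucone0.
by rewrite add0r scale1r; apply: ucone_gen; rewrite setU11.
Qed.

(** Makes balancing independent of the chosen normal vectors. The coefficient [z t] of [v] along
    [u t] divides 1 because [v] generates, and is nonnegative because [v] points into the facet. *)
Lemma normal_vector_ucone_uniq u e t v : t \notin e -> unimodular u (t |: e) ->
  normal_vector (ucone u e) (ucone u (t |: e)) v ->
  int_vec v - int_vec (u t) \in ucspan u e.
Proof.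
move=> te uc; have ue : unimodular u e by apply: unimodular_sub uc; apply: subsetUr.
case: (uc) => d du [/(lattice_uconeP _ uc)[z vz] gen [x [tau [xe tau0 xv]]]].
have te1 : t \in t |: e by rewrite setU11.
have det w : w \in ucspan u e -> pairing (d t) w = 0.
  case/ucspanP => b ->; rewrite pairing_sumr big1 // => s se; rewrite pairingZr pairing_int.
  rewrite (du _ _ te1 (setU1r _ se)) eq_sym.
  have -> : (s == t) = false by apply: contraNF te => /eqP <-.
  by rewrite mulr0.
have dv : pairing (d t) (@int_vec R N v) = (z t)%:~R.
  rewrite vz int_vec_sum -(dual_pairing (fun s => (z s)%:~R) du te1).
  by congr (pairing _ _); apply: eq_bigr => t1 _; rewrite int_vecMz.
have z0 : 0 <= z t.
  have : pairing (d t) (x + tau *: @int_vec R N v) = tau * (z t)%:~R.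
    by rewrite pairingDr pairingZr dv (det _ (ucone_lin xe)) add0r.
  case: xv => b [b0 ->]; rewrite (dual_pairing b du te1) => e1.
  by rewrite -(ler0z R) -(pmulr_rge0 _ tau0) -e1 b0.
have [w' [m [le eu]]] : exists w' (m : int), lattice (ucone u e) w' /\ u t = w' + v *~ m.
  apply: gen; apply/(lattice_uconeP _ uc); exists (fun s => (s == t)%:Z).
  rewrite (bigD1 t) //= eqxx mulr1z big1 ?addr0 // => s /andP[_ /negbTE->].
  by rewrite mulr0z.
have z1 : z t = 1.
  have := congr1 (fun w => pairing (d t) (@int_vec R N w)) eu.
  rewrite int_vecD int_vecMz pairingDr pairingZr dv pairing_int du // eqxx.
  rewrite det ?add0r; last by move: le; rewrite /lattice /= lin_ucone.
  rewrite -intrM -[1%:~R]/(1%:~R : R) => /eqP; rewrite eqr_int => /eqP e1.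
  move: (congr1 absz e1); rewrite abszM => /esym/eqP; rewrite muln_eq1 => /andP[_ /eqP zt].
  by rewrite -(gez0_abs z0) zt.
apply/ucspanP; exists (fun s => (z s)%:~R).
rewrite vz int_vec_sum big_setU1 //= z1 mulr1z addrC addrK.
by apply: eq_bigr => s _; rewrite int_vecMz.
Qed.

Lemma fsbig_imagefin (V : nmodType) (S : choiceType) (Te : {set T}) (phi : T -> S) (A : set S)
    (g : S -> V) :
  (forall F, A F <-> exists2 t, t \in Te & F = phi t) -> {in Te &, injective phi} ->
  \sum_(F \in A) g F = \sum_(t in Te) g (phi t).
Proof.
move=> hA inj; have -> : A = (phi @` [set` Te])%classic.
  apply/classical_sets.seteqP; split=> F; first by move=> /hA[t tT ->]; exists t.
  by case=> t tT <-; apply/hA; exists t.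
rewrite fsbig_image; last by move=> s t /set_mem sT /set_mem tT; apply: inj.
rewrite [RHS](bigfs _ (f := fun t => g (phi t))) ?index_enum_uniq // => t _.
by rewrite mem_index_enum.
Qed.

(** Normal vectors being unique modulo the span of the face, any choice of them may be exchanged for
    the generators [u t]; balancing becomes a condition on one explicit sum. *)
Lemma balanced_uconeP (k : int) (X : wcomplex R N) u e (Te : {set T}) :
  (forall F, facets k X F /\ (ucone u e `<=` F)%classic <->
     exists2 t, t \in Te & F = ucone u (t |: e)) ->
  {in Te &, injective (fun t => ucone u (t |: e))} ->
  (forall t, t \in Te -> t \notin e /\ unimodular u (t |: e)) ->
  balanced_at k X (ucone u e) <->
  \sum_(t in Te) int_vec (u t) *~ weight X (ucone u (t |: e)) \in ucspan u e.
Proof.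
move=> hF inj ht; rewrite /balanced_at lin_ucone.
have sumE v : \sum_(F \in [set F | facets k X F /\ ucone u e `<=` F]%classic)
       (@int_vec R N (v F) *~ weight X F) =
     \sum_(t in Te) @int_vec R N (v (ucone u (t |: e))) *~ weight X (ucone u (t |: e)).
  exact: (fsbig_imagefin (fun F => @int_vec R N (v F) *~ weight X F) hF inj).
split.
  case=> v [hv]; rewrite sumE => h.
  rewrite -[X in X \in _](subKr (\sum_(t in Te) @int_vec R N (v (ucone u (t |: e))) *~
    weight X (ucone u (t |: e)))).
  apply: rpredB => //; rewrite -sumrB; apply: rpred_sum => t tT; rewrite -mulrzBl.
  have [te uc] := ht _ tT; apply: rpredMz.
  apply: normal_vector_ucone_uniq => //; apply: hv.
    by have [|//] := (hF (ucone u (t |: e))).2; exists t.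
  by apply: ucone_mono; apply: subsetUr.
(* Take the generators at the adjacent facets, and 0 at all other sets, where nothing is asked of
   [v]. *)
move=> h; pose P F v := exists2 t, t \in Te & F = ucone u (t |: e) /\ v = u t.
have /choice [v hv] : forall F, exists v, (exists2 t, t \in Te & F = ucone u (t |: e)) -> P F v.
  move=> F; have [[t tT ->]|nh] := pselect (exists2 t, t \in Te & F = ucone u (t |: e)).
    by exists (u t) => _; exists t.
  by exists 0.
exists v; split.
  move=> F h1 h2; have [|t tT [eF ->]] := hv F; first by apply/hF.
  by have [te uc] := ht _ tT; rewrite eF; apply: normal_vector_ucone.
rewrite sumE (eq_bigr (fun t => int_vec (u t) *~ weight X (ucone u (t |: e)))) // => t tT.
have [|s sT [es ->]] := hv (ucone u (t |: e)); first by exists t.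
by rewrite (inj _ _ tT sT es).
Qed.

End UCone.

(** * Cones of chains of sets *)

Section Braid.
Local Open Scope ring_scope.
Context {N : nat}.
Implicit Types (A B F G H : {set 'I_N}) (c e : {set {set 'I_N}}) (j l : 'I_N).

(** The vector v_F in the chart x_j = 0, integral and supported on [B]. *)
Definition cv B j F : 'rV[int]_N :=
  \row_l (if l \in B then (j \in F)%:R - (l \in F)%:R else 0).

(** The cones of these chains form the braid fan, of which the Bergman fan of every loopless matroid
    on [B] is a subfan. *)
Definition bchain B c : bool :=
  [forall F in c, [&& F \subset B, F != set0 & F != B]] &&
  [forall F in c, forall G in c, (F \subset G) || (G \subset F)].

Lemma bchainP B c : reflect
  ((forall F, F \in c -> [/\ F \subset B, F != set0 & F != B]) /\
   {in c &, forall F G, (F \subset G) || (G \subset F)}) (bchain B c).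
Proof.
apply: (iffP andP) => -[].
  move=> /'forall_implyP h1 /'forall_implyP h2; split=> [F /h1/and3P//|F G /h2/'forall_implyP].
  by apply.
move=> h1 h2; split; apply/'forall_implyP => F Fc; first by apply/and3P; apply: h1.
by apply/'forall_implyP => G Gc; apply: h2.
Qed.

Lemma bchain_mem B c F : bchain B c -> F \in c -> [/\ F \subset B, F != set0 & F != B].
Proof. by case/bchainP => h _ /h. Qed.

Lemma bchain_total B c : bchain B c -> {in c &, forall F G, (F \subset G) || (G \subset F)}.
Proof. by case/bchainP. Qed.

Lemma sub_bchain B c c' : c' \subset c -> bchain B c -> bchain B c'.
Proof.
move=> /subsetP s /bchainP[h1 h2]; apply/bchainP; split=> [F /s /h1 //|F G /s Fc /s Gc].
exact: h2.
Qed.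

Lemma chain_of_flats_bchain (M : rankdata N) c : is_chain_of_flats M c -> bchain (ground M) c.
Proof.
case/andP => /'forall_implyP h1 h2; apply/andP; split=> //.
by apply/'forall_implyP => F /h1/and3P[/andP[-> _] -> ->].
Qed.

(** Choose [l] in [A] outside the largest member not containing [A]. On the cone of the chain, the
    maximum of the coordinates in [A] is attained at [l]. *)
Lemma chain_last_elt B c A : bchain B c -> A != set0 ->
  exists2 l, l \in A & forall F, F \in c -> l \in F -> A \subset F.
Proof.
move=> cc A0; have [/existsP[F0 F0P]|/existsPn h] := boolP [exists F in c, ~~ (A \subset F)].
  case: (@arg_maxnP _ F0 (fun F => (F \in c) && ~~ (A \subset F)) (fun F : {set 'I_N} => #|F|) F0P).
  move=> G /andP[Gc AG] Gmax; have [l lA lG] := subsetPn AG; exists l => // F Fc lF.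
  apply: contraT => AF.
  case/orP: (bchain_total cc Fc Gc) => s; first by rewrite (subsetP s) in lG.
  have : F == G by rewrite eq_sym eqEcard s; apply: Gmax; rewrite Fc.
  by move=> /eqP e; rewrite e (negbTE lG) in lF.
have [l lA] := set0Pn _ A0; exists l => // F Fc _.
by have := h F; rewrite Fc negbK.
Qed.

Lemma chain_first_elt B c A : bchain B c -> ~~ (B \subset A) ->
  exists2 l, l \in B :\: A & forall F, F \in c -> ~~ (F \subset A) -> l \in F.
Proof.
move=> cc BA; have [/existsP[F0 F0P]|/existsPn h] := boolP [exists F in c, ~~ (F \subset A)].
  case: (@arg_minnP _ F0 (fun F => (F \in c) && ~~ (F \subset A)) (fun F : {set 'I_N} => #|F|) F0P).
  move=> G /andP[Gc AG] Gmin; have [l lG lA] := subsetPn AG.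
  have [GB _ _] := bchain_mem cc Gc; exists l; first by rewrite inE lA (subsetP GB).
  move=> F Fc AF; case/orP: (bchain_total cc Fc Gc) => s; last exact: subsetP s _ lG.
  have : F == G by rewrite eqEcard s; apply: Gmin; rewrite Fc.
  by move=> /eqP ->.
have [l lB lA] := subsetPn BA; exists l; first by rewrite inE lA.
by move=> F Fc FA; have := h F; rewrite Fc FA.
Qed.

Lemma bchain_neqB B c F : bchain B c -> F \in c -> ~~ (B \subset F).
Proof.
by move=> cc /(bchain_mem cc)[FB _ FnB]; apply: contra FnB => s; rewrite eqEsubset FB.
Qed.

(** Take [p] entering last in [F] and [q] entering first outside [F]: on the cone of [c], the
    difference x_q - x_p is the coefficient of v_F. *)
Lemma bchain_dual B c F : bchain B c -> F \in c ->
  exists p q, [/\ p \in B, q \in B & forall G, G \in c -> (p \in G) = ((q \in G) + (F == G))%N :> nat].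
Proof.
move=> cc Fc; have [FB F0 _] := bchain_mem cc Fc.
have [p pF pP] := chain_last_elt cc F0.
have [q] := chain_first_elt cc (bchain_neqB cc Fc).
rewrite inE => /andP[qF qB] qP; exists p, q; split=> //; first exact: subsetP FB _ pF.
move=> G Gc; have [<-|FG] := eqVneq F G; first by rewrite pF (negbTE qF).
rewrite addn0; congr (nat_of_bool _); apply/idP/idP => [/(pP _ Gc) s|qG].
  by apply: qP => //; apply: contra FG => s'; rewrite eqEsubset s.
case/orP: (bchain_total cc Fc Gc) => s; first exact: subsetP s _ pF.
by rewrite (subsetP s) in qF.
Qed.

Lemma ipair_delta l (v : 'rV[int]_N) : ipair (delta_mx 0 l) v = v 0 l.
Proof.
rewrite /ipair (bigD1 l) //= big1 ?addr0; first by rewrite mxE !eqxx mul1r.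
by move=> m ml; rewrite mxE eqxx (negbTE ml) mul0r.
Qed.

Lemma ipairBl (a b v : 'rV[int]_N) : ipair (a - b) v = ipair a v - ipair b v.
Proof. by rewrite /ipair -sumrB; apply: eq_bigr => l _; rewrite !mxE mulrBl. Qed.

Lemma bchain_dual_basis B j c : bchain B c -> exists2 d, dual_basis (cv B j) c d &
  forall F, F \in c -> exists p q, [/\ p \in B, q \in B & d F = delta_mx 0 q - delta_mx 0 p].
Proof.
move=> cc.
have /choice [d hd] : forall F, exists d : 'rV[int]_N, F \in c ->
    (forall G, G \in c -> ipair d (cv B j G) = (F == G)%:R) /\
    exists p q, [/\ p \in B, q \in B & d = delta_mx 0 q - delta_mx 0 p].
  move=> F; have [Fc|Fc] := boolP (F \in c); last by exists 0.
  have [p [q [pB qB h]]] := bchain_dual cc Fc.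
  exists (delta_mx 0 q - delta_mx 0 p) => _; split; last by exists p, q.
  move=> G Gc; rewrite ipairBl !ipair_delta !mxE pB qB.
  have := congr1 (fun n => n%:R : int) (h _ Gc); rewrite natrD => ->; ring.
by exists d => [F G Fc Gc|F Fc]; case: (hd _ Fc) => // h _; apply: h.
Qed.

Lemma bchain_unimodular B j c : bchain B c -> unimodular (cv B j) c.
Proof. by move=> /(bchain_dual_basis j)[d hd _]; exists d. Qed.

Context {R : realType}.
Implicit Types (x y : 'rV[R]_N).

(** For [x] in the chart this is the chain of the cone with [x] in its relative interior; [B] is
    left out because its vector is 0. *)
Definition sublevels B x : {set {set 'I_N}} :=
  [set F | [exists b in B, F == [set a in B | x 0 a <= x 0 b]] & F != B].

Lemma sublevels_bchain B x : bchain B (sublevels B x).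
Proof.
apply/bchainP; split=> [F|F G].
  rewrite inE => /andP[/existsP[b /andP[bB /eqP e]] FB]; split=> //.
    by rewrite e; apply/subsetP => a; rewrite inE => /andP[].
  by apply/set0Pn; exists b; rewrite e inE bB lexx.
rewrite !inE => /andP[/existsP[b /andP[bB /eqP->]] _] /andP[/existsP[b' /andP[b'B /eqP->]] _].
case/orP: (le_total (x 0 b) (x 0 b')) => h; apply/orP; [left|right];
  by apply/subsetP => a; rewrite !inE => /andP[-> /le_trans]; apply.
Qed.

Lemma braid_entry B j c (a : {set 'I_N} -> R) l :
  (\sum_(F in c) a F *: int_vec (cv B j F)) 0 l =
  if l \in B then \sum_(F in c) a F * ((j \in F)%:R - (l \in F)%:R) else 0.
Proof.
rewrite summxE; case: ifP => lB; last first.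
  by apply: big1 => F _; rewrite !mxE lB mulr0.
by apply: eq_bigr => F _; rewrite !mxE lB intrB !mulrz_nat.
Qed.

Definition braid_ineqs B c x := forall a b, a \in B -> b \in B ->
  (forall F, F \in c -> b \in F -> a \in F) -> x 0 a <= x 0 b.

Lemma ucone_braid_ineqs B j c x : ucone (cv B j) c x -> braid_ineqs B c x.
Proof.
case=> a [a0 ->] p q pB qB h; rewrite !braid_entry pB qB -subr_ge0 -sumrB sumr_ge0 // => F Fc.
rewrite -mulrBr mulr_ge0 ?a0 //.
have := h _ Fc; case: (q \in F) => [->//|_]; first by rewrite subrr.
by rewrite subr0 subKr ler0n.
Qed.

Lemma braid_realspace B j c x : j \in B -> ucone (cv B j) c x -> realspace (B :\ j) x.
Proof.
move=> jB [a [_ ->]] l; rewrite in_setD1 negb_and negbK braid_entry => /orP[/eqP->|/negbTE->//].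
by rewrite jB big1 // => F _; rewrite subrr mulr0.
Qed.

(** If [l] enters last in a sublevel set [F] and [q] first outside [F], then x_l < x_q, so some
    member [H] contains [l] but not [q]; by the choice of [l] and [q], [F] equals [H]. *)
Lemma braid_ineqs_sublevels B c x : bchain B c -> braid_ineqs B c x -> sublevels B x \subset c.
Proof.
move=> cc h; apply/subsetP => F Fs; have [FB F0 FnB] := bchain_mem (sublevels_bchain B x) Fs.
have [l lF lP] := chain_last_elt cc F0.
have [q] := chain_first_elt cc (bchain_neqB (sublevels_bchain B x) Fs).
rewrite inE => /andP[qF qB] qP.
move: Fs; rewrite inE => /andP[/existsP[b /andP[bB /eqP e]] _].
move: (lF) (qF); rewrite e !inE qB /= -ltNge => /andP[lB lb] qb.
have /existsP[H /and3P[Hc lH qH]] : [exists H, [&& H \in c, l \in H & q \notin H]].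
  apply: contraT => /existsPn hn; have : x 0 q <= x 0 l.
    apply: h => // G Gc lG; apply: contraT => qG; have := hn G.
    by rewrite Gc lG qG.
  by rewrite leNgt (le_lt_trans lb).
suff -> : [set a in B | x 0 a <= x 0 b] = H by [].
rewrite -e; apply/eqP; rewrite eqEsubset lP //=.
by apply: contraNT qH; apply: qP.
Qed.

(** Works in homogeneous coordinates: [t] is the multiple of (1,...,1) that is fixed later by the
    chart x_j = 0. *)
Lemma braid_decomposition B c x : bchain B c -> braid_ineqs B c x ->
  exists (a : {set 'I_N} -> R) (t : R), (forall F, F \in c -> 0 <= a F) /\
    forall l, l \in B -> x 0 l = t - \sum_(F in c) a F * (l \in F)%:R.
Proof.
have [m] := ubnP #|c|; elim: m c x => // m IH c x cm cc h.
have [c0|[F0 F0c]] := set_0Vmem c.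
  have [B0|[b bB]] := set_0Vmem B.
    by exists (fun=> 0), 0; split=> // l; rewrite B0 inE.
  exists (fun=> 0), (x 0 b); split=> // l lB; rewrite c0 big_set0 subr0.
  by apply/eqP; rewrite eq_le !h // => F; rewrite c0 inE.
case: (arg_maxnP (fun F : {set 'I_N} => #|F|) F0c) => G Gc' Gmax; have Gc : G \in c by [].
have cG F : F \in c -> F \subset G.
  move=> Fc; case/orP: (bchain_total cc Fc Gc) => // s.
  by have /eqP -> : G == F by rewrite eqEcard s; apply: Gmax.
have [GB G0 _] := bchain_mem cc Gc.
have [q qB qG] := subsetPn (bchain_neqB cc Gc).
have [p0 p0G] := set0Pn _ G0.
case: (Order.TotalTheory.arg_maxP (fun l => x 0 l) p0G) => p pG' pmax; have pG : p \in G by [].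
have pB := subsetP GB _ pG.
have hq l : l \in B -> x 0 l <= x 0 q.
  move=> lB; apply: h => // F /cG/subsetP s /s.
  by rewrite (negbTE qG).
(* The coefficient of the largest member [G] is the jump from the maximum of [x] on [G] to its value
   outside [G], where [x] is constant. Closing this jump leaves a point for the chain without
   [G]. *)
pose aG := x 0 q - x 0 p; have aG0 : 0 <= aG by rewrite subr_ge0 hq.
pose x' := \row_l (x 0 l + aG * (l \in G)%:R).
have [||a [t [a0 ha]]] := IH (c :\ G) x' _ (sub_bchain (subD1set _ _) cc).
- by move: cm; rewrite (cardsD1 G) Gc.
- move=> b b' bB b'B hb; rewrite !mxE.
  have [bG|bG] := boolP (b \in G); have [b'G|b'G] := boolP (b' \in G).
  + rewrite lerD2r h // => F Fc; case: (eqVneq F G) => [->//|FG].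
    by apply: hb; rewrite !inE FG.
  + rewrite mulr0 mulr1 addr0; have -> : x 0 b' = x 0 q.
      apply/eqP; rewrite eq_le hq // h // => F /cG/subsetP s /s.
      by rewrite (negbTE b'G).
    by rewrite /aG; have : x 0 b <= x 0 p := pmax _ bG; lra.
  + have -> : x 0 b' = x 0 p.
      apply/eqP; rewrite eq_le (pmax _ b'G : x 0 b' <= x 0 p) /= h // => F Fc b'F.
      case: (eqVneq F G) => [->//|FG]; have := hb F; rewrite !inE FG Fc b'F => /(_ isT isT).
      by move=> /(subsetP (cG _ Fc)); rewrite (negbTE bG).
    by rewrite mulr0 mulr1 addr0 /aG; have : x 0 b <= x 0 q := hq _ bB; lra.
  + rewrite !mulr0 !addr0 h // => F Fc; case: (eqVneq F G) => [->|FG].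
      by rewrite (negbTE b'G).
    by apply: hb; rewrite !inE FG.
exists (fun F => if F == G then aG else a F), t; split.
  by move=> F Fc; case: eqP => // /eqP FG; apply: a0; rewrite !inE FG.
move=> l lB; have := ha _ lB; rewrite mxE (big_setD1 G Gc) /= eqxx.
rewrite [X in _ -> _ = t - (_ + X)](eq_bigr (fun F => a F * (l \in F)%:R)).
  by move=> e; rewrite opprD addrCA -e; ring.
by move=> F; rewrite !inE => /andP[/negbTE->].
Qed.

Lemma braid_ineqs_ucone B j c x : bchain B c -> j \in B -> realspace (B :\ j) x ->
  braid_ineqs B c x -> ucone (cv B j) c x.
Proof.
move=> cc jB rx /(braid_decomposition cc)[a [t [a0 ha]]]; exists a; split=> //.
have t0 : t = \sum_(F in c) a F * (j \in F)%:R.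
  by have := ha _ jB; rewrite rx ?inE ?eqxx // => /esym/eqP; rewrite subr_eq0 => /eqP.
apply/rowP => l; rewrite braid_entry; case: ifP => lB.
  by rewrite ha // t0 -sumrB; apply: eq_bigr => F _; rewrite mulrBr.
by rewrite rx // !inE lB andbF.
Qed.

Lemma sublevels_ineqs B x : braid_ineqs B (sublevels B x) x.
Proof.
move=> a b aB bB h; rewrite leNgt; apply/negP => ab.
have : a \in [set a in B | x 0 a <= x 0 b].
  apply: h; last by rewrite inE bB lexx.
  rewrite inE; apply/andP; split; first by apply/existsP; exists b; rewrite bB eqxx.
  apply/eqP => e; have : a \in B by []; rewrite -e inE aB leNgt ab.
  by [].
by rewrite inE aB leNgt ab.
Qed.

(** Turns inclusions and intersections of cones into those of chains, and gives the multiplicities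
    of fans with such cells. *)
Lemma ucone_braidP B j c x : bchain B c -> j \in B ->
  ucone (cv B j) c x <-> realspace (B :\ j) x /\ sublevels B x \subset c.
Proof.
move=> cc jB; split=> [h|[rx s]].
  split; first exact: braid_realspace h.
  exact/braid_ineqs_sublevels/ucone_braid_ineqs/h.
apply: ucone_mono s _ _.
by apply: braid_ineqs_ucone => //; [exact: sublevels_bchain|exact: sublevels_ineqs].
Qed.

Lemma sublevels_interior B j c : bchain B c -> j \in B ->
  sublevels B (\sum_(F in c) 1 *: int_vec (cv B j F) : 'rV[R]_N) = c.
Proof.
move=> cc jB; set x := \sum_(F in c) _.
have xc : ucone (cv B j) c x by exists (fun=> 1); split=> // F _; rewrite ler01.
have [rx s] := (ucone_braidP x cc jB).1 xc.
apply/eqP; rewrite eqEsubset s; apply/subsetP => F Fc; apply: contraT => nF.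
have : ucone (cv B j) (sublevels B x) x by apply/ucone_braidP; rewrite ?sublevels_bchain.
case=> a [_ xa].
have key : x = \sum_(F in c) (if F \in sublevels B x then a F else 0) *: int_vec (cv B j F).
  rewrite {1}xa [RHS](big_setID (sublevels B x)) /= (setIidPr s) [X in _ + X]big1 ?addr0.
    by apply: eq_bigr => G ->.
  by move=> G; rewrite inE => /andP[/negbTE-> _]; rewrite scale0r.
have := unimodular_coef (a := fun=> 1) (bchain_unimodular j cc) key Fc.
by rewrite (negbTE nF) => /eqP; rewrite oner_eq0.
Qed.

Lemma braid_sub B j c c' : bchain B c -> bchain B c' -> j \in B ->
  (@ucone R N _ (cv B j) c `<=` ucone (cv B j) c')%classic -> c \subset c'.
Proof.
move=> cc cc' jB s; rewrite -[c](sublevels_interior cc jB).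
apply: (proj2 ((ucone_braidP _ cc' jB).1 _)); apply: s; exists (fun=> 1).
by split=> // F _; rewrite ler01.
Qed.

Lemma braid_inj B j c c' : bchain B c -> bchain B c' -> j \in B ->
  @ucone R N _ (cv B j) c = ucone (cv B j) c' -> c = c'.
Proof.
move=> cc cc' jB e; apply/eqP.
by rewrite eqEsubset (braid_sub cc cc' jB) ?(braid_sub cc' cc jB) ?e.
Qed.

Lemma braid_setI B j c c' : bchain B c -> bchain B c' -> j \in B ->
  (@ucone R N _ (cv B j) c `&` ucone (cv B j) c')%classic = ucone (cv B j) (c :&: c').
Proof.
move=> cc cc' jB; have cI : bchain B (c :&: c') by apply: sub_bchain cc; apply: subsetIl.
apply/classical_sets.seteqP; split=> x.
  case=> /(ucone_braidP _ cc jB)[rx s] /(ucone_braidP _ cc' jB)[_ s'].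
  by apply/ucone_braidP => //; rewrite subsetI s.
by move=> h; split; apply: ucone_mono h; [apply: subsetIl|apply: subsetIr].
Qed.

Lemma braid_polyhedron B j c : bchain B c -> j \in B ->
  is_polyhedron (B :\ j) (@ucone R N _ (cv B j) c).
Proof.
move=> cc jB.
pose P (ab : 'I_N * 'I_N) := [&& ab.1 \in B, ab.2 \in B &
  [forall F in c, (ab.2 \in F) ==> (ab.1 \in F)]].
exists [seq (delta_mx 0 ab.1 - delta_mx 0 ab.2, 0) | ab <- enum P].
have pE a b x : pairing (delta_mx 0 a - delta_mx 0 b) x = x 0 a - x 0 b.
  by rewrite pairingDl pairingNl !pairing_delta.
apply/classical_sets.seteqP; split=> x.
  move=> xc; split; first exact: braid_realspace xc.
  move=> _ /mapP[[a b] + ->]; rewrite mem_enum => /and3P[/= aB bB /'forall_implyP h].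
  rewrite pE subr_le0; apply: (ucone_braid_ineqs xc) => // F Fc bF.
  by have := h _ Fc; rewrite bF.
case=> rx h; apply: braid_ineqs_ucone => // a b aB bB hab.
rewrite -subr_le0 -pE; apply: (h (_, _)); apply/mapP; exists (a, b) => //.
rewrite mem_enum; apply/and3P; split=> //=; apply/'forall_implyP => F Fc.
by apply/implyP; apply: hab.
Qed.

Definition braid_cells B j (C : {set {set {set 'I_N}}}) : set (set 'rV[R]_N) :=
  [set ucone (cv B j) c | c in [set` C]]%classic.

Lemma braid_complex B j (C : {set {set {set 'I_N}}}) : j \in B ->
  (forall c, c \in C -> bchain B c) ->
  (forall c c', c \in C -> c' \subset c -> c' \in C) ->
  is_complex (B :\ j) (braid_cells B j C).
Proof.
move=> jB hC sC; split.
- by apply: finite_image; apply: finite_finset.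
- move=> _ [c cC <-]; split; first exact/braid_polyhedron/jB/hC.
  by exists 0; apply: ucone0.
- move=> _ F [c cC <-] /(ucone_faceP _ (bchain_unimodular j (hC _ cC)))[c' s ->].
  by exists c' => //; apply: sC s.
move=> _ _ [c cC <-] [c' c'C <-] _; rewrite braid_setI ?hC //.
by split; apply: ucone_face; rewrite ?subsetIl ?subsetIr //; apply/bchain_unimodular/hC.
Qed.

Lemma pdim_braid B j c : bchain B c -> pdim (@ucone R N _ (cv B j) c) = #|c|%:Z.
Proof. by move=> cc; rewrite pdim_ucone //; apply: bchain_unimodular. Qed.

(** Every cell containing [x] contains the cone of its sublevel chain, which at a generic point has
    dimension at least [k]; so this cone is the only possible facet at [x]. *)
Lemma braid_mult (k : nat) B j (C : {set {set {set 'I_N}}}) (X : wcomplex R N) x : j \in B ->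
  (forall c, c \in C -> bchain B c) ->
  (forall c c', c \in C -> c' \subset c -> c' \in C) ->
  cells X = braid_cells B j C -> generic k X x ->
  mult k X x = if [&& `[< realspace (B :\ j) x >], sublevels B x \in C & #|sublevels B x| == k]
    then weight X (ucone (cv B j) (sublevels B x)) else 0.
Proof.
move=> jB hC sC eX gx.
have inC c : c \in C -> ucone (cv B j) c x ->
    [/\ `[< realspace (B :\ j) x >], sublevels B x \subset c,
        sublevels B x \in C & (k <= #|sublevels B x|)%N].
  move=> cC /(ucone_braidP _ (hC _ cC) jB)[rx s].
  have sxC := sC _ _ cC s; split=> //; first exact/asboolP.
  rewrite -lez_nat -(pdim_braid j (sublevels_bchain B x)); apply: gx.
    by rewrite eX; exists (sublevels B x).
  by apply/ucone_braidP => //; apply: sublevels_bchain.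
rewrite /mult; case: ifP => [/and3P[/asboolP rx sxC /eqP sk]|h].
  rewrite (_ : [set F | _]%classic = [set ucone (cv B j) (sublevels B x)]%classic).
    by rewrite fsbig_set1.
  apply/classical_sets.seteqP; split=> F.
    case=> -[]; rewrite eX => -[c cC <-]; rewrite pdim_braid ?hC // => -[kc] xc.
    have [_ s _ _] := inC _ cC xc.
    by have /eqP <- : sublevels B x == c by rewrite eqEcard s kc sk leqnn.
  move=> ->; split; last by apply/ucone_braidP => //; apply: sublevels_bchain.
  split; first by rewrite eX; exists (sublevels B x).
  by rewrite pdim_braid ?sublevels_bchain // sk.
apply: fsbig1 => F [[]]; rewrite eX => -[c cC <-]; rewrite pdim_braid ?hC // => -[kc] xc.
have [rx s sxC kle] := inC _ cC xc; move: h; rewrite rx sxC /= => /negP[].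
by rewrite eqn_leq kle andbT -kc subset_leq_card.
Qed.

Lemma affine_chart_cone B j c : j \in B -> 
  (affine_chart B j @` chain_cone c)%classic = @ucone R N _ (cv B j) c.
Proof.
move=> jB; have ch a : affine_chart B j (\sum_(F in c) a F *: flat_vec F) =
    \sum_(F in c) a F *: @int_vec R N (cv B j F).
  apply/rowP => l; rewrite braid_entry mxE; case: ifP => // lB.
  rewrite !summxE -sumrB; apply: eq_bigr => F _; rewrite !mxE -mulrBr; congr (_ * _).
  have fE m : (- \sum_(l in F) @delta_mx R 1 N 0 l) 0 m = - (m \in F)%:R.
    rewrite mxE summxE; congr (- _); have [mF|mF] := boolP (m \in F).
      rewrite (bigD1 m) //= mxE !eqxx big1 ?addr0 // => s /andP[_ sm].
      by rewrite mxE eqxx eq_sym (negbTE sm).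
    rewrite big1 // => s sF; rewrite mxE eqxx.
    by case: eqP mF => // ->; rewrite sF.
  by have := fE l; have := fE j; rewrite !mxE => -> ->; ring.
apply/classical_sets.seteqP; split=> x.
  by case=> _ [a [a0 ->]] <-; rewrite ch; exists a.
case=> a [a0 ->]; exists (\sum_(F in c) a F *: flat_vec F); last exact: ch.
by exists a.
Qed.

End Braid.

(** * Bergman fans are cycles *)

Section BergmanCycle.
Local Open Scope ring_scope.
Context {R : realType} {N : nat}.
Implicit Types (A B F G H : {set 'I_N}) (c e : {set {set 'I_N}}) (j l : 'I_N) (M : rankdata N).

Lemma cv0 B j : cv B j set0 = 0.
Proof. by apply/rowP => l; rewrite !mxE !in_set0 subrr if_same. Qed.

Lemma cv_ground B j : j \in B -> cv B j B = 0.
Proof. by move=> jB; apply/rowP => l; rewrite !mxE jB; case: (l \in B); rewrite ?subrr. Qed.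

Definition chains_of_flats M : {set {set {set 'I_N}}} := [set c | is_chain_of_flats M c].

Lemma loopless_fan_cells M j : j \in ground M ->
  cells (@loopless_fan R N M j) = braid_cells (ground M) j (chains_of_flats M).
Proof.
move=> jE; apply/classical_sets.seteqP; split=> P [c cc <-].
  by exists c; rewrite ?affine_chart_cone //= inE.
by exists c; rewrite ?affine_chart_cone //; move: cc; rewrite /= inE.
Qed.

Lemma chains_of_flats_bchain M c : c \in chains_of_flats M -> bchain (ground M) c.
Proof. by rewrite inE; apply: chain_of_flats_bchain. Qed.

Lemma sub_chains_of_flats M c c' : c \in chains_of_flats M -> c' \subset c ->
  c' \in chains_of_flats M.
Proof. by rewrite !inE => cc s; apply: sub_chain cc. Qed.

Section Fillers.
Context (M : rankdata N) (mM : is_matroid M) (loopless : is_flat M set0).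
Context (j : 'I_N) (jE : j \in ground M).
Notation E := (ground M).
Notation r := (rk M).

(** This is the balancing of the Bergman fan: [G1] and [G2] belong to [e], or are [set0] or [E] and
    have the vector 0. *)
Lemma fillers_sum e G1 G2 : is_flat M G1 -> is_flat M G2 -> G1 \proper G2 ->
  r G2 = (r G1).+2 ->
  fillers M e = [set F | [&& is_flat M F, G1 \proper F & F \proper G2]] ->
  \sum_(F in fillers M e) cv E j F = cv E j G2 + cv E j G1 *~ (#|fillers M e|%:Z - 1).
Proof.
move=> f1 f2 s12 r12 he.
have cnt l : (#|[set F in fillers M e | l \in F]|%:R : int) =
    (l \in G2)%:R + (l \in G1)%:R * (#|fillers M e|%:Z - 1).
  have := congr1 (fun n => n%:R : int) (fillers_count mM l f1 f2 s12 r12 he).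
  rewrite /= !natrD natrM => h.
  apply: (addIr (l \in G1)%:R); rewrite h natz; ring.
have sE l : \sum_(F in fillers M e) (l \in F)%:R = #|[set F in fillers M e | l \in F]|%:R :> int.
  rewrite -sum1_card natr_sum [RHS](eq_bigl (fun F => (F \in fillers M e) && (l \in F))).
    by rewrite big_mkcondr; apply: eq_bigr => F _; case: (l \in F).
  by move=> F; rewrite inE.
apply/rowP => l; rewrite summxE [RHS]mxE mulrz_rowE !mxE.
have [lE|lE] := boolP (l \in E); last first.
  by rewrite mulr0 addr0 big1 // => F _; rewrite mxE (negbTE lE).
rewrite (eq_bigr (fun F : {set 'I_N} => (j \in F)%:R - (l \in F)%:R)); last first.
  by move=> F _; rewrite mxE lE.
rewrite sumrB !sE !cnt; ring.
Qed.

Lemma cv_mem_span e G : G \in set0 |: e -> @int_vec R N (cv E j G) \in ucspan (cv E j) e.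
Proof.
rewrite !inE => /orP[/eqP->|Ge]; first by rewrite cv0 int_vec0 rpred0.
by apply/ucone_lin/ucone_gen.
Qed.

Lemma cv_mem_spanE e G : G \in E |: e -> @int_vec R N (cv E j G) \in ucspan (cv E j) e.
Proof.
rewrite !inE => /orP[/eqP->|Ge]; first by rewrite cv_ground // int_vec0 rpred0.
by apply/ucone_lin/ucone_gen.
Qed.

Lemma fillersP e F : is_chain_of_flats M e -> reflect (exists2 c,
  [/\ is_chain_of_flats M c, e \subset c & #|c| = #|e|.+1] & c = F |: e) (F \in fillers M e).
Proof.
move=> ec; rewrite inE; apply: (iffP andP) => [[Fe Fc]|[c [cc s cn] ce]].
  by exists (F |: e) => //; split=> //; [apply: subsetUr|rewrite cardsU1 Fe].
rewrite -ce; split=> //; apply/negP => Fe.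
by move: cn; rewrite ce (setUidPr _) ?sub1set // => /n_Sn.
Qed.

Lemma chain_succ_filler e c : is_chain_of_flats M c -> e \subset c -> #|c| = #|e|.+1 ->
  exists2 F, F \in fillers M e & c = F |: e.
Proof.
move=> cc s cn; have := cardsD c e; rewrite (setIidPr s) cn subSnn => /eqP/cards1P[F eF].
have cE : c = F |: e.
  rewrite -eF; apply/setP => H; rewrite !inE.
  by have [/(subsetP s) ->|] := boolP (H \in e); rewrite ?orbT ?orbF.
exists F => //; have ec := sub_chain s cc.
by apply/fillersP => //; exists c.
Qed.

Lemma loopless_fan_cycle k : r E = k.+1 ->
  is_cycle k%:Z (E :\ j) (@loopless_fan R N M j).
Proof.
move=> rE; have cE := loopless_fan_cells jE.
split.
- rewrite cE; apply: braid_complex => //; first exact: chains_of_flats_bchain.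
  exact: sub_chains_of_flats.
- rewrite cE => P [c cc <-] {P}; move: cc; rewrite /= inE => cc.
  have [c' [cc' s k']] := chain_extend mM loopless cc.
  exists (ucone (cv E j) c'); last exact: ucone_mono.
  split; first by rewrite cE; exists c' => //=; rewrite inE.
  by rewrite pdim_braid ?chain_of_flats_bchain // k' rE.
move=> P [+ dP]; rewrite cE => -[e]; rewrite /= inE => ec eP; subst P.
move: dP; rewrite pdim_braid ?chain_of_flats_bchain // => ek.
have {}ek : #|e|.+1 = k by move: ek; clear; lia.
have [G1 [G2 [[f1 f2 s12] G1e G2e r12 he]]] : _ := chain_codim1 mM loopless ec (etrans (congr1 S ek) (esym rE)).
apply/(balanced_uconeP (Te := fillers M e)).
- move=> F; split.
    case=> -[+ dF] s; rewrite cE => -[c]; rewrite /= inE => cc cF; subst F.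
    move: dF; rewrite pdim_braid ?chain_of_flats_bchain // => -[ck].
    have sec := braid_sub (chain_of_flats_bchain ec) (chain_of_flats_bchain cc) jE s.
    have [|F Ff cFe] := chain_succ_filler cc sec; first by rewrite ck -ek.
    by exists F; rewrite // cFe.
  case=> H /(fillersP _ ec)[c [cc s cn] cH ->]; rewrite -cH; split; last exact: ucone_mono.
  split; first by rewrite cE; exists c => //=; rewrite inE.
  by rewrite pdim_braid ?chain_of_flats_bchain // cn ek.
- move=> F F' /(fillersP _ ec)[c [cc s cn] cF] /(fillersP _ ec)[c' [cc' s' cn'] cF'] /=.
  rewrite -cF -cF' => /braid_inj-/(_ (chain_of_flats_bchain cc) (chain_of_flats_bchain cc') jE) ecc.
  have : F' \in c by rewrite ecc cF' setU11.
  rewrite cF !inE => /orP[/eqP->//|F'e]; move: cn'; rewrite cF' (setUidPr _) ?sub1set //.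
  by move=> /n_Sn.
- move=> F Ff; have [Fe Fc] : F \notin e /\ is_chain_of_flats M (F |: e).
    by apply/andP; move: Ff; rewrite inE.
  by split=> //; apply: bchain_unimodular; apply: chain_of_flats_bchain.
rewrite (eq_bigr (fun F => int_vec (cv E j F))); last by move=> F _; rewrite mulr1z.
rewrite -int_vec_sum (fillers_sum f1 f2 s12 r12 he) int_vecD int_vecMz.
by rewrite rpredD ?cv_mem_spanE // rpredZ // cv_mem_span.
Qed.

End Fillers.

Lemma wzero_cycle k A : is_cycle k A (@wzero R N).
Proof. by split=> [|P []|E [[]]] //; split=> // [|P Q []|P Q []]. Qed.

Lemma bergman_cycle M j k : is_matroid M -> j \in ground M -> rk M (ground M) = k.+1 ->
  is_tcycle k%:Z (ground M :\ j) (bergman R M j).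
Proof.
move=> mM jE rE I; rewrite /bergman; case: (boolP ((I == loops M) && _)) => h; last first.
  by case: ifP => // _; apply: wzero_cycle.
case/andP: h => /eqP -> jL; rewrite subsetD1 loops_subE jL /=.
rewrite (_ : (_ :\ j) :\: _ = (ground M :\: loops M) :\ j); last first.
  by apply/setP => l; rewrite !inE; case: (l == j); rewrite //= andbF.
apply: (loopless_fan_cycle (M := mdelete M (loops M))) => //.
- exact: matroid_mdelete.
- exact: loopless_mdelete.
- by rewrite /= inE jL.
- by rewrite /= rk_ground_noloops.
Qed.

Lemma bergman_loop M j : j \in loops M -> bergman R M j = fun=> wzero.
Proof. by move=> jL; apply/funext => I; rewrite /bergman jL andbF. Qed.

Lemma wzero_tcycle k (S : {set 'I_N}) : is_tcycle k S (fun=> @wzero R N).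
Proof. by move=> I; case: ifP => // _; apply: wzero_cycle. Qed.

Lemma bergman_effective k (S : {set 'I_N}) M j : effective k S (bergman R M j).
Proof. by move=> I F _; rewrite /bergman; case: ifP => _ [] //. Qed.

End BergmanCycle.

(** * Tropical polynomials *)

Section TropicalPolynomials.
Local Open Scope ring_scope.
Context {R : realType} {N : nat}.
Implicit Types (x : 'rV[R]_N) (m : 'rV[nat]_N) (p : seq 'rV[nat]_N) (L S B A F G : {set 'I_N}).

Definition monoval m x : R := \sum_l x 0 l *+ m 0 l.

(** All polynomials that occur have coefficients 0, so a list of exponent vectors describes them. *)
Definition tpoly p (y : 'rV[\bar R]_N) : \bar R :=
  (\big[maxe/-oo]_(c <- [seq (0%R : R, m) | m <- p])
     (c.1%:E + \sum_l (y 0%R l *+ c.2 0%R l)))%E.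

Lemma tpoly_regular S p : (forall m l, m \in p -> l \notin S -> m 0 l = 0%N) ->
  is_regular S (tpoly p).
Proof.
move=> h; exists [seq (0, m) | m <- p]; split=> // _ l /mapP[m mp ->]; exact: h.
Qed.

Lemma bigmaxe_attained (T : eqType) (s : seq T) (v : T -> R) (t : T) : t \in s ->
  (forall t', t' \in s -> v t' <= v t) -> \big[maxe/-oo%E]_(t <- s) (v t)%:E = (v t)%:E.
Proof.
move=> ts h; apply/le_anti/andP; split; last exact: (le_bigmax_seq _ t xpredT).
by rewrite big_seq; apply: bigmax_le => [|t' t's]; rewrite ?leNye // lee_fin h.
Qed.

Lemma tpoly_sed L p x m : (forall m' l, m' \in p -> l \in L -> m' 0 l = 0%N) -> m \in p ->
  (forall m', m' \in p -> monoval m' x <= monoval m x) ->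
  tpoly p (sed L x) = (monoval m x)%:E.
Proof.
move=> hL mp h; rewrite /tpoly big_map /=.
rewrite -(bigmaxe_attained (v := fun m => monoval m x) mp h) big_seq [RHS]big_seq.
apply: eq_bigr => m' m'p; rewrite add0e -sumEFin; apply: eq_bigr => l _; rewrite mxE.
(* A coordinate equal to -oo has exponent 0 and contributes 0. *)
case: ifP => lL; first by rewrite (hL _ _ m'p lL) !mulr0n.
by rewrite EFin_natmul.
Qed.

End TropicalPolynomials.

(** * The polynomials attached to a family of sets *)

Section FamilyPolynomials.
Local Open Scope ring_scope.
Context {R : realType} {N : nat} (B : {set 'I_N}) (j : 'I_N) (jB : j \in B).
Context (AA : {set {set 'I_N}}) (AA_neq0 : AA != set0).
Context (AAB : forall A : {set 'I_N}, A \in AA -> A \subset B /\ A != set0).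
Implicit Types (x : 'rV[R]_N) (m : 'rV[nat]_N) (A F G : {set 'I_N}) (D c : {set {set 'I_N}}).
Notation sel := {ffun {set 'I_N} -> 'I_N}.
Implicit Type s : sel.

(** A sum of maxima expands into a maximum over all choices of an element [s A] in each [A]. *)
Definition selections : seq sel :=
  [seq s : sel <- enum {: sel} | [forall A in AA, s A \in A]].

Definition expo D s : 'rV[nat]_N :=
  \row_l (if l == j then 0%N else #|[set A in D | s A == l]|).

(* The polynomials \sum_(A in AA) max_(l in A) x_l and
   max_(A0 in AA) \sum_(A in AA, A <> A0) max_(l in A) x_l, with x_j = 0. *)
Definition sum_poly : seq 'rV[nat]_N := [seq expo AA s | s <- selections].
Definition cosum_poly : seq 'rV[nat]_N :=
  [seq expo (AA :\ A0) s | A0 <- enum AA, s <- selections].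

(* The values at v_F of min_(A in AA) max_(l in A) x_l, of sum_poly and of
   cosum_poly; all three functions are linear on the cones of chains. *)
Definition psi_min F : int := (j \in F)%:R - [exists A in AA, A \subset F]%:R.
Definition psi_sum F : int := \sum_(A in AA) ((j \in F)%:R - (A \subset F)%:R).
Definition psi_cosum F : int := psi_sum F - psi_min F.

Lemma selectionsP s : reflect (forall A, A \in AA -> s A \in A) (s \in selections).
Proof. by rewrite mem_filter mem_enum andbT; apply: (iffP 'forall_implyP). Qed.

Lemma expo_supp D s l : D \subset AA -> s \in selections -> l \notin B :\ j -> expo D s 0 l = 0%N.
Proof.
move=> DA /selectionsP hs; rewrite mxE in_setD1 negb_and negbK; case: eqP => //= _ lB.
apply: eq_card0 => A; rewrite !inE; apply/negP => /andP[AD /eqP sA].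
have AAA := subsetP DA _ AD; have [AB _] := AAB AAA.
by move: lB; rewrite -sA (subsetP AB) ?hs.
Qed.

Lemma sum_poly_supp m l : m \in sum_poly -> l \notin B :\ j -> m 0 l = 0%N.
Proof. by case/mapP => s sP ->; apply: expo_supp. Qed.

Lemma cosum_poly_supp m l : m \in cosum_poly -> l \notin B :\ j -> m 0 l = 0%N.
Proof. by case/allpairsP => -[A0 s] /= [_ sP ->]; apply: expo_supp => //; apply: subD1set. Qed.

Lemma monoval_expo D s x : x 0 j = 0 -> monoval (expo D s) x = \sum_(A in D) x 0 (s A).
Proof.
move=> xj; rewrite /monoval (partition_big s xpredT) //=; apply: eq_bigr => l _.
rewrite mxE; case: eqP => [->|_].
  by rewrite mulr0n big1 // => A /andP[_ /eqP ->].
rewrite (eq_bigr (fun=> x 0 l)) ?sumr_const; last by move=> A /andP[_ /eqP ->].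
by congr (_ *+ _); apply: eq_card => A; rewrite !inE.
Qed.

Section OnCone.
Context (c : {set {set 'I_N}}) (cc : bchain B c) (a : {set 'I_N} -> R).
Context (a0 : forall F, F \in c -> 0 <= a F).
Let x := \sum_(F in c) a F *: @int_vec R N (cv B j F).
(** The value of max_(l in A) x_l at the point [x]. *)
Let mval A := \sum_(F in c) a F * ((j \in F)%:R - (A \subset F)%:R).

Let xj : x 0 j = 0.
Proof. by rewrite braid_entry jB big1 // => F _; rewrite subrr mulr0. Qed.

Let x_le A l : A \subset B -> l \in A -> x 0 l <= mval A.
Proof.
move=> AB lA; rewrite braid_entry (subsetP AB) // ler_sum // => F Fc.
rewrite ler_wpM2l ?a0 // lerD2l lerN2 ler_nat.
by case: (boolP (A \subset F)) => // /subsetP->.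
Qed.

Let x_att A : A \subset B -> A != set0 -> exists2 l, l \in A & x 0 l = mval A.
Proof.
move=> AB A0; have [l lA lP] := chain_last_elt cc A0; exists l => //.
rewrite braid_entry (subsetP AB) //; apply: eq_bigr => F Fc; congr (_ * (_ - _%:R)).
by congr nat_of_bool; apply/idP/idP => [/(lP _ Fc)//|/subsetP->].
Qed.

Let best : exists2 s, s \in selections & forall A, A \in AA -> x 0 (s A) = mval A.
Proof.
have /choice[s hs] : forall A, exists l, A \in AA -> l \in A /\ x 0 l = mval A.
  move=> A; have [AAA|] := boolP (A \in AA); last by exists j.
  by have [AB A0] := AAB AAA; have [l lA e] := x_att AB A0; exists l.
by exists [ffun A => s A] => [|A AAA]; [apply/selectionsP => A AAA|]; rewrite ffunE; case: (hs _ AAA).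
Qed.

(** The minimizing [A0] lies in the smallest member of [c] containing any set of the family, or is
    arbitrary if there is none. Its choice depends on [c] only, which makes the minimum linear on
    the whole cone. *)
Let mval_min : exists2 A0, A0 \in AA &
  mval A0 = \sum_(F in c) a F * (psi_min F)%:~R /\ forall A, A \in AA -> mval A0 <= mval A.
Proof.
have h A : A \in AA -> \sum_(F in c) a F * (psi_min F)%:~R <= mval A.
  move=> AAA; apply: ler_sum => F Fc; rewrite ler_wpM2l ?a0 // intrB !mulrz_nat lerD2l lerN2 ler_nat.
  have [AF|//] := boolP (A \subset F).
  by rewrite (_ : [exists _ in _, _]) //; apply/existsP; exists A; rewrite AAA.
suff [A0 A0A e] : exists2 A0, A0 \in AA & forall F, F \in c ->
    (A0 \subset F) = [exists A in AA, A \subset F].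
  have e' : mval A0 = \sum_(F in c) a F * (psi_min F)%:~R.
    by apply: eq_bigr => F Fc; rewrite intrB !mulrz_nat e.
  by exists A0 => //; split=> // A AAA; rewrite e' h.
have [/existsP[F0 F0P]|/existsPn hn] := boolP [exists F in c, [exists A in AA, A \subset F]].
  case: (@arg_minnP _ F0 (fun F => (F \in c) && [exists A in AA, A \subset F])
    (fun F : {set 'I_N} => #|F|) F0P) => G /andP[Gc /existsP[A0 /andP[A0A A0G]]] Gmin.
  exists A0 => // F Fc; apply/idP/idP => [s|hF]; first by apply/existsP; exists A0; rewrite A0A.
  case/orP: (bchain_total cc Fc Gc) => s; last exact: subset_trans s.
  by have /eqP -> : F == G by rewrite eqEcard s; apply: Gmin; rewrite Fc.
have [A0 A0A] := set0Pn _ AA_neq0; exists A0 => // F Fc.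
have := hn F; rewrite Fc /= => /negbTE ->; apply: negbTE; apply: contra (hn F) => s.
by rewrite Fc; apply/existsP; exists A0; rewrite A0A.
Qed.

Let sum_mval : \sum_(A in AA) mval A = \sum_(F in c) a F * (psi_sum F)%:~R.
Proof.
rewrite exchange_big; apply: eq_bigr => F _; rewrite -mulr_sumr; congr (_ * _).
by rewrite rmorph_sum; apply: eq_bigr => A _; rewrite /= intrB !mulrz_nat.
Qed.

Lemma sum_poly_cone : exists m, [/\ m \in sum_poly,
    monoval m x = \sum_(F in c) a F * (psi_sum F)%:~R &
    forall m', m' \in sum_poly -> monoval m' x <= monoval m x].
Proof.
have [s sP hs] := best; exists (expo AA s); split; first exact: map_f.
  by rewrite monoval_expo // -sum_mval; apply: eq_bigr.
move=> _ /mapP[s' /selectionsP s'P ->]; rewrite !monoval_expo // ler_sum // => A AAA.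
by have [AB _] := AAB AAA; rewrite hs // x_le // s'P.
Qed.

Lemma cosum_poly_cone : exists m, [/\ m \in cosum_poly,
    monoval m x = \sum_(F in c) a F * (psi_cosum F)%:~R &
    forall m', m' \in cosum_poly -> monoval m' x <= monoval m x].
Proof.
have [s sP hs] := best; have [A0 A0A [e0 h0]] := mval_min.
have D1 A1 : A1 \in AA -> \sum_(A in AA :\ A1) mval A = \sum_(A in AA) mval A - mval A1.
  by move=> A1A; rewrite (big_setD1 A1 A1A) /= addrC addrK.
exists (expo (AA :\ A0) s); split.
- by apply/allpairsP; exists (A0, s); rewrite mem_enum.
- rewrite monoval_expo // (eq_bigr mval) => [|A]; last by rewrite inE => /andP[_ /hs].
  rewrite D1 // e0 sum_mval -sumrB; apply: eq_bigr => F _.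
  by rewrite -mulrBr /psi_cosum [in RHS]intrB.
move=> _ /allpairsP[[A1 s'] /= [A1A /selectionsP s'P ->]]; rewrite mem_enum in A1A.
rewrite !monoval_expo //; apply: (@le_trans _ _ (\sum_(A in AA :\ A1) mval A)).
  by apply: ler_sum => A; rewrite inE => /andP[_ AAA]; have [AB _] := AAB AAA; rewrite x_le // s'P.
rewrite [leRHS](eq_bigr mval) => [|A]; last by rewrite inE => /andP[_ /hs].
by rewrite !D1 // lerD2l lerN2 h0.
Qed.

End OnCone.

Let selection_avoiding G D : (forall A, A \in D -> ~~ (A \subset G)) -> D \subset AA ->
  exists2 s, s \in selections & forall l, l \in G -> expo D s 0 l = 0%N.
Proof.
move=> hG DA; have /choice[s hs] : forall A, exists l, A \in AA ->
    l \in A /\ (A \in D -> l \notin G).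
  move=> A; have [AAA|] := boolP (A \in AA); last by exists j.
  have [AB /set0Pn[l lA]] := AAB AAA.
  have [/hG/subsetPn[l' l'A l'G]|AD] := boolP (A \in D); first by exists l'.
  by exists l.
exists [ffun A => s A]; first by apply/selectionsP => A AAA; rewrite ffunE; case: (hs _ AAA).
move=> l lG; rewrite mxE; case: eqP => // _; apply: eq_card0 => A; rewrite !inE ffunE.
apply/negP => /andP[AD /eqP e]; have [_ /(_ AD)] := hs _ (subsetP DA _ AD).
by rewrite e lG.
Qed.

Let psi_sumE G : j \notin G -> psi_sum G = - (#|[set A in AA | A \subset G]|%:Z).
Proof.
move=> jG; rewrite /psi_sum (negbTE jG) sumrB sumr_const mul0rn sub0r -natz; congr (- _).
rewrite -sum1_card natr_sum [RHS](eq_bigl (fun A => (A \in AA) && (A \subset G))).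
  by rewrite big_mkcondr; apply: eq_bigr => A _; case: (A \subset G).
by move=> A; rewrite inE.
Qed.

(** Nonnegativity means that no [A] of the family lies in [G], so every maximum can be represented
    by an element outside [G]. *)
Lemma sum_poly_avoid G : j \notin G -> 0 <= psi_sum G ->
  exists2 m, m \in sum_poly & forall l, l \in G -> m 0 l = 0%N.
Proof.
move=> jG; rewrite psi_sumE // oppr_ge0 lez_nat leqn0 cards_eq0 => /eqP h.
have [A AAA|//|s sP hs] := @selection_avoiding G AA.
  apply/negP => AG; have : A \in [set A in AA | A \subset G] by rewrite inE AAA.
  by rewrite h inE.
by exists (expo AA s) => //; apply: map_f.
Qed.

(** Nonnegativity allows at most one [A] inside [G], and this one can be the set left out of the
    sum. *)
Lemma cosum_poly_avoid G : j \notin G -> 0 <= psi_cosum G ->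
  exists2 m, m \in cosum_poly & forall l, l \in G -> m 0 l = 0%N.
Proof.
move=> jG; rewrite /psi_cosum psi_sumE // /psi_min (negbTE jG) sub0r opprK => h.
have [A0 A0A hA0] : exists2 A0, A0 \in AA & forall A, A \in AA :\ A0 -> ~~ (A \subset G).
  have [/existsP[A1 /andP[A1A A1G]]|/existsPn hn] := boolP [exists A in AA, A \subset G].
    exists A1 => // A; rewrite !inE => /andP[AA1 AAA]; apply/negP => AG.
    have : (1 < #|[set A in AA | A \subset G]|)%N.
      apply/card_gt1P; exists A, A1; rewrite !inE AAA A1A; split=> //.
    move: h; rewrite (_ : [exists _ in _, _]) /=; last by apply/existsP; exists A; rewrite AAA.
    lia.
  have [A0 A0A] := set0Pn _ AA_neq0; exists A0 => // A; rewrite inE => /andP[_ AAA].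
  by have := hn A; rewrite AAA.
have [s sP hs] := selection_avoiding hA0 (subD1set _ _).
exists (expo (AA :\ A0) s) => //; apply/allpairsP; exists (A0, s).
by rewrite mem_enum.
Qed.

End FamilyPolynomials.

(** * Completed graphs over Bergman fans *)

Section CompletedGraph.
Local Open Scope ring_scope.
Context {R : realType} {N : nat} (M : rankdata N) (mM : is_matroid M).
Context (loopless : is_flat M set0) (j i : 'I_N) (jB : j \in ground M) (iB : i \notin ground M).
Context (k : nat) (rB : rk M (ground M) = k.+1).
Notation B := (ground M).
Notation r := (rk M).
Implicit Types (F G : {set 'I_N}) (c e : {set {set 'I_N}}) (l : 'I_N) (x y : 'rV[R]_N).
Notation cvj := (cv B j).

Let bc c : is_chain_of_flats M c -> bchain B c := @chain_of_flats_bchain N M c.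

(** For [e] of codimension one, such coefficients exist by balancing and are unique on [e] by
    independence of the vectors, so any explicit relation may be used to compute the defect. *)
Definition filler_coef e : {ffun {set 'I_N} -> int} :=
  xget 0 [set z : {ffun {set 'I_N} -> int} |
    \sum_(F in fillers M e) cvj F = \sum_(G in e) cvj G *~ z G]%classic.

(* The weight of the facet in direction - e_i needed to balance the graph of the
   piecewise linear function psi at the cone of the codimension one chain e. *)
Definition defect (psi : {set 'I_N} -> int) e : int :=
  \sum_(F in fillers M e) psi F - \sum_(G in e) psi G * filler_coef e G.

Lemma filler_coef_gap e G1 G2 : is_chain_of_flats M e -> is_flat M G1 -> is_flat M G2 ->
  G1 \proper G2 -> r G2 = (r G1).+2 -> G1 \in set0 |: e -> G2 \in B |: e ->
  fillers M e = [set F | [&& is_flat M F, G1 \proper F & F \proper G2]] ->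
  \sum_(F in fillers M e) cvj F =
  \sum_(G in e) cvj G *~ ((G == G2)%:Z + (G == G1)%:Z * (#|fillers M e|%:Z - 1)).
Proof.
move=> ec f1 f2 s12 r12 G1e G2e he; rewrite (fillers_sum mM j f1 f2 s12 r12 he).
rewrite (eq_bigr (fun G => cvj G *~ (G == G2)%:Z +
  (cvj G *~ (G == G1)%:Z) *~ (#|fillers M e|%:Z - 1))); last first.
  by move=> G _; rewrite mulrzDr mulrzA.
(* An end of the gap that is not a member of [e] is [set0] or [B] and has the vector 0. *)
have sE H : cvj H = 0 \/ H \in e -> \sum_(G in e) cvj G *~ (G == H)%:Z = cvj H.
  have [He _|He [->|//]] := boolP (H \in e).
    rewrite (bigD1 H) //= eqxx mulr1z big1 ?addr0 // => G /andP[_ /negbTE->].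
    by rewrite mulr0z.
  rewrite big1 // => G Ge; case: eqP => [e'|_]; last by rewrite mulr0z.
  by move: He; rewrite -e' Ge.
rewrite big_split /= -mulrz_suml !sE //.
- by move: G1e; rewrite !inE => /orP[/eqP->|]; [left; exact: cv0|right].
- by move: G2e; rewrite !inE => /orP[/eqP->|]; [left; exact: cv_ground|right].
Qed.

Lemma filler_coefE e : is_chain_of_flats M e -> #|e|.+1 = k ->
  \sum_(F in fillers M e) cvj F = \sum_(G in e) cvj G *~ filler_coef e G.
Proof.
move=> ec ek; have [|G1 [G2 [[f1 f2 s12] G1e G2e r12 he]]] := chain_codim1 mM loopless ec.
  by rewrite rB -ek.
pose z := [ffun G => (G == G2)%:Z + (G == G1)%:Z * (#|fillers M e|%:Z - 1)].
suff /(xgetI 0) : [set z : {ffun {set 'I_N} -> int} |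
    \sum_(F in fillers M e) cvj F = \sum_(G in e) cvj G *~ z G]%classic z by [].
rewrite /= (filler_coef_gap ec f1 f2 s12 r12 G1e G2e he).
by apply: eq_bigr => G _; rewrite ffunE.
Qed.

Lemma defectE psi e (z : {set 'I_N} -> int) : is_chain_of_flats M e -> #|e|.+1 = k ->
  \sum_(F in fillers M e) cvj F = \sum_(G in e) cvj G *~ z G ->
  defect psi e = \sum_(F in fillers M e) psi F - \sum_(G in e) psi G * z G.
Proof.
move=> ec ek ez; congr (_ - _); apply: eq_bigr => G Ge; congr (_ * _).
have := filler_coefE ec ek; rewrite ez => /(congr1 (@int_vec R N)); rewrite !int_vec_sum.
rewrite (eq_bigr (fun G => (z G)%:~R *: int_vec (cvj G))); last by move=> *; rewrite int_vecMz.
rewrite [RHS](eq_bigr (fun G => (filler_coef e G)%:~R *: int_vec (cvj G))); last first.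
  by move=> *; rewrite int_vecMz.
by move=> /unimodular_coef-/(_ (bchain_unimodular _ (bc ec)) _ Ge) /eqP; rewrite eqr_int => /eqP.
Qed.

Context (psi : {set 'I_N} -> int).

(** [Some F] stands for the lift of v_F to the graph and [None] for -e_i, so that graph cells and
    the facets attached to them are cones over one family of generators. *)
Definition gvec (o : option {set 'I_N}) : 'rV[int]_N :=
  if o is Some F then cvj F + delta_mx 0 i *~ psi F else - delta_mx 0 i.

Definition gcell c : set 'rV[R]_N := ucone gvec (Some @: c).
Definition dcell c : set 'rV[R]_N := ucone gvec (None |: Some @: c).

Lemma delta_row l l' : (delta_mx 0 l : 'rV[int]_N) 0 l' = (l' == l)%:R.
Proof. by rewrite mxE eqxx. Qed.

Lemma big_Some (V : nmodType) (f : option {set 'I_N} -> V) c :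
  \sum_(o in Some @: c) f o = \sum_(F in c) f (Some F).
Proof. by rewrite big_imset //= => F G _ _ []. Qed.

Lemma None_notin_Some c : None \notin Some @: c.
Proof. by apply/imsetP => -[]. Qed.

Lemma card_Some c : #|Some @: c| = #|c|.
Proof. by rewrite card_imset // => F G []. Qed.

Lemma gvec_unimodular c : is_chain_of_flats M c -> unimodular gvec (None |: Some @: c).
Proof.
move=> cc; have [d hd dB] := bchain_dual_basis j (bc cc).
have di F : F \in c -> ipair (d F) (delta_mx 0 i) = 0.
  move=> /dB[p [q [pB qB ->]]]; rewrite ipairBl !ipair_delta !delta_row.
  have ni a : a \in B -> (a == i) = false by move=> aB; apply: contraNF iB => /eqP <-.
  by rewrite !ni // subrr.
have ipD a u v : ipair a (u + v) = ipair a u + ipair a v.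
  by rewrite /ipair -big_split; apply: eq_bigr => l _; rewrite mxE mulrDr.
have ipM a u (z : int) : ipair a (u *~ z) = ipair a u * z.
  rewrite /ipair mulr_suml; apply: eq_bigr => l _; rewrite mulrz_rowE; ring.
have ipDl a b u : ipair (a + b) u = ipair a u + ipair b u.
  by rewrite /ipair -big_split; apply: eq_bigr => l _; rewrite mxE mulrDl.
have ipMl a u (z : int) : ipair (a *~ z) u = ipair a u * z.
  rewrite /ipair mulr_suml; apply: eq_bigr => l _; rewrite mulrz_rowE; ring.
have ipN a u : ipair a (- u) = - ipair a u by rewrite -[- u]mulrN1z ipM mulrN1.
have ipNl a u : ipair (- a) u = - ipair a u by rewrite -[- a]mulrN1z ipMl mulrN1.
have ip_sum (f : {set 'I_N} -> 'rV[int]_N) u :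
    ipair (\sum_(F in c) f F) u = \sum_(F in c) ipair (f F) u.
  rewrite /ipair exchange_big; apply: eq_bigr => l _ /=.
  by rewrite summxE mulr_suml.
(* The functional dual to -e_i: it measures how far a point lies below the graph, the function being
   extended linearly from the cone of [c]. *)
pose dN := - delta_mx 0 i + \sum_(F in c) d F *~ psi F.
have dNF F : F \in c -> ipair dN (cvj F + delta_mx 0 i *~ psi F) = 0.
  move=> Fc; rewrite ipDl ipNl ipair_delta mxE mulrz_rowE delta_row eqxx mulr1 mxE (negbTE iB) add0r.
  rewrite ip_sum (bigD1 F) //= big1 ?addr0 => [|G /andP[Gc GF]].
    by rewrite ipMl ipD ipM di // hd // eqxx mul0r addr0 mul1r addNr.
  by rewrite ipMl ipD ipM di // hd // (negbTE GF) mul0r addr0 mul0r.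
have dNN : ipair dN (- delta_mx 0 i) = 1.
  rewrite ipN ipDl ipNl ipair_delta delta_row eqxx ip_sum big1 ?addr0 ?opprK // => G Gc.
  by rewrite ipMl di // mul0r.
exists (fun o => if o is Some F then d F else dN) => s t.
have inE' o : o \in None |: Some @: c -> o = None \/ exists2 F, F \in c & o = Some F.
  by rewrite !inE => /orP[/eqP->|/imsetP[F Fc ->]]; [left|right; exists F].
move=> /inE'[->|[F Fc ->]] /inE'[->|[G Gc ->]].
- exact: dNN.
- by rewrite dNF.
- by rewrite ipN di // oppr0.
- by rewrite ipD ipM di // mul0r addr0 hd.
Qed.

Lemma gvec_unimodular_Some c : is_chain_of_flats M c -> unimodular gvec (Some @: c).
Proof. by move=> /gvec_unimodular; apply: unimodular_sub; apply: subsetUr. Qed.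

Lemma gcellP c y : gcell c y <-> exists a : {set 'I_N} -> R, (forall F, F \in c -> 0 <= a F) /\
  y = \sum_(F in c) a F *: int_vec (cvj F) + (\sum_(F in c) a F * (psi F)%:~R) *: delta_mx 0 i.
Proof.
have e (a : {set 'I_N} -> R) : \sum_(F in c) a F *: @int_vec R N (gvec (Some F)) =
    \sum_(F in c) a F *: int_vec (cvj F) + (\sum_(F in c) a F * (psi F)%:~R) *: delta_mx 0 i.
  rewrite scaler_suml -big_split; apply: eq_bigr => F _ /=.
  rewrite int_vecD int_vecMz scalerDr scalerA; congr (_ + _ *: _).
  by apply/rowP => l; rewrite !mxE; case: (_ && _).
split=> -[a [a0 ->]].
  exists (fun F => a (Some F)); split; first by move=> F Fc; apply/a0/imset_f.
  by rewrite big_Some e.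
exists (fun o => if o is Some F then a F else 0); split.
  by move=> _ /imsetP[F Fc ->]; apply: a0.
by rewrite big_Some e.
Qed.

Lemma dcellE c : dcell c = downward i (gcell c).
Proof.
have dE : @int_vec R N (- delta_mx 0 i) = - delta_mx 0 i.
  by rewrite int_vecN; congr (- _); apply/rowP => l; rewrite !mxE; case: (_ && _).
apply/classical_sets.seteqP; split=> y.
  case=> a [a0 ->]; rewrite big_setU1 ?None_notin_Some //=.
  exists (\sum_(o in Some @: c) a o *: int_vec (gvec o)), (a None); split.
  - by exists a; split=> // o oc; apply: a0; rewrite !inE oc orbT.
  - by apply: a0; rewrite !inE eqxx.
  - by rewrite dE scalerN addrC.
case=> _ [t [[a [a0 ->]] t0 ->]].
exists (fun o => if o is Some F then a o else t); split.
  by case=> [F|//]; rewrite !inE /= => Fc; apply: a0.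
by rewrite big_setU1 ?None_notin_Some //= dE scalerN addrC !big_Some.
Qed.

Lemma forget_delta c (a : {set 'I_N} -> R) (t : R) :
  forget i (\sum_(F in c) a F *: int_vec (cvj F) + t *: delta_mx 0 i) =
  \sum_(F in c) a F *: int_vec (cvj F).
Proof.
rewrite /forget mxE braid_entry (negbTE iB) add0r !mxE !eqxx mulr1.
by rewrite addrK.
Qed.

Lemma gcell_forget c y : gcell c y -> ucone cvj c (forget i y).
Proof. by case/gcellP => a [a0 ->]; rewrite forget_delta; exists a. Qed.

Lemma dcell_forget c y : dcell c y -> ucone cvj c (forget i y).
Proof.
rewrite dcellE => -[x [t [/gcellP[a [a0 ->]] _ ->]]].
by rewrite -addrA -scaleNr -scalerDl forget_delta; exists a.
Qed.

Lemma gcell_mono c c' : c' \subset c -> (gcell c' `<=` gcell c)%classic.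
Proof. by move=> s; apply: ucone_mono; apply: imsetS. Qed.

Lemma ucone_gcell c (x : 'rV[R]_N) : ucone cvj c x -> exists2 y, gcell c y & forget i y = x.
Proof.
case=> a [a0 ->].
exists (\sum_(F in c) a F *: int_vec (cvj F) + (\sum_(F in c) a F * (psi F)%:~R) *: delta_mx 0 i).
  by apply/gcellP; exists a.
exact: forget_delta.
Qed.

Lemma gcell_sub c c' (P : set 'rV[R]_N) : is_chain_of_flats M c -> is_chain_of_flats M c' ->
  (forall y, P y -> ucone cvj c' (forget i y)) -> (gcell c `<=` P)%classic -> c \subset c'.
Proof.
move=> cc cc' hP s; apply: (braid_sub (R := R) (bc cc) (bc cc') jB) => x /ucone_gcell[y yc <-].
exact/hP/s.
Qed.

Lemma gcell_dcell c : (gcell c `<=` dcell c)%classic.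
Proof. by apply: ucone_mono; apply: subsetUr. Qed.

Lemma gcell_inj c c' : is_chain_of_flats M c -> is_chain_of_flats M c' ->
  gcell c = gcell c' -> c = c'.
Proof.
move=> cc cc' e; apply/eqP; rewrite eqEsubset.
rewrite (gcell_sub cc cc' (@gcell_forget c')) ?e //=.
by rewrite (gcell_sub cc' cc (@gcell_forget c)) ?e.
Qed.

Lemma dcell_inj c c' : is_chain_of_flats M c -> is_chain_of_flats M c' ->
  dcell c = dcell c' -> c = c'.
Proof.
move=> cc cc' e; apply/eqP; rewrite eqEsubset.
rewrite (gcell_sub cc cc' (@dcell_forget c')) -?e /=; last exact: gcell_dcell.
by rewrite (gcell_sub cc' cc (@dcell_forget c)) ?e //; apply: gcell_dcell.
Qed.

(** The vector -e_i projects to 0, above which a graph cell contains only the origin. This keeps the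
    two kinds of cells apart when weights are read off. *)
Lemma gcell_neq_dcell c c' : is_chain_of_flats M c -> gcell c <> dcell c'.
Proof.
move=> cc e; have : gcell c (int_vec (gvec None)).
  by rewrite e; apply: ucone_gen; rewrite !inE eqxx.
case/gcellP => a [a0 ea].
have z : \sum_(F in c) a F *: @int_vec R N (cvj F) = \sum_(F in c) 0 *: int_vec (cvj F).
  rewrite -(forget_delta c a (\sum_(F in c) a F * (psi F)%:~R)) -ea.
  rewrite [RHS]big1; last by move=> *; rewrite scale0r.
  apply/rowP => l; rewrite !mxE !eqxx /=.
  by case: eqP => _; rewrite ?mulr1n ?mulr0n /= ?oppr0 ?mulr0 ?mulr1 subrr.
have a00 := unimodular_coef (a := a) (b := fun=> 0) (bchain_unimodular j (bc cc)) z.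
have := congr1 (fun y : 'rV[R]_N => y 0 i) ea.
rewrite !mxE !eqxx braid_entry (negbTE iB) add0r mulr1 big1; last first.
  by move=> F Fc; rewrite a00 // mul0r.
by move/eqP; rewrite /= rmorphN /= oppr_eq0 oner_eq0.
Qed.

Lemma pdim_gcell c : is_chain_of_flats M c -> pdim (gcell c) = #|c|%:Z.
Proof. by move=> cc; rewrite pdim_ucone ?card_Some //; apply: gvec_unimodular_Some. Qed.

Lemma pdim_dcell c : is_chain_of_flats M c -> pdim (dcell c) = #|c|.+1%:Z.
Proof.
move=> cc; rewrite pdim_ucone; last exact: gvec_unimodular.
by rewrite cardsU1 None_notin_Some card_Some.
Qed.

(** Subchains are included because each attached facet comes with the downward cells over the faces
    of its base. *)
Definition unbalanced_chains : {set {set {set 'I_N}}} :=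
  [set c : {set {set 'I_N}} | [exists e : {set {set 'I_N}},
     [&& is_chain_of_flats M e, #|e|.+1 == k, defect psi e != 0 & c \subset e]]].

Lemma unbalancedP c : reflect (exists e, [/\ is_chain_of_flats M e, #|e|.+1 = k,
    defect psi e != 0 & c \subset e]) (c \in unbalanced_chains).
Proof.
rewrite inE; apply: (iffP existsP) => -[e].
  by case/and4P => h1 /eqP h2 h3 h4; exists e.
by case=> h1 h2 h3 h4; exists e; rewrite h1 h2 h3 h4 eqxx.
Qed.

Lemma unbalanced_chain c : c \in unbalanced_chains -> is_chain_of_flats M c.
Proof. by case/unbalancedP => e [ec _ _ s]; apply: sub_chain ec. Qed.

(** The weight function receives a bare set, so the chain of a downward cell is recovered by choice;
    it is unique by [dcell_inj]. *)
Definition completed_graph : wcomplex R N := WComplex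
  ([set gcell c | c in [set` chains_of_flats M]] `|`
   [set dcell c | c in [set` unbalanced_chains]])%classic
  (fun P => if `[< exists2 c, is_chain_of_flats M c & P = gcell c >] then 1
            else defect psi (xget set0 [set e | is_chain_of_flats M e /\ P = dcell e]%classic)).

Lemma weight_gcell c : is_chain_of_flats M c -> weight completed_graph (gcell c) = 1.
Proof. by move=> cc /=; case: asboolP => // -[]; exists c. Qed.

Lemma weight_dcell e : is_chain_of_flats M e -> weight completed_graph (dcell e) = defect psi e.
Proof.
move=> ec /=; case: asboolP => [[c cc e']|_].
  by case: (gcell_neq_dcell cc (esym e')).
by congr (defect psi _); apply: xget_unique => // e' [e'c /dcell_inj ->].
Qed.

Let delta_span e (z : int) : is_chain_of_flats M e ->
  @int_vec R N (delta_mx 0 i *~ z) \in ucspan gvec (Some @: e) -> z = 0.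
Proof.
move=> ec /ucspanP[a]; rewrite big_Some int_vecMz => h.
have dN : @int_vec R N (gvec None) = - int_vec (delta_mx 0 i) by rewrite int_vecN.
have key : \sum_(o in None |: Some @: e) (if o is Some F then a (Some F) else z%:~R) *:
    @int_vec R N (gvec o) = \sum_(o in None |: Some @: e) 0 *: int_vec (gvec o).
  rewrite [RHS]big1; last by move=> *; rewrite scale0r.
  by rewrite big_setU1 ?None_notin_Some //= big_Some -h dN scalerN addNr.
have := unimodular_coef (gvec_unimodular ec) key (setU11 _ _).
by move=> /eqP; rewrite intr_eq0 => /eqP.
Qed.

Let sum_gvec e : is_chain_of_flats M e -> #|e|.+1 = k ->
  \sum_(F in fillers M e) gvec (Some F) =
  \sum_(G in e) gvec (Some G) *~ filler_coef e G + delta_mx 0 i *~ defect psi e.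
Proof.
move=> ec ek; rewrite big_split /= filler_coefE // -mulrz_sumr.
rewrite [X in _ = X + _](eq_bigr (fun G => cvj G *~ filler_coef e G +
  delta_mx 0 i *~ (psi G * filler_coef e G))).
  rewrite big_split /= -mulrz_sumr -addrA -mulrzDr; congr (_ + _ *~ _).
  by rewrite /defect addrC subrK.
by move=> G _; rewrite mulrzDl mulrzA.
Qed.

(** The lifts of the fillers add up to a combination of the lifts of [e] plus [defect psi e] times
    e_i, and e_i is independent of these lifts. *)
Lemma sum_gvec_span e (w : int) : is_chain_of_flats M e -> #|e|.+1 = k ->
  @int_vec R N (\sum_(F in fillers M e) gvec (Some F) - delta_mx 0 i *~ w)
    \in ucspan gvec (Some @: e) <-> w = defect psi e.
Proof.
move=> ec ek; rewrite sum_gvec // -addrA -mulrzBr int_vecD.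
have h : @int_vec R N (\sum_(G in e) gvec (Some G) *~ filler_coef e G) \in ucspan gvec (Some @: e).
  apply/ucspanP; exists (fun o => if o is Some G then (filler_coef e G)%:~R else 0).
  by rewrite big_Some int_vec_sum; apply: eq_bigr => G _; rewrite int_vecMz.
rewrite rpredDl //; split=> [/(delta_span ec)/eqP|->]; last by rewrite subrr mulr0z int_vec0 rpred0.
by rewrite subr_eq0 => /eqP.
Qed.

Context (h : 'rV[R]_N -> R) (hpl : forall c (a : {set 'I_N} -> R), is_chain_of_flats M c ->
  (forall F, F \in c -> 0 <= a F) ->
  h (\sum_(F in c) a F *: int_vec (cvj F)) = \sum_(F in c) a F * (psi F)%:~R).

Lemma graph_gcell c : is_chain_of_flats M c -> graph i h (ucone cvj c) = gcell c.
Proof.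
move=> cc; apply/classical_sets.seteqP; split=> y.
  by case=> _ [a [a0 ->]] <-; rewrite hpl //; apply/gcellP; exists a.
case/gcellP => a [a0 ->]; exists (\sum_(F in c) a F *: int_vec (cvj F)); first by exists a.
by rewrite hpl.
Qed.

Lemma affine_on_cone c : is_chain_of_flats M c -> affine_on h (ucone cvj c).
Proof.
move=> cc; have [d hd] := bchain_unimodular j (bc cc).
exists (\sum_(F in c) d F *~ psi F), 0 => _ [a [a0 ->]]; rewrite addr0 hpl //.
rewrite pairing_suml; apply: eq_bigr => F Fc.
by rewrite pairingMzl (dual_pairing a hd Fc) mulrC.
Qed.

Let fan := @loopless_fan R N M j.
Let G := graph_complex i h fan.

Let cells_graph : cells G = [set gcell c | c in [set` chains_of_flats M]]%classic.
Proof.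
change (cells G) with (graph i h @` cells fan)%classic; rewrite /fan (loopless_fan_cells jB).
apply/classical_sets.seteqP; split=> P.
  case=> _ [c cc <-] <-; exists c => //.
  by rewrite graph_gcell //; move: cc; rewrite /= inE.
case=> c cc <-; exists (ucone cvj c); first by exists c.
by rewrite graph_gcell //; move: cc; rewrite /= inE.
Qed.

Let facets_graph m P : facets m G P <-> exists c,
  [/\ is_chain_of_flats M c, #|c|%:Z = m & P = gcell c].
Proof.
split=> [[+ dP]|[c [cc ck ->]]].
  rewrite cells_graph => -[c]; rewrite /= inE => cc cP; exists c; split=> //.
  by rewrite -pdim_gcell // cP.
by split; rewrite ?pdim_gcell // cells_graph; exists c; rewrite //= inE.
Qed.

Let fillers_gcell e (X : wcomplex R N) (D : set (set 'rV[R]_N)) :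
  is_chain_of_flats M e -> #|e|.+1 = k ->
  (forall P, facets k%:Z X P <-> (exists c, [/\ is_chain_of_flats M c, #|c| = k & P = gcell c]) \/
    D P) ->
  forall P, (facets k%:Z X P /\ (gcell e `<=` P)%classic <->
    (exists2 F, F \in fillers M e & P = gcell (F |: e)) \/ (D P /\ (gcell e `<=` P)%classic)).
Proof.
move=> ec ek hX P; rewrite hX; split.
  case=> -[[c [cc ck ->]] s|DP s]; last by right.
  left; have sec := gcell_sub ec cc (@gcell_forget c) s.
  have [|F Ff cFe] := chain_succ_filler cc sec; first by rewrite ck.
  by exists F; rewrite // -cFe.
case=> [[F /(fillersP _ ec)[c [cc s cn] <-] ->]|[DP s]]; last by split=> //; right.
by split; [left; exists c; rewrite cn|apply: gcell_mono].
Qed.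

Let filler_chain e F : F \in fillers M e -> F \notin e /\ is_chain_of_flats M (F |: e).
Proof. by rewrite inE => /andP. Qed.

Let gcellU F e : gcell (F |: e) = ucone gvec (Some F |: Some @: e).
Proof. by rewrite /gcell imsetU1. Qed.

Let filler_inj e : {in fillers M e &, injective (fun F => gcell (F |: e))}.
Proof.
move=> F F' /filler_chain[Fe Fc] /filler_chain[F'e F'c] /(gcell_inj Fc F'c) ecc.
have : F' \in F |: e by rewrite ecc setU11.
by rewrite !inE (negbTE F'e) orbF => /eqP.
Qed.

Lemma graph_balanced e : is_chain_of_flats M e -> #|e|.+1 = k ->
  balanced_at k%:Z G (gcell e) <-> defect psi e = 0.
Proof.
move=> ec ek; rewrite (balanced_uconeP (Te := Some @: fillers M e)).
- rewrite big_Some (eq_bigr (fun F => int_vec (gvec (Some F)))).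
    rewrite -int_vec_sum; have := sum_gvec_span 0 ec ek.
    by rewrite mulr0z subr0 => ->; split=> ->.
  by move=> F _; rewrite mulr1z.
- move=> P; rewrite (fillers_gcell (D := fun=> False) ec ek).
    split=> [[[F Ff ->]|h0]|[s /imsetP[F Ff ->] ->]].
    - by exists (Some F); rewrite ?gcellU //; apply: imset_f.
    - by case: h0.
    by left; exists F; rewrite ?gcellU.
  move=> Q; rewrite facets_graph; split.
    by case=> c [cc /eqP]; rewrite eqz_nat => /eqP ck ->; left; exists c.
  by case=> // -[c [cc ck ->]]; exists c; rewrite ck.
- move=> _ _ /imsetP[F Ff ->] /imsetP[F' F'f ->] /=; rewrite -!gcellU => /filler_inj.
  by move=> ->.
- move=> _ /imsetP[F Ff ->]; have [Fe Fc] := filler_chain Ff; split.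
    by apply: contra Fe => /imsetP[F' F'e [->]].
  by rewrite -imsetU1; apply: gvec_unimodular_Some.
Qed.

Lemma facets_completed P : facets k%:Z completed_graph P <->
  (exists c, [/\ is_chain_of_flats M c, #|c| = k & P = gcell c]) \/
  (exists e, [/\ is_chain_of_flats M e, #|e|.+1 = k, defect psi e != 0 & P = dcell e]).
Proof.
split.
  case=> -[[c + <-]|[c + <-]].
    by rewrite /= inE => cc; rewrite pdim_gcell // => -[ck]; left; exists c.
  move=> cu; have cc := unbalanced_chain cu; rewrite pdim_dcell // => -[ck].
  move: cu => /unbalancedP[e [ec ek eu s]]; right; exists c; split=> //.
  by have /eqP -> : c == e by rewrite eqEcard s -ltnS ek ck leqnn.
case=> [[c [cc ck ->]]|[e [ec ek eu ->]]].
  by split; [left; exists c; rewrite //= inE|rewrite pdim_gcell // ck].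
split; last by rewrite pdim_dcell // ek.
by right; exists e => //; apply/unbalancedP; exists e; split.
Qed.

Lemma completed_balanced e : is_chain_of_flats M e -> #|e|.+1 = k ->
  balanced_at k%:Z completed_graph (gcell e).
Proof.
move=> ec ek.
pose Te := (if defect psi e == 0 then set0 else [set None]) :|: Some @: fillers M e.
have TeP o : o \in Te -> (o = None /\ defect psi e != 0) \/ exists2 F, F \in fillers M e & o = Some F.
  rewrite !inE => /orP[|/imsetP[F Ff ->]]; last by right; exists F.
  by case: eqP; rewrite inE // => _ /eqP ->; left.
apply/(balanced_uconeP (Te := Te)).
- move=> P; rewrite (fillers_gcell ec ek facets_completed); split.
    case=> [[F Ff ->]|[[e' [e'c e'k e'u ->]] s]].
      by exists (Some F); rewrite ?gcellU // !inE imset_f ?orbT.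
    have see' := gcell_sub ec e'c (@dcell_forget e') s.
    have /eqP -> : e' == e by rewrite eq_sym eqEcard see' -ltnS e'k ek leqnn.
    exists None => //; have /eqP ee : e' == e by rewrite eq_sym eqEcard see' -ltnS e'k ek leqnn.
    by rewrite -ee in Te TeP *; rewrite /Te (negbTE e'u) !inE eqxx.
  case=> o /TeP[[-> eu] ->|[F Ff ->] ->]; last by left; exists F; rewrite ?gcellU.
  by right; split; [exists e|apply: gcell_dcell].
- move=> o o' /TeP[[-> eu]|[F Ff ->]] /TeP[[-> eu']|[F' F'f ->]] //=; rewrite -?gcellU.
  + by move=> /esym /gcell_neq_dcell; case; case: (filler_chain F'f).
  + by move=> /gcell_neq_dcell; case; case: (filler_chain Ff).
  + by move=> /filler_inj ->.
- move=> o /TeP[[-> _]|[F Ff ->]]; first by rewrite None_notin_Some; split=> //; apply: gvec_unimodular.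
  have [Fe Fc] := filler_chain Ff; split; first by apply: contra Fe => /imsetP[F' F'e [->]].
  by rewrite -imsetU1; apply: gvec_unimodular_Some.
have -> : \sum_(t in Te) @int_vec R N (gvec t) *~ weight completed_graph (ucone gvec (t |: Some @: e)) =
    int_vec (\sum_(F in fillers M e) gvec (Some F) - delta_mx 0 i *~ defect psi e).
  have fE : \sum_(o in Some @: fillers M e) @int_vec R N (gvec o) *~
      weight completed_graph (ucone gvec (o |: Some @: e)) =
      int_vec (\sum_(F in fillers M e) gvec (Some F)).
    rewrite big_Some int_vec_sum; apply: eq_bigr => F Ff; have [_ Fc] := filler_chain Ff.
    by rewrite -gcellU weight_gcell // mulr1z.
  rewrite /Te; have [->|eu] := eqVneq (defect psi e) 0.
    by rewrite set0U fE mulr0z subr0.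
  rewrite big_setU1 ?None_notin_Some // fE -/(dcell e) weight_dcell // [RHS]int_vecB [LHS]addrC.
  by rewrite [gvec None]/(- delta_mx 0 i) int_vecN mulNrz int_vecMz -scaler_int.
exact/sum_gvec_span.
Qed.

Lemma completed_graphP : is_completed_graph k%:Z i h fan completed_graph.
Proof.
have dw c : downward i (gcell c) = dcell c by rewrite dcellE.
have kE e : #|e|%:Z = k%:Z - 1 -> #|e|.+1 = k by lia.
split.
- move=> P; rewrite /fan (loopless_fan_cells jB) => -[c]; rewrite /= inE => cc <-.
  exact: affine_on_cone.
- rewrite -/G cells_graph; congr (_ `|` _)%classic.
  apply/classical_sets.seteqP; split=> P.
    case=> c /unbalancedP[e [ec ek eu s]] <-; exists (gcell c); last exact: dw.
    exists (gcell e); split.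
    + by apply/facets_graph; exists e; split=> //; lia.
    + by rewrite graph_balanced //; apply/eqP.
    + by apply: ucone_face; [apply: gvec_unimodular_Some|apply: imsetS].
  case=> Q [E [/facets_graph[e [ec /kE ek ->]]]]; rewrite graph_balanced // => /eqP eu.
  case/(ucone_faceP _ (gvec_unimodular_Some ec)) => c' sc' -> <-.
  have [c sc ->] : exists2 c : {set {set 'I_N}}, c \subset e & c' = Some @: c.
    exists (Some @^-1: c'); last first.
      apply/setP => o; apply/idP/imsetP => [oc'|[F + ->]]; last by rewrite inE.
      by have /imsetP[F Fe oF] := subsetP sc' _ oc'; exists F => //; rewrite inE -oF.
    apply/subsetP => F; rewrite inE => /(subsetP sc')/imsetP[F' F'e [->]] //.
  by exists c; [apply/unbalancedP; exists e|rewrite -dw].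
- by move=> P /facets_graph[c [cc _ ->]]; rewrite weight_gcell.
- by move=> P /facets_graph[e [ec /kE ek ->]]; apply: completed_balanced.
Qed.

End CompletedGraph.

(** * Closures of cones at infinity *)

Section ClosureRow.
Local Open Scope ring_scope.
Context {R : realType} {N : nat}.
Implicit Types (A : set 'rV[\bar R]_N) (w z : 'rV[\bar R]_N) (l : 'I_N).

Lemma closure_nbhs_coord A w (P : 'I_N -> set (\bar R)) : closure A w ->
  (forall l, nbhs (w 0%R l) (P l)) -> exists2 z, A z & forall l, P l (z 0%R l).
Proof.
move=> cA hP.
have [|z [Az Pz]] := cA [set z : 'rV[\bar R]_N | forall l, P l (z 0%R l)]%classic.
  exists (fun _ l => P l); first by move=> q l; rewrite (ord1 q).
  by move=> z hz l; apply: hz.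
by exists z.
Qed.

Lemma ereal_between (u v : \bar R) : (u < v)%E -> exists r : R, (u < r%:E /\ r%:E < v)%E.
Proof.
case: u v => [x| |] [y| |] //.
- rewrite lte_fin => xy; exists ((x + y) / 2); rewrite !lte_fin; split; lra.
- by move=> _; exists (x + 1); rewrite lte_fin ltrDl ltr01 ltry.
- by move=> _; exists (y - 1); rewrite ltNyr lte_fin ltrBlDr ltrDl ltr01.
- by move=> _; exists 0; rewrite ltNyr ltry.
Qed.

Lemma closure_coord_le A w a b : closure A w ->
  (forall z, A z -> (z 0%R a <= z 0%R b)%E) -> (w 0%R a <= w 0%R b)%E.
Proof.
move=> cA hA; rewrite leNgt; apply/negP => /ereal_between[t [wt tw]].
pose P l := [set v : \bar R | (l = b -> (v < t%:E)%E) /\ (l = a -> (t%:E < v)%E)]%classic.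
have [l|z /hA zab Pz] := @closure_nbhs_coord A w P cA.
  apply: filterI.
    have [->|ne] := pselect (l = b); last by apply: filterE => v /= /ne.
    apply: (@filterS _ _ _ [set v | (v < t%:E)%E]%classic) => [v vt _ //|].
    by apply: open_nbhs_nbhs; split=> //; apply: open_ereal_lt_ereal.
  have [->|ne] := pselect (l = a); last by apply: filterE => v /= /ne.
  apply: (@filterS _ _ _ [set v | (t%:E < v)%E]%classic) => [v vt _ //|].
  by apply: open_nbhs_nbhs; split=> //; apply: open_ereal_gt_ereal.
have [/(_ erefl) zb _] := Pz b; have [_ /(_ erefl) za] := Pz a.
by have := lt_le_trans (lt_trans zb za) zab; rewrite ltxx.
Qed.

(** Coordinates of [z m] are constant or decrease linearly to -oo, so an index beyond finitely many
    archimedean bounds enters any given neighbourhood of [w]. *)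
Lemma closure_ray A w (z : nat -> 'rV[\bar R]_N) : (forall m, A (z m)) ->
  (forall l, (forall m, z m 0%R l = w 0%R l) \/
    (w 0%R l = -oo%E /\ exists (t e : R), 0 < e /\ forall m, z m 0%R l = (t - m%:R * e)%:E)) ->
  closure A w.
Proof.
move=> Az hz U [P hP sU].
have /choice [k hk] : forall l, exists k : nat, forall m, (k <= m)%N -> P 0 l (z m 0%R l).
  move=> l; have := hP 0 l; case: (hz l) => [e|[-> [t [e [e0 e']]]]].
    by move=> /nbhs_singleton wP; exists 0%N => m _; rewrite e.
  move=> [K [_ hK]]; exists (Num.bound `|(t - K) / e|) => m km.
  rewrite e'; apply: hK; rewrite lte_fin ltrBlDr -ltrBlDl -ltr_pdivrMr //.
  apply: le_lt_trans (ler_norm _) _; apply: lt_le_trans (archi_boundP (normr_ge0 _)) _.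
  by rewrite ler_nat.
exists (z (\max_l k l)); split; first exact: Az.
by apply: sU => q l; rewrite (ord1 q); apply: hk; apply: leq_bigmax.
Qed.

End ClosureRow.

(** * Chains truncated at a member *)

Section ChainQuotient.
Local Open Scope ring_scope.
Context {N : nat} (B : {set 'I_N}).
Implicit Types (F G H : {set 'I_N}) (c : {set {set 'I_N}}) (l : 'I_N).

(** Describes a cone at infinity: when the coordinates in [G] tend to -oo, with j outside [G],
    members inside [G] have no component in the other coordinates, and members above [G] lose
    [G]. *)
Definition chain_quotient G c : {set {set 'I_N}} :=
  [set H :\: G | H in [set H in c | G \proper H]].

Lemma chain_quotientP G c F : reflect (exists H, [/\ H \in c, G \proper H & F = H :\: G])
  (F \in chain_quotient G c).
Proof.
apply: (iffP imsetP) => [[H + ->]|[H [Hc GH ->]]]; first by rewrite inE => /andP[]; exists H.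
by exists H; rewrite // inE Hc.
Qed.

Lemma setD_inj_above G H H' : G \subset H -> G \subset H' -> H :\: G = H' :\: G -> H = H'.
Proof. by move=> s s' e; rewrite -(setID H G) -(setID H' G) e !(setIidPr _). Qed.

Lemma chain_quotient_inj G c : {in [set H in c | G \proper H] &, injective (fun H => H :\: G)}.
Proof.
move=> H H'; rewrite !inE => /andP[_ s] /andP[_ s'].
by apply: setD_inj_above; apply: proper_sub.
Qed.

Lemma chain_quotient_bchain G c : bchain B c -> bchain (B :\: G) (chain_quotient G c).
Proof.
move=> cc; apply/bchainP; split=> [F /chain_quotientP[H [Hc GH ->]]|].
  have [HB _ HnB] := bchain_mem cc Hc; split; first exact: setSD.
    by case/properP: GH => _ [l lH lG]; apply/set0Pn; exists l; rewrite inE lG.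
  apply: contra HnB => /eqP/setD_inj_above e; apply/eqP/e; first exact: proper_sub.
  exact: subset_trans (proper_sub GH) HB.
move=> F F' /chain_quotientP[H [Hc GH ->]] /chain_quotientP[H' [H'c GH' ->]].
by case/orP: (bchain_total cc Hc H'c) => s; rewrite (setSD _ s) ?orbT.
Qed.

Lemma chain_quotient0 c : bchain B c -> chain_quotient set0 c = c.
Proof.
move=> cc; apply/setP => F; apply/chain_quotientP/idP => [[H [Hc _ ->]]|Fc].
  by rewrite setD0.
exists F; split; rewrite ?setD0 // properE sub0set subset0.
by have [_ ->] := bchain_mem cc Fc.
Qed.

Lemma card_chain_quotient G c : #|chain_quotient G c| = #|[set H in c | G \proper H]|.
Proof. exact/card_in_imset/chain_quotient_inj. Qed.

Lemma chain_quotient_lift G c c' : bchain B c -> c' \subset chain_quotient G c ->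
  exists c1, [/\ c1 \subset c, G \in c -> G \in c1 & chain_quotient G c1 = c'].
Proof.
move=> cc s; exists [set H in c | (H == G) || (H :\: G \in c')]; split.
- by apply/subsetP => H; rewrite inE => /andP[].
- by move=> Gc; rewrite inE Gc eqxx.
apply/setP => F; apply/chain_quotientP/idP => [[H []]|Fc'].
  rewrite inE => /andP[Hc /orP[/eqP->|Hc' _ ->//]]; by rewrite properE subxx.
have /chain_quotientP[H [Hc GH eF]] := subsetP s _ Fc'.
by exists H; split=> //; rewrite inE Hc -eF Fc' orbT.
Qed.

End ChainQuotient.

(** * Graph cells and downward cells at infinity *)

Section Traces.
Local Open Scope ring_scope.
Context {R : realType} {N : nat} (M : rankdata N).
Context (j i : 'I_N) (jB : j \in ground M) (iB : i \notin ground M) (L : {set 'I_N}).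
Context (iL : i \notin L) (LB : [disjoint L & ground M]).
Notation B := (ground M).
Implicit Types (F G H : {set 'I_N}) (c e : {set {set 'I_N}}) (l : 'I_N) (x y z : 'rV[R]_N).
Notation cvj := (cv B j).
Context (psi : {set 'I_N} -> int).
Notation S' := (i |: (B :\ j :|: L)).
Notation gcell := (@gcell R N M j i psi).
Notation dcell := (@dcell R N M j i psi).

Let bc c : is_chain_of_flats M c -> bchain B c := @chain_of_flats_bchain N M c.

Section AtInfinity.
Context (G : {set 'I_N}) (GB : G \subset B :\ j).
Notation J := (i |: (G :|: L)).

Let GB' : G \subset B. Proof. exact: subset_trans GB (subD1set _ _). Qed.
Let jG : j \notin G. Proof. by apply/negP => /(subsetP GB); rewrite !inE eqxx. Qed.
Let jL : j \notin L.
Proof. by apply: contraTN LB => jL'; apply/pred0Pn; exists j => /=; rewrite jL'. Qed.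
Let ji : j != i. Proof. by apply: contraNneq iB => <-. Qed.
Let BL l : l \in B -> l \notin L.
Proof. by move=> lB; apply: contraTN LB => lL; apply/pred0Pn; exists l => /=; rewrite lL. Qed.
Let Bi l : l \in B -> (l == i) = false.
Proof. by move=> lB; apply: contraNF iB => /eqP <-. Qed.

Let S'J : S' :\: J = (B :\: G) :\ j.
Proof.
apply/setP => l; rewrite !inE; have [->|li] /= := eqVneq l i; first by rewrite (negbTE iB) !andbF.
have [lL|lL] := boolP (l \in L); last by rewrite !orbF; case: (l \in G); rewrite ?andbF.
by rewrite orbT /=; case: (boolP (l \in B)) => [/BL|]; rewrite ?lL // !andbF.
Qed.

Let inJ l : l \in B -> (l \in J) = (l \in G).
Proof. by move=> lB; rewrite !inE Bi // (negbTE (BL lB)) orbF. Qed.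

(** The inequalities between coordinates survive the closure. Applied to finite against infinite
    coordinates they put [G] into the chain; applied to the finite coordinates they cut out the
    quotient cone. *)
Lemma trace_cone_sub c (P : set 'rV[R]_N) y : is_chain_of_flats M c ->
  (forall z, P z -> ucone cvj c (forget i z)) -> trace S' L J P y ->
  (G == set0) || (G \in c) /\ ucone (cv (B :\: G) j) (chain_quotient G c) y.
Proof.
move=> cc hP [ry cy].
have fE (z : 'rV[R]_N) l : l \in B -> forget i z 0 l = z 0 l.
  by move=> lB; rewrite !mxE eqxx Bi //= mulr0 subr0.
have le_y a b : a \in B -> b \in B -> (forall F, F \in c -> b \in F -> a \in F) ->
    (sed J y 0%R a <= sed J y 0%R b)%E.
  move=> aB bB h; apply: closure_coord_le cy _ => _ [z Pz <-].
  rewrite !mxE (negbTE (BL aB)) (negbTE (BL bB)) lee_fin -(fE z a) // -(fE z b) //.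
  exact: (ucone_braid_ineqs (hP _ Pz)).
have down a b : a \in B -> b \in B -> (forall F, F \in c -> b \in F -> a \in F) ->
    b \in G -> a \in G.
  move=> aB bB h bG; have := le_y _ _ aB bB h; rewrite !mxE !inJ // bG.
  by case: (a \in G).
have Gc : (G == set0) || (G \in c).
  have [//|G0] := eqVneq G set0.
  (* The indicator of the complement of [G] satisfies the inequalities of [c] and has [G] as a
     sublevel set. *)
  pose x : 'rV[R]_N := \row_l (l \notin G)%:R.
  have : braid_ineqs B c x.
    move=> a b aB bB h; rewrite !mxE ler_nat; have := down _ _ aB bB h.
    by case: (b \in G) => [-> //|_]; case: (a \in G).
  move/(braid_ineqs_sublevels (bc cc))/subsetP; apply; rewrite inE; apply/andP; split.
    have [b bG] := set0Pn _ G0; apply/existsP; exists b; rewrite (subsetP GB') //=.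
    apply/eqP/setP => a; rewrite !inE !mxE bG /= ler_nat leqn0 eqb0 negbK.
    by case: (boolP (a \in G)) => [/(subsetP GB')->|]; rewrite ?andbF.
  by apply: contraNneq jG => ->.
split=> //; apply: braid_ineqs_ucone.
- exact/chain_quotient_bchain/bc.
- by rewrite inE jG.
- by rewrite -S'J.
move=> a b; rewrite !inE => /andP[aG aB] /andP[bG bB] h.
have := le_y a b aB bB; rewrite !mxE !inJ // (negbTE aG) (negbTE bG) lee_fin; apply.
move=> F Fc bF; have GF : G \proper F.
  have FG : ~~ (F \subset G) by apply: contra bG => /subsetP/(_ _ bF).
  rewrite properE FG andbT; case/orP: Gc => [/eqP->|Gc]; first exact: sub0set.
  by case/orP: (bchain_total (bc cc) Fc Gc) => // s; rewrite s in FG.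
have : a \in F :\: G; last by rewrite inE => /andP[].
by apply: h; [apply/chain_quotientP; exists F|rewrite inE bG].
Qed.

Let lift_coord c (b : {set 'I_N} -> R) (t : R) l : is_chain_of_flats M c ->
  l \in B :\: G ->
  (\sum_(F in c) (if G \proper F then b (F :\: G) else if F == G then t else 0) *:
     int_vec (cvj F)) 0 l =
  (\sum_(H in chain_quotient G c) b H *: int_vec (cv (B :\: G) j H)) 0 l.
Proof.
move=> cc lBG; move: (lBG); rewrite inE => /andP[lG lB].
rewrite !braid_entry lB lBG (big_setID [set H in c | G \proper H]) /= [X in _ + X]big1 => [|F].
  rewrite addr0 /chain_quotient big_imset; last exact: chain_quotient_inj.
  rewrite (setIidPr _); last by apply/subsetP => H; rewrite inE => /andP[].
  apply: eq_bigr => H; rewrite inE => /andP[_ ->].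
  by rewrite !inE jG lG.
rewrite !inE => /andP[+ Fc]; rewrite Fc /= => /negbTE ->.
case: eqP => [->|_]; last by rewrite mul0r.
by rewrite (negbTE jG) (negbTE lG) subrr mulr0.
Qed.

Let lift_coordG c (b : {set 'I_N} -> R) (t : R) l : is_chain_of_flats M c ->
  G \in c -> l \in G ->
  (\sum_(F in c) (if G \proper F then b (F :\: G) else if F == G then t else 0) *:
     int_vec (cvj F)) 0 l =
  \sum_(F in c) (if G \proper F then b (F :\: G) * ((j \in F)%:R - (l \in F)%:R) else 0) - t.
Proof.
move=> cc Gc lG; rewrite braid_entry (subsetP GB') // (bigD1 G) //= [X in _ = X - _](bigD1 G) //=.
rewrite properE subxx /= eqxx (negbTE jG) lG /= sub0r add0r mulrN1 addrC; congr (_ - _).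
apply: eq_bigr => F /andP[_ /negbTE FG].
by case: ifP => // _; rewrite FG mul0r.
Qed.

(** The limit is approached by giving v_G the coefficient [m]: coordinates in [G] tend to -oo and
    those of [B] outside [G] stay fixed. The behaviour of x_i, which depends on the kind of cell, is
    left to the hypothesis on [z m 0 i]. *)
Lemma trace_cone_sup c (z : nat -> 'rV[R]_N) (P : set 'rV[R]_N) (b : {set 'I_N} -> R) (t e : R) :
  is_chain_of_flats M c -> (G == set0) || (G \in c) -> 0 < e ->
  (forall m, P (z m)) ->
  (forall m l, l != i -> z m 0 l = (\sum_(F in c) (if G \proper F then b (F :\: G)
     else if F == G then m%:R else 0) *: int_vec (cvj F)) 0 l) ->
  (forall m, z m 0 i = t - m%:R * e) ->
  trace S' L J P (\sum_(H in chain_quotient G c) b H *: int_vec (cv (B :\: G) j H)).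
Proof.
move=> cc Gc e0 Pz zl zi; set y := \sum_(H in _) _; split.
  move=> l; rewrite S'J => lBG; rewrite /y braid_entry; case: ifP => // lBG'.
  move: lBG; rewrite in_setD1 lBG' andbT negbK => /eqP ->.
  by rewrite big1 // => H _; rewrite subrr mulr0.
apply: (closure_ray (z := fun m => sed L (z m))) => [m|l]; first by exists (z m).
have [lL|lL] := boolP (l \in L).
  by left => m; rewrite !mxE lL !inE lL !orbT.
have [->|li] := eqVneq l i.
  right; rewrite mxE setU11; split=> //; exists t, e; split=> // m.
  by rewrite mxE (negbTE iL) zi.
have [lG|lG] := boolP (l \in G).
  right; rewrite mxE !inE lG orbT; split=> //.
  have Gc' : G \in c by case/orP: Gc => // /eqP G0; rewrite G0 inE in lG.
  exists (\sum_(F in c) (if G \proper F then b (F :\: G) * ((j \in F)%:R - (l \in F)%:R) else 0)), 1.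
  split=> // m; rewrite mxE (negbTE lL) zl // lift_coordG // mulr1.
  by [].
left=> m; rewrite !mxE (negbTE lL) !inE (negbTE li) (negbTE lG) (negbTE lL) /=; congr (_%:E).
have [lB|lB] := boolP (l \in B); first by rewrite zl // lift_coord // inE lG.
by rewrite zl // /y !braid_entry inE (negbTE lB) andbF.
Qed.

Lemma trace_dcell c : is_chain_of_flats M c -> 
  trace S' L J (dcell c) =
  if (G == set0) || (G \in c) then ucone (cv (B :\: G) j) (chain_quotient G c)
  else classical_sets.set0.
Proof.
move=> cc; apply/classical_sets.seteqP; split=> y.
  by case/(trace_cone_sub cc (@dcell_forget R N M j i iB psi c)) => ->.
case: ifP => // Gc [b [b0 ->]].
pose a m F : R := if G \proper F then b (F :\: G) else if F == G then m else 0.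
pose u m := \sum_(F in c) a m F *: int_vec (cvj F) + (\sum_(F in c) a m F * (psi F)%:~R) *: delta_mx 0 i.
have a0 m F : 0 <= m -> F \in c -> 0 <= a m F.
  rewrite /a => m0 Fc; case: ifP => GF; last by case: ifP.
  by apply: b0; apply/chain_quotientP; exists F.
pose t := \sum_(F in c) a 0 F * (psi F)%:~R.
pose q : R := if G \in c then (psi G)%:~R else 0.
have aE m : \sum_(F in c) a m F * (psi F)%:~R = t + m * q.
  rewrite /t /q; case: ifP => GC.
    rewrite (bigD1 G GC) [in RHS](bigD1 G GC) /= /a properE subxx /= eqxx mul0r add0r addrC.
    by congr (_ + _); apply: eq_bigr => F /andP[_ /negbTE ->].
  rewrite mulr0 addr0; apply: eq_bigr => F Fc; rewrite /a; case: ifP => // _.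
  by case: eqP => // FG; rewrite -FG Fc in GC.
(* On the graph x_i is [t + m * q]; going down by the nonnegative amount [m * (1 + |q| + q)]
   replaces this by [t - m * (1 + |q|)], whatever the sign of [q]. *)
apply: (@trace_cone_sup c (fun m => u m%:R - (m%:R * (1 + `|q| + q)) *: delta_mx 0 i)
   _ b t (1 + `|q|)) => //.
- move=> m; rewrite dcellE; exists (u m%:R), (m%:R * (1 + `|q| + q)).
  split=> //; first by apply/gcellP; exists (a m%:R); split=> // F; apply: a0.
  by rewrite mulr_ge0 //; have := ler_norm (- q); rewrite normrN; lra.
- by move=> m l li; rewrite !mxE /= (negbTE li) !mulr0 addr0 subr0.
move=> m; rewrite !mxE !eqxx !mulr1 braid_entry (negbTE iB) add0r aE; ring.
Qed.

(** Along v_G the graph has slope [psi G]; this being negative, x_i reaches -oo without leaving the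
    graph. *)
Lemma trace_gcell c : is_chain_of_flats M c -> psi G < 0 -> G != set0 ->
  trace S' L J (gcell c) = if G \in c then ucone (cv (B :\: G) j) (chain_quotient G c)
  else classical_sets.set0.
Proof.
move=> cc psiG G0; apply/classical_sets.seteqP; split=> y.
  by case/(trace_cone_sub cc (@gcell_forget R N M j i iB psi c)); rewrite (negbTE G0) /= => ->.
case: ifP => // Gc [b [b0 ->]].
pose a m F : R := if G \proper F then b (F :\: G) else if F == G then m else 0.
pose u m := \sum_(F in c) a m F *: int_vec (cvj F) + (\sum_(F in c) a m F * (psi F)%:~R) *: delta_mx 0 i.
have a0 m F : 0 <= m -> F \in c -> 0 <= a m F.
  rewrite /a => m0 Fc; case: ifP => GF; last by case: ifP.
  by apply: b0; apply/chain_quotientP; exists F.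
pose t := \sum_(F in c) a 0 F * (psi F)%:~R.
have aE m : \sum_(F in c) a m F * (psi F)%:~R = t + m * (psi G)%:~R.
  rewrite /t (bigD1 G Gc) [in RHS](bigD1 G Gc) /= /a properE subxx /= eqxx mul0r add0r addrC.
  by congr (_ + _); apply: eq_bigr => F /andP[_ /negbTE ->].
apply: (@trace_cone_sup c (fun m => u m%:R) _ b t (- (psi G)%:~R)) => //.
- by rewrite Gc orbT.
- by rewrite oppr_gt0 ltrz0.
- by move=> m; apply/gcellP; exists (a m%:R); split=> // F; apply: a0.
- by move=> m l li; rewrite !mxE /= (negbTE li) !mulr0 addr0.
by move=> m; rewrite !mxE !eqxx !mulr1 braid_entry (negbTE iB) add0r aE mulrN opprK.
Qed.

(* If some monomial of the polynomial avoids G, then the polynomial stays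
   bounded below when the coordinates of G tend to -oo. *)
Lemma trace_gcell_empty c (p : seq 'rV[nat]_N) m0 : is_chain_of_flats M c ->
  (forall m l, m \in p -> l \notin B :\ j -> m 0 l = 0%N) ->
  (forall a : {set 'I_N} -> R, (forall F, F \in c -> 0 <= a F) -> exists m, [/\ m \in p,
    monoval m (\sum_(F in c) a F *: int_vec (cvj F)) = \sum_(F in c) a F * (psi F)%:~R &
    forall m', m' \in p -> monoval m' (\sum_(F in c) a F *: @int_vec R N (cvj F)) <=
      monoval m (\sum_(F in c) a F *: int_vec (cvj F))]) ->
  m0 \in p -> (forall l, l \in G -> m0 0 l = 0%N) ->
  trace S' L J (gcell c) = classical_sets.set0.
Proof.
move=> cc psupp pcone m0p m0G; apply/classical_sets.seteqP; split=> // y [ry cy].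
have m0l l : m0 0 l != 0%N -> [/\ l \in B, l != j, l \notin G, l \notin J & l \notin L].
  move=> ml; have : l \in B :\ j by apply: contraR ml => /(psupp _ _ m0p) ->.
  rewrite in_setD1 => /andP[lj lB]; have lG : l \notin G by apply: contra ml => /m0G ->.
  by rewrite inJ // lG BL.
(* Near [y] the coordinates used by [m0] exceed y_l - 1, so [K] bounds the monomial [m0], and with
   it the polynomial, from below. *)
pose K := \sum_l (y 0 l - 1) *+ m0 0 l.
pose P l := if l == i then [set v : \bar R | (v < K%:E)%E]%classic
  else if m0 0%R l == 0%N then classical_sets.setT else [set v : \bar R | ((y 0%R l - 1)%:E < v)%E]%classic.
have [l|z [w wc <-] Pz] := closure_nbhs_coord (P := P) cy.
  rewrite /P mxE; case: eqP => [->|_].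
    by rewrite setU11; apply: open_nbhs_nbhs; split; [exact: open_ereal_lt_ereal|exact: ltNyr].
  case: eqP => [_|/eqP /m0l[lB lj lG /negbTE -> _]]; first exact: filterT.
  apply: open_nbhs_nbhs; split; first exact: open_ereal_gt_ereal.
  by rewrite /= lte_fin ltrBlDr ltrDl ltr01.
have := Pz i; rewrite /P eqxx mxE (negbTE iL) /= lte_fin ltNge => /negP; apply.
case/gcellP: wc => a [a0 ew]; have [m [mp mE mmax]] := pcone a a0.
have -> : w 0 i = monoval m (\sum_(F in c) a F *: int_vec (cvj F)).
  by rewrite mE ew !mxE !eqxx mulr1 braid_entry (negbTE iB) add0r.
apply: le_trans (mmax _ m0p); apply: ler_sum => l _.
have [->|ml] := eqVneq (m0 0 l) 0%N; first by rewrite !mulr0n.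
have [lB lj lG lJ lL] := m0l _ ml.
apply: ler_wMn2r; have li : (l == i) = false by rewrite Bi.
have := Pz l; rewrite /P li (negbTE ml) mxE (negbTE lL) /= lte_fin => /ltW.
by rewrite ew !mxE eqxx li !mulr0 addr0.
Qed.

End AtInfinity.
End Traces.

(** * Divisors of tropical polynomials *)

Section HyperplaneIndex.
Local Open Scope ring_scope.
Context {R : realType} {N : nat}.

(** A lattice vector with entry -1 at [i] generates, together with the vectors whose entry there is
    0, all integer vectors. *)
Lemma lattice_index1 (A : {set 'I_N}) (i : 'I_N) (P : set 'rV[R]_N) (w : 'rV[int]_N) :
  (lattice P `<=` intspace A)%classic -> lattice P w -> w 0 i = -1 ->
  lattice_index A (lattice_sum (lattice P) [set v | intspace A v /\ v 0 i = 0]%classic) = 1%N.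
Proof.
move=> sP Pw wi.
have -> : lattice_sum (lattice P) [set v | intspace A v /\ v 0 i = 0]%classic = intspace A.
  apply/classical_sets.seteqP; split=> x.
    by case=> u /sP hu [v [hv _] <-] l lA; rewrite mxE hu // hv // addr0.
  move=> hx; exists (w *~ (- x 0 i)).
    by rewrite /lattice /= int_vecMz rpredZ.
  exists (x + w *~ x 0 i); last by rewrite mulrNz addrCA addNr addr0.
  split; last by rewrite mxE mulrz_rowE wi mulrN1 subrr.
  by move=> l lA; rewrite mxE mulrz_rowE (sP _ Pw) // mulr0 addr0 hx.
rewrite /lattice_index (_ : [set _ | _ in _]%classic = [set intspace A]%classic).
  by rewrite fset_set1 cardfs1.
apply/classical_sets.seteqP; split=> X.
  case=> x hx <-; apply/classical_sets.seteqP; split=> y.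
    by case=> v hv <- l lA; rewrite mxE hx // hv // addr0.
  move=> hy; exists (y - x); last by rewrite addrC subrK.
  by move=> l lA; rewrite !mxE hx // hy // subr0.
move=> ->; exists 0; first by move=> l _; rewrite mxE.
apply/classical_sets.seteqP; split=> y; first by case=> v hv <-; rewrite add0r.
by move=> hy; exists y; rewrite ?add0r.
Qed.

End HyperplaneIndex.

Section Zero.
Local Open Scope ring_scope.
Context {R : realType} {N : nat}.
Implicit Types (k : int) (S I J : {set 'I_N}) (i : 'I_N).

Lemma wzero_completed_graph k i (h : 'rV[R]_N -> R) : is_completed_graph k i h wzero wzero.
Proof.
split=> //; last by move=> F [gF _]; case: gF => P; case.
rewrite /graph_complex /= image_set0 classical_sets.set0U.
by apply/classical_sets.seteqP; split=> // P [Q [E [[gE _] _ _]]]; case: gE => P'; case.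
Qed.

Lemma hyp_intersect_wzero k S i I J :
  cells (hyp_intersect k S i I (@wzero R N) J) = classical_sets.set0.
Proof.
rewrite /hyp_intersect; case: ifP => // _; apply/classical_sets.seteqP; split=> // Q.
by case=> _ _ [P []].
Qed.

Lemma hyp_intersect_wzero_tcomplex k S i I :
  is_tcomplex S (hyp_intersect k S i I (@wzero R N)).
Proof.
move=> J; rewrite hyp_intersect_wzero; have wc := @wzero_cycle R N k (S :\: J).
by case: ifP => // _; case: wc.
Qed.

Lemma mult_wzero k (X : wcomplex R N) x : cells X = classical_sets.set0 -> mult k X x = 0.
Proof. by move=> X0; apply: fsbig1 => P [[+ _] _]; rewrite X0. Qed.

End Zero.

(** * The divisor of a polynomial on a Bergman fan *)

Section Divisor.
Local Open Scope ring_scope.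
Context {R : realType} {N : nat} (M : rankdata N) (mM : is_matroid M).
Context (loopless : is_flat M set0) (j i : 'I_N) (jB : j \in ground M) (iB : i \notin ground M).
Context (k : nat) (rB : rk M (ground M) = k.+1).
Context (L : {set 'I_N}) (iL : i \notin L) (LB : [disjoint L & ground M]).
Notation B := (ground M).
Notation r := (rk M).
Notation S := (B :\ j :|: L).
Notation S' := (i |: (B :\ j :|: L)).
Implicit Types (F G H I J : {set 'I_N}) (c e : {set {set 'I_N}}) (l : 'I_N) (x y z : 'rV[R]_N).
Notation cvj := (cv B j).

Let bc c : is_chain_of_flats M c -> bchain B c := @chain_of_flats_bchain N M c.

(** A cycle of pure sedentarity [L], where [L] will be the set of loops. *)
Definition fan_tcomplex (X : wcomplex R N) : tcomplex R N := fun I => if I == L then X else wzero.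

Let LS : L \subset S. Proof. exact: subsetUr. Qed.
Let jL : j \notin L.
Proof. by apply: contraTN LB => jL'; apply/pred0Pn; exists j => /=; rewrite jL'. Qed.
Let ji : j != i. Proof. by apply: contraNneq iB => <-. Qed.
Let BL l : l \in B -> l \notin L.
Proof. by move=> lB; apply: contraTN LB => lL; apply/pred0Pn; exists l => /=; rewrite lL. Qed.
Let iS : i \notin S. Proof. by rewrite !inE negb_or iL (negbTE iB) andbF. Qed.

Lemma fan_modification psi (f g : 'rV[\bar R]_N -> \bar R) :
  (forall c (a : {set 'I_N} -> R), is_chain_of_flats M c -> (forall F, F \in c -> 0 <= a F) ->
    let x := \sum_(F in c) a F *: int_vec (cvj F) in
    [/\ f (sed L x) \is a fin_num, g (sed L x) \is a fin_num &
        rational_on f g L x = \sum_(F in c) a F * (psi F)%:~R]) ->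
  is_modification_complex k%:Z S i f g (fan_tcomplex (loopless_fan M j))
    (fan_tcomplex (@completed_graph R N M j i k psi)).
Proof.
move=> h I; rewrite /fan_tcomplex; have [->|IL] := eqVneq I L; last first.
  by case: ifP => // _; split=> //; apply: wzero_completed_graph.
rewrite LS; split.
  move=> P x; rewrite (loopless_fan_cells jB) => -[c]; rewrite /= inE => cc <- [a [a0 ->]].
  by have [? ? _] := h c a cc a0.
apply: completed_graphP => // c a cc a0.
by have [_ _ ->] := h c a cc a0.
Qed.

(** The properties shared by f and g: linearity on braid cones with values [psi]; a monomial that
    stays bounded at infinity where [psi] is nonnegative; and slope at least -1 on rank one flats,
    which will give lattice index 1. *)
Context (p : seq 'rV[nat]_N) (psi : {set 'I_N} -> int).
Context (psupp : forall m l, m \in p -> l \notin B :\ j -> m 0 l = 0%N).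
Context (pcone : forall c (a : {set 'I_N} -> R), bchain B c ->
  (forall F, F \in c -> 0 <= a F) -> exists m, [/\ m \in p,
    monoval m (\sum_(F in c) a F *: int_vec (cvj F)) = \sum_(F in c) a F * (psi F)%:~R &
    forall m', m' \in p -> monoval m' (\sum_(F in c) a F *: @int_vec R N (cvj F)) <=
      monoval m (\sum_(F in c) a F *: int_vec (cvj F))]).
Context (pavoid : forall G, j \notin G -> 0 <= psi G ->
  exists2 m, m \in p & forall l, l \in G -> m 0 l = 0%N).
Context (prank1 : forall G, is_flat M G -> r G = 1%N -> j \notin G -> -1 <= psi G).

Lemma tpoly_cone c (a : {set 'I_N} -> R) : is_chain_of_flats M c ->
  (forall F, F \in c -> 0 <= a F) ->
  @tpoly R N p (sed L (\sum_(F in c) a F *: int_vec (cvj F))) =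
    (\sum_(F in c) a F * (psi F)%:~R)%:E.
Proof.
move=> /bc cc a0; have [m [mp <- mmax]] := pcone cc a0; apply: tpoly_sed mmax => // m' l m'p lL.
by apply: psupp m'p _; rewrite !inE negb_and negbK; apply/orP; right; apply: contraL lL => /BL.
Qed.

Notation X := (@completed_graph R N M j i k psi).
Notation gcell := (@gcell R N M j i psi).
Notation dcell := (@dcell R N M j i psi).

Lemma tpoly_modification :
  is_modification_complex k%:Z S i (tpoly p) (cst 0%E) (fan_tcomplex (loopless_fan M j))
    (fan_tcomplex X).
Proof.
apply: fan_modification => c a cc a0 x; rewrite /rational_on tpoly_cone //=.
by split=> //; rewrite subr0.
Qed.

(** Traces of the downward cells, followed by traces of the graph cells. *)
Definition infinity_cones G : {set {set {set 'I_N}}} :=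
  [set chain_quotient G c | c in [set c in unbalanced_chains M j k psi | (G == set0) || (G \in c)]] :|:
  [set chain_quotient G c | c in [set c in chains_of_flats M | (psi G < 0) && (G \in c)]].

Section Infinity.
Context (G : {set 'I_N}) (GB : G \subset B :\ j).
Notation J := (i |: (G :|: L)).

Let GB' : G \subset B. Proof. exact: subset_trans GB (subD1set _ _). Qed.
Let jG : j \notin G. Proof. by apply/negP => /(subsetP GB); rewrite !inE eqxx. Qed.
Let jBG : j \in B :\: G. Proof. by rewrite inE jG. Qed.

Lemma infinity_coneP c' : reflect
  ((exists2 c, c \in unbalanced_chains M j k psi /\ ((G == set0) || (G \in c)) &
     c' = chain_quotient G c) \/
   (exists2 c, [/\ is_chain_of_flats M c, psi G < 0 & G \in c] & c' = chain_quotient G c))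
  (c' \in infinity_cones G).
Proof.
rewrite in_setU; apply: (iffP orP) => -[].
- by case/imsetP => c; rewrite in_set => /andP[h1 h2] ->; left; exists c.
- by case/imsetP => c; rewrite !in_set => /and3P[h1 h2 h3] ->; right; exists c.
- by case=> c [h1 h2] ->; left; apply/imsetP; exists c; rewrite // in_set h1.
- by case=> c [h1 h2 h3] ->; right; apply/imsetP; exists c; rewrite // !in_set h1 h2 h3.
Qed.

Lemma infinity_cones_bchain c' : c' \in infinity_cones G -> bchain (B :\: G) c'.
Proof.
case/infinity_coneP => [[c [cu _] ->]|[c [cc _ _] ->]]; apply/chain_quotient_bchain/bc => //.
exact: unbalanced_chain cu.
Qed.

Lemma infinity_cones_sub c' c'' : c' \in infinity_cones G -> c'' \subset c' ->
  c'' \in infinity_cones G.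
Proof.
case/infinity_coneP => [[c [cu Gc] ->]|[c [cc psiG Gc] ->]] s; apply/infinity_coneP.
  have cc := unbalanced_chain cu; have [c1 [s1 G1 <-]] := chain_quotient_lift (bc cc) s.
  left; exists c1 => //; split; last by case/orP: Gc => [->//|/G1->]; rewrite orbT.
  case/unbalancedP: cu => e [ec ek eu se]; apply/unbalancedP; exists e; split=> //.
  exact: subset_trans se.
have [c1 [s1 G1 <-]] := chain_quotient_lift (bc cc) s.
by right; exists c1 => //; split=> //; [apply: sub_chain cc|apply: G1].
Qed.

Let card_unbalanced c : c \in unbalanced_chains M j k psi -> (#|c| < k)%N.
Proof. by case/unbalancedP => e [_ <- _ /subset_leq_card]; rewrite ltnS. Qed.

Let card_quotient_lt c : G \in c -> (#|chain_quotient G c| < #|c|)%N.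
Proof.
move=> Gc; rewrite card_chain_quotient; apply: proper_card; apply/properP; split.
  by apply/subsetP => H; rewrite inE => /andP[].
by exists G; rewrite // inE properE subxx andbF.
Qed.

Let card_quotient_le c : (#|chain_quotient G c| <= #|c|)%N.
Proof.
by rewrite card_chain_quotient subset_leq_card //; apply/subsetP => H; rewrite inE => /andP[].
Qed.

Let chain_card_k c : is_chain_of_flats M c -> (#|c| <= k)%N.
Proof. by move=> cc; have := chain_card mM loopless cc; rewrite rB. Qed.

Let gcell_empty c : is_chain_of_flats M c -> (G == set0) || ~~ (psi G < 0) ->
  trace S' L J (gcell c) = classical_sets.set0.
Proof.
move=> cc h; have [m0 m0p m0G] : exists2 m, m \in p & forall l, l \in G -> m 0 l = 0%N.
  case/orP: h => [/eqP->|]; last by rewrite -leNgt; apply: pavoid.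
  have [m [mp _ _]] := pcone (bc cc) (a := fun=> 0) (fun _ _ => lexx _).
  by exists m => // l; rewrite inE.
by apply: (trace_gcell_empty iB iL LB cc psupp) m0p m0G => a; apply: pcone (bc cc).
Qed.

Lemma infinity_cells : cells (hyp_intersect k%:Z S' i L X J) =
  braid_cells (B :\: G) j (infinity_cones G).
Proof.
rewrite /hyp_intersect [L \subset J]subsetU ?subsetUr ?orbT // setU11 andbT /=.
rewrite (_ : (J \subset S') = true); last first.
  by apply: setUS; apply: setSU.
apply/classical_sets.seteqP; split=> Q.
  case=> Q0 _ [P [[c cc eP]|[c cu eP]] eQ].
    move: cc; rewrite /= inE => cc; have [h|] := boolP ((G == set0) || ~~ (psi G < 0)).
      by case: Q0 => y; rewrite eQ -eP gcell_empty.
    rewrite negb_or negbK => /andP[G0 psiG]; move: Q0; rewrite eQ -eP trace_gcell //.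
    case: ifP => [Gc _|_ [y []]].
    by exists (chain_quotient G c) => //; apply/infinity_coneP; right; exists c.
  have cc := unbalanced_chain cu; move: Q0; rewrite eQ -eP trace_dcell //.
  case: ifP => [Gc _|_ [y []]].
  by exists (chain_quotient G c) => //; apply/infinity_coneP; left; exists c.
case=> c' /= c'C <-; have c'b := infinity_cones_bchain c'C.
split; first by exists 0; apply: ucone0.
  (* [hyp_intersect] keeps traces of dimension at most [k] - 1. Nothing is lost: an unbalanced chain
     has fewer than [k] members, and the quotient of a chain through [G] loses [G]. *)
  rewrite pdim_braid //; case/infinity_coneP: c'C => [[c [cu _] ->]|[c [cc _ Gc] ->]].
    by have := leq_ltn_trans (card_quotient_le c) (card_unbalanced cu); clear; lia.
  by have := leq_trans (card_quotient_lt Gc) (chain_card_k cc); clear; lia.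
case/infinity_coneP: c'C => [[c [cu Gc] ->]|[c [cc psiG Gc] ->]].
  exists (dcell c); first by right; exists c.
  by rewrite trace_dcell ?Gc //; apply: unbalanced_chain cu.
exists (gcell c); first by left; exists c => //=; rewrite inE.
rewrite trace_gcell ?Gc //.
by apply: contraTneq Gc => ->; apply/negP => /(chain_neq0 cc); rewrite eqxx.
Qed.

Lemma infinity_complement : S' :\: J = (B :\: G) :\ j.
Proof.
apply/setP => l; rewrite !inE; have [->|li] /= := eqVneq l i; first by rewrite (negbTE iB) !andbF.
have [lL|lL] := boolP (l \in L); last by rewrite !orbF; case: (l \in G); rewrite ?andbF.
by rewrite orbT /=; case: (boolP (l \in B)) => [/BL|]; rewrite ?lL // !andbF.
Qed.

Lemma infinity_complex : is_complex (S' :\: J) (cells (hyp_intersect k%:Z S' i L X J)).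
Proof.
rewrite infinity_cells infinity_complement; apply: braid_complex => //.
- exact: infinity_cones_bchain.
- exact: infinity_cones_sub.
Qed.

Let S'L : S' :\: L = i |: (B :\ j).
Proof.
apply/setP => l; rewrite !inE; have [->|li] /= := eqVneq l i; first by rewrite iL.
have [lL|lL] := boolP (l \in L); last by rewrite !orbF.
by case: (boolP (l \in B)) => [/BL|]; rewrite ?lL // !andbF.
Qed.

Let lattice_sub (c : {set option {set 'I_N}}) :
  (lattice (@ucone R N _ (gvec M j i psi) c) `<=` intspace (S' :\: L))%classic.
Proof.
move=> v; rewrite /lattice /= lin_ucone => /ucspanP[a e] l; rewrite S'L => lS.
have : (int_vec v : 'rV[R]_N) 0 l = 0.
  rewrite e summxE big1 // => o _; rewrite !mxE.
  have gl : gvec M j i psi o 0 l = 0.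
    move: lS; rewrite !inE negb_or negb_and negbK => /andP[li lB].
    case: o => [F|] /=; last by rewrite !mxE eqxx (negbTE li) oppr0.
    rewrite mxE mulrz_rowE delta_row (negbTE li) mulr0 addr0 mxE.
    case: ifP => // lB'; move: lB; rewrite lB' orbF => /eqP ->.
    by rewrite subrr.
  by rewrite gl mulr0.
by rewrite mxE => /eqP; rewrite intr_eq0 => /eqP.
Qed.

Let weightE Q : weight (hyp_intersect k%:Z S' i L X J) Q = hyp_weight k%:Z S' i L X J Q.
Proof.
rewrite /hyp_intersect [L \subset J]subsetU ?subsetUr ?orbT // setU11 andbT /=.
by rewrite (_ : (J \subset S') = true) //; apply: setUS; apply: setSU.
Qed.

Let hyp_weight1 (Q P0 : set 'rV[R]_N) (w : 'rV[int]_N) : facets k%:Z X P0 ->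
  (Q `<=` trace S' L J P0)%classic ->
  (forall P, facets k%:Z X P -> (Q `<=` trace S' L J P)%classic -> P = P0) ->
  lattice P0 w -> w 0 i = -1 ->
  hyp_weight k%:Z S' i L X J Q = weight X P0.
Proof.
move=> h1 h2 h3 P0w wi; rewrite /hyp_weight.
have -> : [set P | facets k%:Z X P /\ Q `<=` trace S' L J P]%classic = [set P0]%classic.
  apply/classical_sets.seteqP; split=> P; first by case=> /h3; apply.
  by move=> ->.
rewrite fsbig_set1; have [c P0E] : exists c' : {set option {set 'I_N}}, P0 = ucone (gvec M j i psi) c'.
  by case: (h1) => -[[c _ <-]|[c _ <-]] _; [exists (Some @: c)|exists (None |: Some @: c)].
by rewrite (lattice_index1 (w := w)) ?mulr1 // P0E; apply: lattice_sub.
Qed.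

Let gvec_i o : gvec M j i psi o 0 i = if o is Some F then psi F else -1.
Proof.
case: o => [F|] /=; last by rewrite !mxE !eqxx.
by rewrite mxE mulrz_rowE delta_row eqxx mulr1 mxE (negbTE iB) add0r.
Qed.

Let lattice_gvec (c : {set option {set 'I_N}}) o : o \in c ->
  lattice (@ucone R N _ (gvec M j i psi) c) (gvec M j i psi o).
Proof. by move=> oc; rewrite /lattice /= lin_ucone; apply/ucone_lin/ucone_gen. Qed.

Let quotient_braid_sub c c' : bchain (B :\: G) c' -> is_chain_of_flats M c ->
  (@ucone R N _ (cv (B :\: G) j) c' `<=` ucone (cv (B :\: G) j) (chain_quotient G c))%classic ->
  c' \subset chain_quotient G c.
Proof. by move=> c'b cc; apply: braid_sub => //; apply/chain_quotient_bchain/bc. Qed.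

Let ucone_not_empty (c' : {set {set 'I_N}}) :
  ~ (@ucone R N _ (cv (B :\: G) j) c' `<=` classical_sets.set0)%classic.
Proof. by move=> /(_ 0 (ucone0 _ _)). Qed.

Lemma hyp_weight_unbalanced c : G = set0 -> is_chain_of_flats M c -> #|c|.+1 = k ->
  defect M j psi c != 0 ->
  hyp_weight k%:Z S' i L X J (ucone (cv (B :\: G) j) c) = defect M j psi c.
Proof.
move=> G0 cc ck cu; have cq : chain_quotient G c = c by rewrite G0; apply/chain_quotient0/bc.
rewrite (@hyp_weight1 _ (dcell c) (gvec M j i psi None)).
- by rewrite weight_dcell.
- by apply/facets_completed => //; right; exists c.
- by rewrite trace_dcell // G0 eqxx /= -G0 cq.
- move=> P /facets_completed[] //.
    case=> c2 [c2c _ ->]; rewrite gcell_empty //; last by rewrite G0 eqxx.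
    by move=> s; case: (ucone_not_empty s).
  case=> e [ec ek eu ->]; rewrite trace_dcell // (introT eqP G0) /= => s.
  have cb : bchain (B :\: G) c by rewrite G0 setD0; apply: bc.
  have := quotient_braid_sub cb ec s; rewrite G0 (chain_quotient0 (bc ec)).
  move=> s'; congr dcell; apply/eqP; rewrite eq_sym eqEcard s'.
  by rewrite -ltnS ek ck leqnn.
- by apply: lattice_gvec; rewrite setU11.
by rewrite gvec_i.
Qed.

Let quotient_full c : is_chain_of_flats M c -> G \in c -> #|chain_quotient G c|.+1 = k ->
  #|c| = k /\ forall F, F \in c -> G \subset F.
Proof.
move=> cc Gc ck; have ckk : #|c| = k.
  by apply/eqP; rewrite eqn_leq chain_card_k //= -ck; apply: card_quotient_lt.
split=> // F Fc; apply: contraT => GF.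
have : (#|chain_quotient G c| < #|c :\ G|)%N.
  rewrite card_chain_quotient; apply: proper_card; apply/properP; split.
    apply/subsetP => H; rewrite !inE => /andP[-> /andP[_ GH]]; rewrite andbT.
    by apply: contraNneq GH => ->.
  exists F; rewrite !inE Fc ?andbT ?properE ?(negbTE GF) //=.
  by apply: contraNneq GF => ->.
by move: ckk; rewrite (cardsD1 G) Gc -ck add1n => -[->]; rewrite ltnn.
Qed.

(** The chain has [k] members, all containing [G], with distinct ranks between [r G] and [k]. *)
Lemma quotient_rk1 c : is_chain_of_flats M c -> G \in c -> #|chain_quotient G c|.+1 = k ->
  r G = 1%N.
Proof.
move=> cc Gc ck; have [ckk above] := quotient_full cc Gc ck.
have := chain_card_above mM loopless G cc.
rewrite (_ : [set F in c | G \subset F] = c) ?ckk ?rB; last first.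
  by apply/setP => F; rewrite inE; apply: andb_idr; apply: above.
have := chain_rk_gt0 mM loopless cc Gc; have := chain_rk_lt mM cc Gc; rewrite rB.
by clear; lia.
Qed.

Lemma hyp_weight_above c : is_chain_of_flats M c -> G \in c -> psi G < 0 ->
  #|chain_quotient G c|.+1 = k ->
  hyp_weight k%:Z S' i L X J (ucone (cv (B :\: G) j) (chain_quotient G c)) = 1.
Proof.
move=> cc Gc psiG ck; have G0 : G != set0 by apply: (chain_neq0 cc).
have [ckk above] := quotient_full cc Gc ck.
have rG := quotient_rk1 cc Gc ck.
(* The lift of v_G then has entry -1 at [i], so the lattice index in the weight is 1. *)
have psi1 : psi G = -1.
  by have := prank1 (chain_flat cc Gc) rG jG; move: psiG; clear; lia.
have cqb := chain_quotient_bchain G (bc cc).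
rewrite (@hyp_weight1 _ (gcell c) (gvec M j i psi (Some G))).
- by rewrite weight_gcell.
- by apply/facets_completed => //; left; exists c.
- by rewrite trace_gcell // Gc.
- move=> P /facets_completed[] //.
    case=> c2 [c2c c2k ->]; rewrite trace_gcell //; case: ifP => [Gc2 s|_ s]; last first.
      by case: (ucone_not_empty s).
    have {}s := quotient_braid_sub cqb c2c s; congr gcell.
    have c2q : #|chain_quotient G c2|.+1 = k.
      apply/eqP; rewrite eqn_leq -[X in (_ <= X)%N]c2k card_quotient_lt //=.
      by rewrite -ck ltnS subset_leq_card.
    apply/esym/eqP; rewrite eqEcard ckk c2k leqnn andbT; apply/subsetP => H Hc.
    have [->//|HG] := eqVneq H G.
    have : H :\: G \in chain_quotient G c.
      by apply/chain_quotientP; exists H; split=> //; rewrite properEneq eq_sym HG above.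
    move/(subsetP s)/chain_quotientP => [H2 [H2c GH2 e]].
    by rewrite (setD_inj_above (above _ Hc) (proper_sub GH2) e).
  case=> e [ec ek _ ->]; rewrite trace_dcell // (negbTE G0) /=; case: ifP => [Ge s|_ s]; last first.
    by case: (ucone_not_empty s).
  have := subset_leq_card (quotient_braid_sub cqb ec s).
  by have := card_quotient_lt Ge; move: ck ek; clear; lia.
- by apply: lattice_gvec; apply: imset_f.
by rewrite gvec_i.
Qed.

(** For [k] = 0 the divisor has dimension -1, hence no facets. *)
Let mult_neg (Y : wcomplex R N) x : k = 0%N -> mult (k%:Z - 1) Y x = 0.
Proof.
move=> k0; apply: fsbig1 => P [[_ dP] _]; move: dP; rewrite k0 /pdim; clear; lia.
Qed.

Lemma infinity_mult0 x : G = set0 ->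
  generic (k%:Z - 1) (hyp_intersect k%:Z S' i L X J) x ->
  mult (k%:Z - 1) (hyp_intersect k%:Z S' i L X J) x =
  if [&& `[< realspace (B :\ j) x >], is_chain_of_flats M (sublevels B x) &
         #|sublevels B x|.+1 == k] then defect M j psi (sublevels B x) else 0.
Proof.
move=> G0; case: (posnP k) => [k0 _|k0].
  by rewrite mult_neg // k0 !andbF.
have kE : k%:Z - 1 = k.-1%:Z by move: k0; clear; lia.
rewrite kE => gx.
rewrite (braid_mult jBG infinity_cones_bchain infinity_cones_sub infinity_cells gx).
have BG : B :\: G = B by rewrite G0 setD0.
rewrite -[in RHS]BG; set c := sublevels (B :\: G) x.
have -> : (#|c| == k.-1) = (#|c|.+1 == k) by rewrite -eqSS prednK.
case: asboolP => //= rx.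
have cIn : c \in infinity_cones G -> is_chain_of_flats M c /\ c \in unbalanced_chains M j k psi.
  case/infinity_coneP => [[c1 [cu _] e]|[c1 [cc _ Gc] _]].
    have cc := unbalanced_chain cu; move: e; rewrite G0 (chain_quotient0 (bc cc)) => ->.
    by [].
  by have := chain_neq0 cc Gc; rewrite G0 eqxx.
have [ck|//] := eqVneq #|c|.+1 k; last by rewrite !andbF.
rewrite !andbT; case: ifP => [/cIn[cc cu]|cn].
  rewrite cc weightE hyp_weight_unbalanced //.
  case/unbalancedP: cu => e [ec ek eu s].
  by have /eqP -> : c == e by rewrite eqEcard s -ltnS ek ck leqnn.
case: ifP => // cc; apply/esym/eqP; apply: contraFT cn => cu.
apply/infinity_coneP; left; exists c; last by rewrite G0 (chain_quotient0 (bc cc)).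
by split; [apply/unbalancedP; exists c|rewrite G0 eqxx].
Qed.

Definition quotients_above : {set {set {set 'I_N}}} :=
  [set chain_quotient G c | c in [set c in chains_of_flats M | G \in c]].

Lemma infinity_mult x : G != set0 ->
  generic (k%:Z - 1) (hyp_intersect k%:Z S' i L X J) x ->
  mult (k%:Z - 1) (hyp_intersect k%:Z S' i L X J) x =
  if [&& `[< realspace (B :\: G :\ j) x >], psi G < 0, #|sublevels (B :\: G) x|.+1 == k &
         sublevels (B :\: G) x \in quotients_above] then 1 else 0.
Proof.
move=> G0; case: (posnP k) => [k0 _|k0].
  by rewrite mult_neg // k0 !andbF.
have kE : k%:Z - 1 = k.-1%:Z by move: k0; clear; lia.
rewrite kE => gx.
rewrite (braid_mult jBG infinity_cones_bchain infinity_cones_sub infinity_cells gx).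
set c' := sublevels (B :\: G) x.
have -> : (#|c'| == k.-1) = (#|c'|.+1 == k) by rewrite -eqSS prednK.
case: asboolP => //= rx; have [ck|] := eqVneq #|c'|.+1 k; last by rewrite !andbF.
rewrite andbT /=; have inA : (c' \in infinity_cones G) = (psi G < 0) && (c' \in quotients_above).
  apply/infinity_coneP/andP => [[[c [cu]]|[c [cc psiG Gc] ->]]|[psiG /imsetP[c]]].
  (* For nonempty [G] a downward cell has a trace of dimension at most [k] - 2: its chain has fewer
     than [k] members and loses [G]. *)
  - rewrite (negbTE G0) /= => Gc e; have := card_unbalanced cu; have := card_quotient_lt Gc.
    by rewrite -e -ck; clear; lia.
  - by split=> //; apply/imsetP; exists c; rewrite // !inE cc.
  - by rewrite !inE => /andP[cc Gc] e; right; exists c.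
rewrite inA; case: ifP => // /andP[psiG /imsetP[c]]; rewrite !inE => /andP[cc Gc] e.
by rewrite weightE e hyp_weight_above // -e.
Qed.

End Infinity.

Let split_infinity J : J \subset S' -> L \subset J -> i \in J -> exists2 G : {set 'I_N},
  G \subset B :\ j & J = i |: (G :|: L).
Proof.
move=> JS LJ iJ; exists (J :\: L :\ i).
  apply/subsetP => l; rewrite !inE => /and3P[li lL lJ]; have := subsetP JS _ lJ.
  by rewrite !inE (negbTE li) (negbTE lL) orbF.
apply/setP => l; rewrite !inE; have [->|li] //= := eqVneq l i.
have [lL|lL] /= := boolP (l \in L); last by rewrite orbF.
by rewrite ?orbT (subsetP LJ).
Qed.

Lemma hyp_intersect_tcomplex : is_tcomplex S' (fun J => hyp_intersect k%:Z S' i L X J).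
Proof.
move=> J; case: ifP => JS; last by rewrite /hyp_intersect JS andbF.
have [/and3P[LJ _ iJ]|h] := boolP [&& L \subset J, J \subset S' & i \in J].
  by have [G GB ->] := split_infinity JS LJ iJ; apply: infinity_complex.
by rewrite /hyp_intersect (negbTE h); case: (wzero_cycle (R := R) 0 (S' :\: J)).
Qed.

Definition divisor_tcomplex : tcomplex R N :=
  project i (fun J => hyp_intersect k%:Z S' i L X J).

Lemma fan_tcycle : is_tcycle k%:Z S (fan_tcomplex (@loopless_fan R N M j)).
Proof.
move=> I; rewrite /fan_tcomplex; have [->|IL] := eqVneq I L; last first.
  by case: ifP => // _; apply: wzero_cycle.
rewrite LS (_ : S :\: L = B :\ j); first exact: loopless_fan_cycle.
apply/setP => l; rewrite !inE; case: (boolP (l \in B)) => [/BL /negbTE ->|]; rewrite ?orbF //.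
by rewrite andbF /=; case: (l \in L).
Qed.

Lemma tpoly_hyp_intersect : is_hyp_intersect k%:Z S' i (fan_tcomplex X)
  (fun J => hyp_intersect k%:Z S' i L X J).
Proof.
have LS' : L \subset S' by rewrite subsetU // LS orbT.
split; first exact: hyp_intersect_tcomplex.
  move=> I IS iI; rewrite /fan_tcomplex; case: eqP => [->|_]; first exact: hyp_intersect_tcomplex.
  exact: hyp_intersect_wzero_tcomplex.
move=> J x JS _ _; rewrite (bigD1 L) ?LS' //= big1 ?addr0 => [|I /andP[_ IL]].
  by rewrite /fan_tcomplex eqxx.
by rewrite /fan_tcomplex (negbTE IL); apply/mult_wzero/hyp_intersect_wzero.
Qed.

Lemma tpoly_divisor :
  is_divisor_regular k%:Z S i (tpoly p) (fan_tcomplex (loopless_fan M j)) divisor_tcomplex.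
Proof.
exists (fan_tcomplex (loopless_fan M j)), (fan_tcomplex X),
  (fun J => hyp_intersect k%:Z S' i L X J); split; split.
- exact: fan_tcycle.
- by [].
- exact: tpoly_modification.
- exact: tpoly_hyp_intersect.
- move=> J; rewrite /divisor_tcomplex /project; have := hyp_intersect_tcomplex (i |: J).
  have [iJ|iJ] := boolP (i \in J).
    have JS : J \subset S = false by apply: contraNF iS => /subsetP; apply.
    by rewrite JS.
  have -> : (i |: J \subset S') = (J \subset S).
    rewrite subUset sub1set setU11 /=; apply/idP/idP => /subsetP s; apply/subsetP => l lJ.
      have := s _ lJ; rewrite in_setU1; case: eqP => // el; by rewrite -el lJ in iJ.
    by rewrite in_setU1 s ?orbT.
  case: ifP => // JS; rewrite (_ : S' :\: (i |: J) = S :\: J) //.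
  apply/setP => l; rewrite !in_setD !in_setU1; case: eqP => // ->.
  by rewrite (negbTE iS) andbF.
- by [].
Qed.

Lemma divisor_tcomplex_notsub J x : ~~ (L \subset J) -> mult (k%:Z - 1) (divisor_tcomplex J) x = 0.
Proof.
move=> LJ; apply: fsbig1 => P [[+ _] _]; rewrite /divisor_tcomplex /project; case: ifP => // iJ.
rewrite /hyp_intersect (_ : (L \subset i |: J) = false) //; apply: contraNF LJ => /subsetP s.
apply/subsetP => l lL; have := s _ lL; rewrite in_setU1; case: eqP => // el.
by move: iL; rewrite -el lL.
Qed.

Lemma divisor_tcomplexE G : G \subset B :\ j ->
  divisor_tcomplex (G :|: L) = hyp_intersect k%:Z S' i L X (i |: (G :|: L)).
Proof.
move=> GB; rewrite /divisor_tcomplex /project ifF // !inE (negbTE iL) orbF.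
by apply: contraNF iB => /(subsetP GB); rewrite in_setD1 => /andP[].
Qed.

End Divisor.

(** * The graph over a deletion is a Bergman fan *)

Section SublevelFacts.
Local Open Scope ring_scope.
Context {R : realType} {N : nat}.
Implicit Types (B F G : {set 'I_N}) (c : {set {set 'I_N}}) (j l : 'I_N) (x y : 'rV[R]_N).

Lemma braid_coef_sublevels B j c (a : {set 'I_N} -> R) : bchain B c -> j \in B ->
  (forall F, F \in c -> 0 <= a F) ->
  forall F, F \in c -> F \notin sublevels B (\sum_(G in c) a G *: int_vec (cv B j G)) -> a F = 0.
Proof.
move=> cc jB a0 F Fc; set x := \sum_(G in c) _ => nF.
have [rx s] := (ucone_braidP x cc jB).1 (ex_intro _ a (conj a0 erefl)).
have : ucone (cv B j) (sublevels B x) x by apply/ucone_braidP; rewrite ?sublevels_bchain.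
case=> b [_ xb].
have key : x = \sum_(F in c) (if F \in sublevels B x then b F else 0) *: int_vec (cv B j F).
  rewrite {1}xb [RHS](big_setID (sublevels B x)) /= (setIidPr s) [X in _ + X]big1 ?addr0.
    by apply: eq_bigr => G ->.
  by move=> G; rewrite inE => /andP[/negbTE-> _]; rewrite scale0r.
by have := unimodular_coef (bchain_unimodular j cc) key Fc; rewrite (negbTE nF).
Qed.

Definition sublevel B x l := [set a in B | x 0 a <= x 0 l].

Lemma sublevelsP B x F : reflect (exists2 b, b \in B & F = sublevel B x b /\ F != B)
  (F \in sublevels B x).
Proof.
rewrite inE; apply: (iffP andP) => [[/existsP[b /andP[bB /eqP e]] FB]|[b bB [e FB]]].
  by exists b.
by split=> //; apply/existsP; exists b; rewrite bB e eqxx.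
Qed.

Lemma sublevel_or B x b : b \in B -> sublevel B x b = B \/ sublevel B x b \in sublevels B x.
Proof.
move=> bB; have [e|ne] := eqVneq (sublevel B x b) B; [by left|right].
by apply/sublevelsP; exists b.
Qed.

(** Tests membership in the support of the fan pointwise, without reference to cones; this suits the
    comparison of two fans with different cells. *)
Lemma sublevels_flatsP (M : rankdata N) x : is_matroid M ->
  is_chain_of_flats M (sublevels (ground M) x) <->
  (forall b, b \in ground M -> is_flat M (sublevel (ground M) x b)).
Proof.
move=> mM; split=> [h b bB|h].
  have [->|] := sublevel_or x bB; first exact: flat_ground.
  exact: chain_flat h.
apply: is_chainP => [F Fs|].
  have [_ F0 FB] := bchain_mem (sublevels_bchain _ _) Fs; split=> //.
  by have /sublevelsP[b bB [-> _]] := Fs; apply: h.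
exact: bchain_total (sublevels_bchain _ _).
Qed.

End SublevelFacts.

Section MinimumFunction.
Local Open Scope ring_scope.
Context {R : realType} {N : nat} (M : rankdata N) (mM : is_matroid M) (loopless : is_flat M set0).
Context (i j : 'I_N) (iE : i \in ground M) (jE : j \in ground M) (ji : j != i).
Context (i_notcoloop : rk M (ground M :\ i) = rk M (ground M)).
Context (k : nat) (rE : rk M (ground M) = k.+1).
Notation E := (ground M).
Notation B := (ground M :\ i).
Notation Mdel := (mdelete M [set i]).
Notation Mcon := (mcontract M i).
Notation r := (rk M).
Notation q F := (i \in mcl M F).
Implicit Types (A F G H : {set 'I_N}) (c e : {set {set 'I_N}}) (l b : 'I_N) (x y : 'rV[R]_N).

Let mD : is_matroid Mdel := matroid_mdelete _ mM.
Let mC : is_matroid Mcon := matroid_mcontract mM iE.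
Let l0 : is_flat Mdel set0 := loopless_mdelete1 mM loopless i.
Let jB : j \in ground Mdel. Proof. by rewrite /= !inE ji. Qed.
Let iB : i \notin ground Mdel. Proof. by rewrite /= !inE eqxx. Qed.
Let rB : rk Mdel (ground Mdel) = k.+1. Proof. by rewrite /= i_notcoloop. Qed.

Definition spanning_flats : {set {set 'I_N}} := [set A | is_flat Mdel A & q A].

Lemma spanning_flatsB A : A \in spanning_flats -> A \subset B /\ A != set0.
Proof.
rewrite !inE => /andP[fA qA]; split; first exact: (flat_subE fA).
apply: contraTneq qA => ->; rewrite setU0 (rk_set0 mM) rk_set1_loopless //.
by rewrite andbF.
Qed.

Lemma spanning_flats_neq0 : spanning_flats != set0.
Proof.
apply/set0Pn; exists B; rewrite in_set groundD_cl // andbT.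
exact: (flat_ground mD).
Qed.

Lemma spanning_flats_cl F : is_flat Mdel F -> [exists A in spanning_flats, A \subset F] = q F.
Proof.
move=> fF; apply/existsP/idP => [[A /andP[]]|qF]; last first.
  by exists F; rewrite in_set fF qF subxx.
rewrite in_set => /andP[_ qA] s; apply: subsetP qA; apply: mcl_mono => //.
by apply: subset_trans (flat_subE fF) (subD1set _ _).
Qed.

Notation psi := (psi_min j spanning_flats).

Lemma psi_minE F : is_flat Mdel F -> psi F = (j \in F)%:R - (q F)%:R.
Proof. by move=> fF; rewrite /psi_min spanning_flats_cl. Qed.

(** The part [j in F] of [psi] cancels by [fillers_count]; the part [i in cl F] leaves
    [contract_chain] by [codim1_contract_count]. *)
Lemma defect_min e : is_chain_of_flats Mdel e -> #|e|.+1 = k ->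
  defect Mdel j psi e = (contract_chain M i e)%:R.
Proof.
move=> ec ek; have [|G1 [G2 [[f1 f2 s12] G1e G2e r12 he]]] := chain_codim1 mD l0 ec.
  by rewrite rB ek.
rewrite (defectE (R := R) mD l0 jB rB psi ec ek (filler_coef_gap mD jB ec f1 f2 s12 r12 G1e G2e he)).
have ek2 : #|e|.+2 = r E by rewrite ek rE.
have cnt := codim1_contract_count mM loopless iE i_notcoloop ec f1 f2 s12 G1e G2e r12 he ek2.
have cntj := fillers_count mD j f1 f2 s12 r12 he.
have q0 : q set0 = false.
  by rewrite !inE setU0 (rk_set0 mM) rk_set1_loopless // andbF.
have psi0 : psi set0 = 0 by rewrite psi_minE // q0 inE subrr.
have psiB : psi B = 0.
  rewrite psi_minE; last exact: (flat_ground mD).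
  by rewrite groundD_cl // (_ : j \in B) ?subrr.
have sE H : psi H = 0 \/ H \in e -> \sum_(G in e) psi G * (G == H)%:Z = psi H.
  have [He _|He [->|//]] := boolP (H \in e).
    rewrite (bigD1 H) //= eqxx mulr1 big1 ?addr0 // => G /andP[_ /negbTE->].
    by rewrite mulr0.
  rewrite big1 // => G Ge; case: eqP => [e'|_]; last by rewrite mulr0.
  by move: He; rewrite -e' Ge.
rewrite [X in _ - X](eq_bigr (fun G => psi G * (G == G2)%:Z +
  (psi G * (G == G1)%:Z) * (#|fillers Mdel e|%:Z - 1))); last first.
  by move=> G _ /=; rewrite mulrDr mulrA.
rewrite [X in _ - X]big_split /= -mulr_suml !sE; last first.
- by move: G2e; rewrite in_setU1 => /orP[/eqP->|]; [left|right].
- by move: G1e; rewrite in_setU1 => /orP[/eqP->|]; [left|right].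
have cardE (P : pred {set 'I_N}) : \sum_(F in fillers Mdel e) (P F)%:R =
    #|[set F in fillers Mdel e | P F]|%:R :> int.
  rewrite -sum1_card natr_sum [RHS](eq_bigl (fun F => (F \in fillers Mdel e) && P F)).
    by rewrite big_mkcondr; apply: eq_bigr => F _; case: (P F).
  by move=> F; rewrite in_set.
rewrite (eq_bigr (fun F : {set 'I_N} => (j \in F)%:R - (q F)%:R)); last first.
  by move=> F; rewrite he in_set => /andP[fF _]; rewrite psi_minE.
rewrite sumrB (cardE (fun F : {set 'I_N} => j \in F)) (cardE (fun F => q F)) !psi_minE //.
move: cnt cntj; move: #|[set F in fillers Mdel e | q F]| => n1.
move: #|[set F in fillers Mdel e | j \in F]| => n2; move: #|fillers Mdel e| => n3.
move/(congr1 (fun n => n%:R : int)); rewrite !natrD natrM => h1.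
move/(congr1 (fun n => n%:R : int)); rewrite !natrD natrM => h2.
have -> : n1%:R = (q G2)%:R + n3%:R * (q G1)%:R - (q G1)%:R - (contract_chain M i e)%:R :> int.
  by rewrite -h1; ring.
have -> : n2%:R = (j \in G2)%:R + n3%:R * (j \in G1)%:R - (j \in G1)%:R :> int.
  by rewrite -h2; ring.
by rewrite -[n3%:Z]natz; ring.
Qed.

Notation gcell := (@gcell R N Mdel j i psi).
Notation dcell := (@dcell R N Mdel j i psi).
Notation X := (@completed_graph R N Mdel j i k psi).
Notation cvj := (cv B j).
Notation lev y b := (sublevel B y b).

Let bc c : is_chain_of_flats Mdel c -> bchain B c := @chain_of_flats_bchain N Mdel c.

Let forgetE y l : l \in B -> forget i y 0 l = y 0 l.
Proof. by rewrite !inE => /andP[/negbTE li _]; rewrite !mxE eqxx li /= mulr0 subr0. Qed.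

Let lev_forget y b : b \in B -> lev (forget i y) b = lev y b.
Proof.
move=> bB; apply/setP => a; rewrite [LHS]inE [RHS]inE.
by case aB : (a \in B) => //=; rewrite !forgetE.
Qed.

Let sublevels_forget y : sublevels B (forget i y) = sublevels B y.
Proof.
apply/setP => F; apply/sublevelsP/sublevelsP => -[b bB [-> FB]]; exists b => //; split=> //.
  by rewrite lev_forget.
by rewrite lev_forget.
Qed.

Let lev_flat y b : is_chain_of_flats Mdel (sublevels B y) -> b \in B -> is_flat Mdel (lev y b).
Proof. by move=> h bB; exact: ((sublevels_flatsP y mD).1 h b bB). Qed.

Let lev_sub y b b' : y 0 b <= y 0 b' -> lev y b \subset lev y b'.
Proof. by move=> h; apply/subsetP => a; rewrite !inE => /andP[-> /le_trans]; apply. Qed.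

Let BE : B \subset E. Proof. exact: subD1set. Qed.

Let levE y b : lev y b \subset E.
Proof. by apply: subset_trans BE; apply/subsetP => a; rewrite inE => /andP[]. Qed.

Let q_mono F G : F \subset G -> G \subset E -> q F -> q G.
Proof. by move=> s GE; apply: subsetP; apply: mcl_mono. Qed.

(** The value of h at the projection of [y] is the coordinate y_b: the smallest level at which the
    sublevel set spans [i]. *)
Definition min_index y b := [/\ b \in B, q (lev y b) &
  forall b', b' \in B -> q (lev y b') -> y 0 b <= y 0 b'].

Lemma min_index_ex y : exists b, min_index y b.
Proof.
have [bt btB btm] : exists2 b, b \in B & forall b', b' \in B -> y 0 b' <= y 0 b.
  by case: (Order.TotalTheory.arg_maxP (fun l => y 0 l) jB) => b bB bm; exists b.
have qt : (bt \in B) && q (lev y bt).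
  rewrite btB; apply: q_mono (groundD_cl iE i_notcoloop) => //.
  by apply/subsetP => a aB; rewrite inE aB btm.
case: (@Order.TotalTheory.arg_minP _ _ _ bt (fun b => (b \in B) && q (lev y b)) (fun l => y 0 l) qt).
move=> b /andP[bB qb] bm; exists b; split=> // b' b'B qb'; apply: bm; exact/andP.
Qed.

Let min_index_lev y b b' : min_index y b -> b' \in B -> q (lev y b') = (y 0 b <= y 0 b').
Proof.
by move=> [bB qb bm] b'B; apply/idP/idP => [/(bm _ b'B)//|/(lev_sub)/q_mono]; apply.
Qed.

(** A sublevel set [F] spans [i] if and only if it contains [b], so [psi F] is the entry of v_F at
    [b]. Members of [c] that are not sublevel sets have coefficient 0. *)
Lemma min_index_value y b c (a : {set 'I_N} -> R) : min_index y b ->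
  is_chain_of_flats Mdel c -> (forall F, F \in c -> 0 <= a F) ->
  forget i y = \sum_(F in c) a F *: int_vec (cvj F) ->
  \sum_(F in c) a F * (psi F)%:~R = y 0 b.
Proof.
move=> mb cc a0 ey; have [bB qb bm] := mb; rewrite -forgetE // ey braid_entry bB.
apply: eq_bigr => F Fc; have [Fs|Fs] := boolP (F \in sublevels B (forget i y)); last first.
  by rewrite (braid_coef_sublevels (bc cc) jB a0 Fc) ?mul0r // -ey.
rewrite psi_minE; last exact: chain_flat cc Fc.
rewrite intrB !mulrz_nat; congr (_ * (_ - _%:R)); congr nat_of_bool.
move: Fs; rewrite sublevels_forget => /sublevelsP[b' b'B [-> _]].
by rewrite (min_index_lev mb b'B) [in RHS]inE bB.
Qed.

Lemma gcell_minP c y b : min_index y b -> is_chain_of_flats Mdel c ->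
  gcell c y <-> ucone cvj c (forget i y) /\ y 0 i = y 0 b.
Proof.
move=> mb cc; split.
  move=> yc; have := yc; case/gcellP => a [a0 ey].
  have fy : forget i y = \sum_(F in c) a F *: int_vec (cvj F).
    by rewrite ey (forget_delta j iB c a).
  split; first by rewrite fy; exists a.
  rewrite -(min_index_value mb cc a0 fy) ey !mxE !eqxx mulr1 braid_entry.
  by rewrite (negbTE iB) add0r.
case=> -[a [a0 fy]] yi; apply/gcellP; exists a; split=> //.
by rewrite (min_index_value mb cc a0 fy) -fy -yi /forget subrK.
Qed.

Lemma dcell_minP c y b : min_index y b -> is_chain_of_flats Mdel c ->
  dcell c y <-> ucone cvj c (forget i y) /\ y 0 i <= y 0 b.
Proof.
move=> mb cc; split.
  move=> yc; split; first exact: dcell_forget yc.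
  move: yc; rewrite dcellE => -[x [t [/gcellP[a [a0 ex]] t0 ey]]].
  have fy : forget i y = \sum_(F in c) a F *: int_vec (cvj F).
    by rewrite ey ex -addrA -scaleNr -scalerDl (forget_delta j iB c a).
  rewrite -(min_index_value mb cc a0 fy) ey ex !mxE !eqxx !mulr1 braid_entry.
  by rewrite (negbTE iB) add0r lerBlDr lerDl.
case=> -[a [a0 fy]] yi; rewrite dcellE.
exists (forget i y + y 0 b *: delta_mx 0 i), (y 0 b - y 0 i); split.
- by apply/gcellP; exists a; split=> //; rewrite (min_index_value mb cc a0 fy) fy.
- by rewrite subr_ge0.
by apply/rowP => l; rewrite !mxE; ring.
Qed.

Let below_flat y b : is_chain_of_flats Mdel (sublevels B y) -> min_index y b -> y 0 i < y 0 b ->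
  let F := [set a in B | y 0 a <= y 0 i] in is_flat Mdel F /\ ~~ q F.
Proof.
move=> cy mb yib F; have [F0|[a aF]] := set_0Vmem F.
  by rewrite F0 l0 !inE setU0 (rk_set0 mM) rk_set1_loopless // andbF.
case: (Order.TotalTheory.arg_maxP (fun l => y 0 l) aF) => b' b'F bm.
have /setIdP[b'B yb'] : b' \in F := b'F.
have -> : F = lev y b'.
  apply/setP => l; apply/idP/setIdP => [lF|[lB ly]].
    by split; [have /setIdP[] := lF|exact: bm].
  by apply/setIdP; split=> //; apply: le_trans ly yb'.
rewrite lev_flat // (min_index_lev mb b'B) -ltNge.
by split=> //; apply: le_lt_trans yib.
Qed.

(** Sublevel sets in [E] and in [B] differ at most by [i]. On the graph, those with [i] are closures
    of the ones in [B]; strictly below it, [i] joins a flat that does not span it, and flatness must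
    survive for every sublevel set and for [set0]. *)
Lemma completed_graph_support y : realspace (E :\ j) y ->
  is_chain_of_flats M (sublevels E y) <-> exists2 P, cells X P & P y.
Proof.
move=> ry; have [b mb] := min_index_ex y; have [bB qb bm] := mb.
have rfy : realspace (B :\ j) (forget i y).
  move=> l; have [->|li] := eqVneq l i; first by rewrite !mxE !eqxx mulr1 subrr.
  rewrite !inE li /= => lj; rewrite !mxE (negbTE li) andbF mulr0 subr0; apply: ry.
  by rewrite !inE.
have uc c : is_chain_of_flats Mdel c -> ucone cvj c (forget i y) <-> sublevels B y \subset c.
  move=> cc; rewrite (ucone_braidP (forget i y) (bc cc) jB) sublevels_forget.
  by split=> [[]|].
pose L l := sublevel E y l.
have LB l : L l :\ i = [set a in B | y 0 a <= y 0 l].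
  by apply/setP => a; rewrite !inE andbA.
have iL l : (i \in L l) = (y 0 i <= y 0 l) by rewrite inE iE.
have L1 l : y 0 i <= y 0 l -> L l = i |: [set a in B | y 0 a <= y 0 l].
  by move=> h; rewrite -LB setD1K // iL.
have L2 l : ~~ (y 0 i <= y 0 l) -> L l = [set a in B | y 0 a <= y 0 l].
  by move=> h; rewrite -LB (setDidPl _) // disjoint_sym disjoints1 iL.
split.
  move=> /(sublevels_flatsP y mM) fl.
  have cB : is_chain_of_flats Mdel (sublevels B y).
    apply/(sublevels_flatsP y mD) => l lB.
    have lE : l \in E := subsetP BE _ lB.
    by have := flat_mdelete mM i (fl l lE); rewrite -/(L l) LB.
  have bE := subsetP BE _ bB.
  (* Above the graph, the sublevel set at [b] would be a flat spanning [i] without containing it. *)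
  have yib : y 0 i <= y 0 b.
    apply: contraT => nyi; have := qb; rewrite -[lev y b]/[set a in B | y 0 a <= y 0 b] -L2 //.
    by rewrite (flat_mcl mM (fl b bE)) -/(L b) iL (negbTE nyi).
  have [yi|yi] := eqVneq (y 0 i) (y 0 b).
    exists (gcell (sublevels B y)); first by left; exists (sublevels B y) => //=; rewrite in_set.
    by apply/(gcell_minP mb) => //; split=> //; apply/uc.
  have {yi yib} yib : y 0 i < y 0 b by rewrite lt_neqAle yi.
  have [fF nqF] := below_flat cB mb yib.
  set F := [set a in B | y 0 a <= y 0 i] in fF nqF.
  have fiF : is_flat M (i |: F) by rewrite -L1 //; apply: fl.
  have FE : F \subset E := subset_trans (flat_subE fF) BE.
  have con G : G \in set0 |: sublevels B y -> is_flat M (i |: G).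
    rewrite in_setU1 => /orP[/eqP->|/sublevelsP[b' b'B [-> _]]].
      by apply: (flat_setU1_sub mM iE loopless (sub0set F)).
    have b'E := subsetP BE _ b'B.
    have [h|h] := boolP (y 0 i <= y 0 b').
      by rewrite -[lev y b']/[set a in B | _] -L1 //; apply: fl.
    have fl' : is_flat M (lev y b') by rewrite -[lev y b']/[set a in B | _] -L2 //; apply: fl.
    apply: (flat_setU1_sub mM iE fl' _ FE nqF fiF); apply/subsetP => a.
    rewrite !inE => /andP[-> /le_trans]; apply; rewrite leNgt.
    by apply: contra h => /ltW.
  have conC G : G \in set0 |: sublevels B y -> is_flat Mcon G.
    move=> Gs; rewrite mcontract_flatE // con // andbT.
    move: Gs; rewrite in_setU1 => /orP[/eqP->|Gs]; first exact: sub0set.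
    by have [] := bchain_mem (sublevels_bchain B y) Gs.
  have C0 : is_flat Mcon set0 by apply: conC; rewrite in_setU1 eqxx.
  have cC : is_chain_of_flats Mcon (sublevels B y).
    apply: is_chainP => [G Gs|].
      have [_ G0 GB] := bchain_mem (sublevels_bchain B y) Gs.
      by split=> //; apply: conC; rewrite in_setU1 Gs orbT.
    exact: bchain_total (sublevels_bchain B y).
  (* Extending the chain within M / i, rather than in M \ i, keeps every [i |: G] flat, so that the
     resulting codimension one chain has defect 1. *)
  have [e [ec se ek]] := chain_extend mC C0 cC.
  (* A maximal chain in M / i has [k.-1] members; [k] is positive because [set0] is a flat of M / i
     different from its ground set. *)
  have ekk : #|e|.+1 = k.
    rewrite ek rk_ground_mcontract // rE /= prednK // lt0n; apply/eqP => k0.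
    have : (rk Mcon set0 < rk Mcon (ground Mcon))%N.
      apply: (flat_lt mC C0) => //; apply/properP; split; first exact: sub0set.
      by exists j; [exact: jB|rewrite inE].
    by rewrite rk_ground_mcontract // rE k0.
  have eD : is_chain_of_flats Mdel e.
    apply: is_chainP => [G Ge|G G' Ge G'e]; last exact: (chain_total ec Ge G'e).
    split; [|exact: chain_neq0 ec Ge|exact: chain_neqE ec Ge].
    by apply: (mcontract_flat_mdelete mM iE); apply: chain_flat ec Ge.
  have ce : contract_chain M i e.
    apply/'forall_implyP => G; rewrite in_setU1 => /orP[/eqP->|Ge].
      by apply: con; rewrite in_setU1 eqxx.
    by have := chain_flat ec Ge; rewrite mcontract_flatE // => /andP[].
  exists (dcell (sublevels B y)); last first.
    by apply/(dcell_minP mb) => //; split; [apply/uc|apply: ltW].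
  right; exists (sublevels B y) => //; apply/unbalancedP; exists e; split=> //.
  by rewrite defect_min // ce oner_eq0.
move=> [P cP Py]; apply/(sublevels_flatsP y mM).
have suff_flat : is_chain_of_flats Mdel (sublevels B y) /\
    ((y 0 i = y 0 b) \/ (y 0 i < y 0 b /\ forall G, G \in set0 |: sublevels B y -> is_flat M (i |: G))).
  case: cP => [[c + eP]|[c cu eP]]; subst P.
    rewrite /= in_set => cc; have [/(uc _ cc) s yi] := (gcell_minP mb cc).1 Py.
    by split; [apply: sub_chain cc|left].
  have cc := unbalanced_chain cu; have [/(uc _ cc) s yi] := (dcell_minP mb cc).1 Py.
  split; first exact: sub_chain cc.
  move: yi; rewrite le_eqVlt => /orP[/eqP->|yi]; [by left|right; split=> // G].
  case/unbalancedP: cu => e [ec ek]; rewrite defect_min // => ce se.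
  have {ce} : contract_chain M i e by move: ce; case: contract_chain; rewrite ?eqxx.
  move=> /'forall_implyP h; rewrite in_setU1 => /orP[/eqP->|Gs]; apply: h.
    by rewrite in_setU1 eqxx.
  by rewrite in_setU1 (subsetP se) ?orbT // (subsetP s).
have [cB alt] := suff_flat.
have LBflat l : l \in B -> is_flat M (L l).
  move=> lB; have fl := lev_flat cB lB.
  have [h|h] := boolP (y 0 i <= y 0 l).
    rewrite L1 // -/(lev y l); case: alt => [yi|[yi con]].
      by apply: mdelete_flat_cl => //; rewrite (min_index_lev mb lB) -yi.
    have [->|] := sublevel_or y lB; first by rewrite setD1K //; apply: flat_ground.
    by move=> Gs; apply: con; rewrite in_setU1 Gs orbT.
  rewrite L2 // -/(lev y l); apply: (mdelete_flat_notcl mM fl); rewrite (min_index_lev mb lB) -ltNge.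
  move: h; rewrite -ltNge => h; case: alt => [<- //|[yi _]].
  exact: lt_trans yi.
move=> l lE; have [->|li] := eqVneq l i; last by apply: LBflat; rewrite !inE li.
case: alt => [yi|[yi con]].
  have -> : sublevel E y i = L b by apply/setP => a; rewrite !inE yi.
  exact: LBflat.
rewrite -/(L i) L1 //; have [fF nqF] := below_flat cB mb yi.
set F := [set a in B | _] in fF nqF *; apply: con; rewrite in_setU1.
have [//|[a aF]] := set_0Vmem F; first by move=> ->; rewrite eqxx.
apply/orP; right; case: (Order.TotalTheory.arg_maxP (fun l => y 0 l) aF) => b' b'F bm'.
have /setIdP[b'B yb'] : b' \in F := b'F.
apply/sublevelsP; exists b' => //; split; last first.
  by apply: contraNneq nqF => ->; apply: groundD_cl.
apply/setP => l'; apply/idP/setIdP => [lF|[l'B ly]].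
  by split; [have /setIdP[] := lF|exact: bm'].
by apply/setIdP; split=> //; apply: le_trans ly yb'.
Qed.

Lemma completed_graph_realspace P y : cells X P -> P y -> realspace (E :\ j) y.
Proof.
move=> cP Py; have : exists2 c, is_chain_of_flats Mdel c & ucone cvj c (forget i y).
  case: cP => [[c + eP]|[c cu eP]]; subst P.
    by rewrite /= in_set => cc; exists c => //; apply: gcell_forget Py.
  by exists c; [apply: unbalanced_chain cu|apply: dcell_forget Py].
case=> c cc /(braid_realspace jB) ry l; rewrite in_setD1 negb_and negbK => hl.
have li : l != i by apply: contraTneq hl => ->; rewrite iE orbF eq_sym.
have : forget i y 0 l = 0.
  by apply: ry; rewrite !in_setD1 li /= negb_and negbK.
by rewrite !mxE (negbTE li) andbF mulr0 subr0.
Qed.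

(** The point is on the graph or strictly below it. Genericity then forces [sublevels B y] to have
    [k] or [k] - 1 members respectively, which leaves one facet through [y]. *)
Lemma completed_graph_mult P y : generic k%:Z X y -> cells X P -> P y -> mult k%:Z X y = 1.
Proof.
move=> gy cP Py; have [b mb] := min_index_ex y; have [bB qb bm] := mb.
have rfy : realspace (B :\ j) (forget i y).
  case: cP => [[c _ eP]|[c cu eP]]; subst P.
    by apply: (braid_realspace jB); apply: gcell_forget Py.
  by apply: (braid_realspace jB); apply: dcell_forget Py.
have uc c : is_chain_of_flats Mdel c -> ucone cvj c (forget i y) <-> sublevels B y \subset c.
  move=> cc; rewrite (ucone_braidP (forget i y) (bc cc) jB) sublevels_forget.
  by split=> [[]|].
have single P0 : (forall Q, facets k%:Z X Q /\ Q y <-> Q = P0) -> mult k%:Z X y = weight X P0.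
  move=> h; rewrite /mult (_ : [set Q | _]%classic = [set P0]%classic) ?fsbig_set1 //.
  by apply/classical_sets.seteqP; split=> Q /h.
have card_le c : is_chain_of_flats Mdel c -> (#|c| <= k)%N.
  by move=> /(chain_card mD l0); rewrite rB.
have [yi|yi] := eqVneq (y 0 i) (y 0 b).
  have cs : is_chain_of_flats Mdel (sublevels B y).
    case: cP => [[c + eP]|[c cu eP]]; subst P.
      rewrite /= in_set => cc; have [/(uc _ cc) s _] := (gcell_minP mb cc).1 Py.
      exact: sub_chain s cc.
    have cc := unbalanced_chain cu.
    by have [/(uc _ cc) s _] := (dcell_minP mb cc).1 Py; apply: sub_chain s cc.
  have gs : gcell (sublevels B y) y by apply/(gcell_minP mb cs); split=> //; apply/uc.
  have sk : #|sublevels B y| = k.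
    apply/eqP; rewrite eqn_leq card_le // -lez_nat -(pdim_gcell (R := R) j iB psi cs).
    by apply: gy gs; left; exists (sublevels B y) => //=; rewrite in_set.
  rewrite (single (gcell (sublevels B y))) ?weight_gcell // => Q; split=> [[]|->].
    move=> /facets_completed[] //.
      case=> c [cc ck ->] Qy; have [/(uc _ cc) s _] := (gcell_minP mb cc).1 Qy.
      by have /eqP -> : sublevels B y == c by rewrite eqEcard s ck sk leqnn.
    case=> e [ec ek _ ->] Qy; have [/(uc _ ec) s _] := (dcell_minP mb ec).1 Qy.
    by have := subset_leq_card s; rewrite sk -ek ltnn.
  by split=> //; apply/facets_completed => //; left; exists (sublevels B y).
have [c cu Qy] : exists2 c, c \in unbalanced_chains Mdel j k psi & dcell c y.
  case: cP => [[c + eP]|[c cu eP]]; subst P; last by exists c.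
  rewrite /= in_set => cc; have [_ /eqP] := (gcell_minP mb cc).1 Py.
  by rewrite (negbTE yi).
have cc := unbalanced_chain cu; have [/(uc _ cc) s yib] := (dcell_minP mb cc).1 Qy.
have cs : is_chain_of_flats Mdel (sublevels B y) by apply: sub_chain cc.
have ds : dcell (sublevels B y) y by apply/(dcell_minP mb cs); split=> //; apply/uc.
case/unbalancedP: cu => e [ec ek eu se].
have sse : sublevels B y \subset e := subset_trans s se.
have sk : (k <= #|sublevels B y|.+1)%N.
  rewrite -lez_nat -(pdim_dcell (R := R) j iB psi cs); apply: gy ds.
  by right; exists (sublevels B y) => //; apply/unbalancedP; exists e.
have es : sublevels B y = e by apply/eqP; rewrite eqEcard sse -ltnS ek.
rewrite (single (dcell e)) ?weight_dcell //.
  by move: eu; rewrite defect_min //; case: contract_chain; rewrite ?eqxx.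
move=> Q; split=> [[]|->].
  move=> /facets_completed[] //.
    case=> c2 [c2c _ ->] /(gcell_minP mb c2c)[_ /eqP].
    by rewrite (negbTE yi).
  case=> e2 [e2c e2k _ ->] /(dcell_minP mb e2c)[/(uc _ e2c) s2 _].
  by have /eqP -> : e == e2 by rewrite eqEcard -es s2 /= es -ltnS ek e2k leqnn.
by split; [apply/facets_completed => //; right; exists e|rewrite -es].
Qed.

Lemma same_cycle_extension : same_cycle k%:Z X (@loopless_fan R N M j).
Proof.
move=> y gX gM; have cE := @loopless_fan_cells R N M j jE.
rewrite (braid_mult jE _ _ cE gM); last 2 first.
- exact: chains_of_flats_bchain.
- exact: sub_chains_of_flats.
have [[P cP Py]|nP] := pselect (exists2 P, cells X P & P y).
  have ry := completed_graph_realspace cP Py.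
  have cy : is_chain_of_flats M (sublevels E y).
    by apply/(completed_graph_support ry); exists P.
  have -> : #|sublevels E y| == k.
    have := chain_card mM loopless cy; rewrite rE eqn_leq => -> /=.
    rewrite -lez_nat -(pdim_braid (R := R) j (sublevels_bchain E y)); apply: gM.
      by rewrite cE; exists (sublevels E y) => //=; rewrite in_set.
    by apply/ucone_braidP => //; apply: sublevels_bchain.
  by rewrite (asboolT ry) in_set cy /= (completed_graph_mult gX cP Py).
rewrite [LHS]fsbig1; last by move=> P [[cP _] Py]; case: nP; exists P.
case: ifP => // /and3P[/asboolP ry]; rewrite in_set => cy _.
by case: nP; apply/(completed_graph_support ry).
Qed.

End MinimumFunction.

(** * The divisor is the Bergman fan of the contraction *)

Lemma mult_dim_lt0 (R : realType) (N : nat) (m : int) (Y : wcomplex R N) x : (m < 0)%R ->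
  mult m Y x = 0%R.
Proof. by move=> m0; apply: fsbig1 => P [[_ dP] _]; move: dP m0; rewrite /pdim; clear; lia. Qed.

Lemma defectB N (M : rankdata N) j (a b h : {set 'I_N} -> int) e :
  (forall F, h F = (a F - b F)%R) -> (defect M j a e - defect M j b e = defect M j h e)%R.
Proof.
move=> hE; rewrite /defect; set z := filler_coef M j e.
have -> : (\sum_(F in fillers M e) h F = \sum_(F in fillers M e) a F - \sum_(F in fillers M e) b F)%R.
  by rewrite -sumrB; apply: eq_bigr.
have -> : (\sum_(G in e) h G * z G = \sum_(G in e) a G * z G - \sum_(G in e) b G * z G)%R.
  by rewrite -sumrB; apply: eq_bigr => G _; rewrite hE mulrBl.
by ring.
Qed.

Section ContractionFan.
Local Open Scope ring_scope.
Context {R : realType} {N : nat} (M : rankdata N) (mM : is_matroid M) (loopless : is_flat M set0).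
Context (i j : 'I_N) (iE : i \in ground M) (jE : j \in ground M) (ji : j != i).
Context (i_notcoloop : rk M (ground M :\ i) = rk M (ground M)).
Context (k : nat) (rE : rk M (ground M) = k.+1).
Notation E := (ground M).
Notation B := (ground M :\ i).
Notation Mdel := (mdelete M [set i]).
Notation Mcon := (mcontract M i).
Notation r := (rk M).
Notation q F := (i \in mcl M F).
Context (L : {set 'I_N}) (iL : i \notin L) (LB : [disjoint L & ground Mdel]).
Implicit Types (A F G H J : {set 'I_N}) (c e : {set {set 'I_N}}) (l b : 'I_N) (x y : 'rV[R]_N).

Let mD : is_matroid Mdel := matroid_mdelete _ mM.
Let mC : is_matroid Mcon := matroid_mcontract mM iE.
Let l0 : is_flat Mdel set0 := loopless_mdelete1 mM loopless i.
Let jB : j \in ground Mdel. Proof. by rewrite /= !inE ji. Qed.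
Let iB : i \notin ground Mdel. Proof. by rewrite /= !inE eqxx. Qed.
Let rB : rk Mdel (ground Mdel) = k.+1. Proof. by rewrite /= i_notcoloop. Qed.
Let jL : j \notin L.
Proof. by apply: contraTN LB => jL'; apply/pred0Pn; exists j; apply/andP; split. Qed.

Notation P := (loops Mcon).
Notation AA := (spanning_flats M i).

Lemma mdelete_loops_flat (M0 : rankdata N) A : is_matroid M0 ->
  is_flat (mdelete M0 (loops M0)) A =
  (A \subset ground M0 :\: loops M0) && is_flat M0 (A :|: loops M0).
Proof.
move=> m0; have LE := loops_subE M0.
have rL A' : A' \subset ground M0 -> rk M0 (A' :|: loops M0) = rk M0 A'.
  move=> A'E; rewrite setUC; apply: rk_setU_closure => // l lL.
  have lE := subsetP LE _ lL; apply: (rk_setU1_mono m0 lE (sub0set _) A'E).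
  by move: lL; rewrite loops_mcl // inE => /andP[_ /eqP].
have sE : A \subset ground M0 :\: loops M0 -> A \subset ground M0.
  by move=> /subset_trans; apply; apply: subsetDl.
apply/(is_flatP (matroid_mdelete _ m0))/andP => /= -[AE].
  move=> h; split=> //; apply/(is_flatP m0); split; first by rewrite subUset sE.
  move=> l lE; rewrite setUA !rL ?setU1_subE ?sE // => e; rewrite inE orbC.
  by have [//|lL] := boolP (l \in loops M0); apply: h => //; rewrite inE lL.
move=> /(is_flatP m0)[_ h]; split=> // l; rewrite inE => /andP[lL lE] e.
have : l \in A :|: loops M0 by apply: h => //; rewrite setUA !rL ?setU1_subE ?sE.
by rewrite inE (negbTE lL) orbF.
Qed.

Lemma loops_mcontract : P = mcl M [set i] :\ i.
Proof.
rewrite (loops_mcl mC); apply/setP => l; rewrite !inE /= setU0.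
have [//|li] /= := eqVneq l i; case lE : (l \in E) => //=.
rewrite setU0 subnn subn_eq0 setUC eqn_leq.
by rewrite [X in _ = _ && X](rk_setU1_ge mM lE) ?sub1set // andbT.
Qed.

Let Pmcl : mcl M [set i] = i |: P.
Proof.
rewrite loops_mcontract setD1K // (subsetP (sub_mcl _)) ?sub1set //.
by rewrite inE.
Qed.

Let PB : P \subset B.
Proof. by have := loops_subE Mcon. Qed.

Let i1E : [set i] \subset E. Proof. by rewrite sub1set. Qed.

Let Pflat : is_flat Mdel P.
Proof. by rewrite loops_mcontract; apply: flat_mdelete => //; apply: mcl_flat. Qed.

Let r1 : r [set i] = 1%N. Proof. exact: rk_set1_loopless. Qed.

Let qP : P != set0 -> q P.
Proof.
move=> /set0Pn[l lP]; have PE : P \subset E := subset_trans PB (subD1set _ _).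
rewrite inE iE eqn_leq (rk_setU1_ge mM iE PE) andbT -Pmcl rk_mcl // r1.
rewrite -(rk_set1_loopless mM loopless (subsetP PE _ lP)).
by rewrite rk_sub // sub1set.
Qed.

(* P is the parallel class of i, without i. *)
Let rank1_spanning G : is_flat Mdel G -> r G = 1%N -> q G -> G = P.
Proof.
move=> fG rG qG; have fiG := mdelete_flat_cl mM fG qG.
have GE : G \subset E := subset_trans (flat_subE fG) (subD1set _ _).
have : mcl M [set i] = i |: G.
  apply: (flat_eq mM); first exact: mcl_flat.
  - by apply: (mcl_min mM) fiG; apply: subsetUl.
  - exact: setU1_subE.
  by move: qG; rewrite inE iE rk_mcl // r1 => /eqP ->; rewrite rG.
rewrite loops_mcontract => ->; rewrite setU1K //.
by apply/negP => /(subsetP (flat_subE fG)); rewrite !inE eqxx.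
Qed.

Let flat_setU1_0 : is_flat M (i |: set0) = (P == set0).
Proof.
rewrite setU0; apply/idP/eqP => [f1|P0].
  by rewrite loops_mcontract (flat_mcl mM f1) setDv.
by have := mcl_flat mM i1E; rewrite Pmcl P0 setU0.
Qed.

Let contract_chainP c : is_chain_of_flats Mdel c && contract_chain M i c =
  (P == set0) && is_chain_of_flats Mcon c.
Proof.
apply/andP/andP => [[cc /'forall_implyP h]|[P0 cc]].
  split; first by rewrite -flat_setU1_0 h // in_setU1 eqxx.
  apply: is_chainP => [G Gc|G G' Gc G'c]; last exact: chain_total cc Gc G'c.
  split; [|exact: chain_neq0 cc Gc|exact: chain_neqE cc Gc].
  rewrite mcontract_flatE // h ?in_setU1 ?Gc ?orbT // andbT.
  exact: (flat_subE (chain_flat cc Gc)).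
split.
  apply: is_chainP => [G Gc|G G' Gc G'c]; last exact: chain_total cc Gc G'c.
  split; [|exact: chain_neq0 cc Gc|exact: chain_neqE cc Gc].
  by apply: (mcontract_flat_mdelete mM iE); apply: chain_flat cc Gc.
apply/'forall_implyP => G; rewrite in_setU1 => /orP[/eqP->|Gc]; first by rewrite flat_setU1_0.
by have := chain_flat cc Gc; rewrite mcontract_flatE // => /andP[].
Qed.

Notation K := (mdelete Mcon P).

(** When nonempty, the loops [P] of M / i span [i] in M, so the flats of M / i are the flats of M \
    i containing [P]. *)
Let K_flatE A : P != set0 -> is_flat K A = (A \subset B :\: P) && is_flat Mdel (A :|: P).
Proof.
move=> P0; rewrite mdelete_loops_flat //; apply: andb_id2l => AB.
have APB : A :|: P \subset B by rewrite subUset PB andbT (subset_trans AB) // subsetDl.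
apply/idP/idP => [|fAP]; first exact: mcontract_flat_mdelete.
rewrite mcontract_flatE // APB; apply: mdelete_flat_cl => //.
apply: subsetP (qP P0); apply: mcl_mono => //; first exact: subsetUr.
exact: subset_trans APB (subD1set _ _).
Qed.

Let quotients_aboveE c' : P != set0 -> j \notin P ->
  (c' \in quotients_above Mdel P) = is_chain_of_flats K c'.
Proof.
move=> P0 jP; apply/imsetP/idP => [[c]|cc'].
  rewrite !in_set => /andP[cc Pc] ->.
  have qb := chain_quotient_bchain P (chain_of_flats_bchain cc).
  apply: is_chainP => [F Fq|]; last exact: bchain_total qb.
  have [FB F0 FnB] := bchain_mem qb Fq; split=> //.
  rewrite K_flatE // FB; have /chain_quotientP[H [Hc PH ->]] := Fq.
  have -> : H :\: P :|: P = H.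
    by rewrite -[RHS](setID H P) (setIidPr (proper_sub PH)) setUC.
  exact: chain_flat cc Hc.
have dP F : F \in c' -> (F :|: P) :\: P = F.
  move=> Fc; have : F \subset B :\: P := flat_subE (chain_flat cc' Fc).
  by rewrite subsetD => /andP[_ /setDidPl]; rewrite setDUl setDv setU0.
have PF F : F \in c' -> P \proper F :|: P.
  move=> Fc; rewrite properE subsetUr /=; apply: contra (chain_neq0 cc' Fc) => s.
  by rewrite -(dP _ Fc) setD_eq0.
(* Put [P] back into every member, and [P] itself at the bottom of the chain. *)
exists (P |: [set F :|: P | F in c']).
  rewrite in_set; apply/andP; split; last exact: setU11.
  rewrite in_set; apply: is_chainP => [F|F F'].
    rewrite in_setU1 => /orP[/eqP->|/imsetP[F' F'c ->]].
      by split=> //; apply: contraNneq jP => ->.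
    have := chain_flat cc' F'c; rewrite K_flatE // => /andP[_ ->]; split=> //.
      by apply: contra P0; rewrite setU_eq0 => /andP[].
    apply: contra (chain_neqE cc' F'c) => /eqP e.
    by rewrite -(dP _ F'c) e.
  rewrite !in_setU1 => /orP[/eqP->|/imsetP[G Gc ->]] /orP[/eqP->|/imsetP[G' G'c ->]].
  - by rewrite subxx.
  - by rewrite subsetUr.
  - by rewrite subsetUr orbT.
  - by case/orP: (chain_total cc' Gc G'c) => s; rewrite (setSU _ s) ?orbT.
apply/setP => F; apply/idP/chain_quotientP => [Fc|[H []]].
  exists (F :|: P); rewrite dP // PF //; split=> //.
  by rewrite in_setU1; apply/orP; right; apply/imsetP; exists F.
rewrite in_setU1 => /orP[/eqP->|/imsetP[F' F'c ->] _ ->]; first by rewrite properE subxx.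
by rewrite dP.
Qed.

(* B(M' / i) for a matroid M' whose deletion by its set of loops L is M. *)
Definition contraction_fan : tcomplex R N := fun J =>
  if (J == P :|: L) && (j \notin P) then loopless_fan K j else wzero.

Notation psiS := (psi_sum j AA).
Notation psiC := (psi_cosum j AA).
Notation psi := (psi_min j AA).

(** A rank one flat contains no smaller nonempty flat, so only the term [A] = [G] of the sum can be
    nonzero. *)
Let psiS_rk1 G : is_flat Mdel G -> r G = 1%N -> j \notin G -> psiS G = - (q G)%:R.
Proof.
move=> fG rG jG; rewrite /psi_sum (negbTE jG).
have AG A : A \in AA -> A \subset G -> A = G.
  rewrite in_set => /andP[fA qA] s; apply: (flat_eq mD fA s); first exact: (flat_subE fG).
  rewrite /= rG; rewrite -(rk_set0 mM); apply: (flat_lt mD l0); last exact: (flat_subE fA).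
  rewrite properE sub0set subset0 /=; apply: contraTneq qA => ->.
  by rewrite inE setU0 (rk_set0 mM) r1 andbF.
have [qG|qG] := boolP (q G).
  have GA : G \in AA by rewrite in_set fG.
  rewrite (bigD1 G GA) //= subxx big1 ?addr0 ?sub0r // => A /andP[AAA AneG].
  have -> : (A \subset G) = false by apply: contraNF AneG => /(AG _ AAA) ->.
  by rewrite subrr.
rewrite big1 ?oppr0 // => A AAA.
have -> : (A \subset G) = false; last by rewrite subrr.
apply: contraNF qG => /(AG _ AAA) <-; by move: AAA; rewrite in_set => /andP[].
Qed.

Let psiC_rk1 G : is_flat Mdel G -> r G = 1%N -> j \notin G -> psiC G = 0.
Proof.
move=> fG rG jG; rewrite /psi_cosum psiS_rk1 // psi_minE // (negbTE jG).
by rewrite sub0r subrr.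
Qed.

Let AAB : forall A, A \in AA -> A \subset B /\ A != set0 := @spanning_flatsB N M mM loopless i iE.
Let AA0 : AA != set0 := spanning_flats_neq0 mM iE i_notcoloop.

Let suppS := @sum_poly_supp N B j AA AAB.
Let suppC := @cosum_poly_supp N B j AA AAB.
Let coneS c (a : {set 'I_N} -> R) cc a0 := @sum_poly_cone R N B j jB AA AAB c cc a a0.
Let coneC c (a : {set 'I_N} -> R) cc a0 := @cosum_poly_cone R N B j jB AA AA0 AAB c cc a a0.
Let avoidS := @sum_poly_avoid N B j AA AAB.
Let avoidC := @cosum_poly_avoid N B j jB AA AA0 AAB.

Let rk1S G : is_flat Mdel G -> rk Mdel G = 1%N -> j \notin G -> -1 <= psiS G.
Proof. by move=> fG rG jG; rewrite psiS_rk1 //; case: (q G). Qed.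

Let rk1C G : is_flat Mdel G -> rk Mdel G = 1%N -> j \notin G -> -1 <= psiC G.
Proof. by move=> fG rG jG; rewrite psiC_rk1. Qed.

Notation S := (B :\ j :|: L).
Notation f := (@tpoly R N (sum_poly j AA)).
Notation g := (@tpoly R N (cosum_poly j AA)).
Notation Df := (@divisor_tcomplex R N Mdel j i k L psiS).
Notation Dg := (@divisor_tcomplex R N Mdel j i k L psiC).

Let contraction_fan_mult J x : J = P :|: L -> j \notin P -> (0 < k)%N ->
  generic (k%:Z - 1) (contraction_fan J) x ->
  mult (k%:Z - 1) (contraction_fan J) x =
  ([&& `[< realspace (B :\: P :\ j) x >], is_chain_of_flats K (sublevels (B :\: P) x) &
     #|sublevels (B :\: P) x|.+1 == k])%:R.
Proof.
move=> eJ jP k0; have kE : k%:Z - 1 = k.-1%:Z by move: k0; clear; lia.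
rewrite /contraction_fan eJ eqxx jP /= kE => gx.
have jK : j \in ground K by rewrite /= inE jP.
rewrite (braid_mult jK (@chains_of_flats_bchain N K) (@sub_chains_of_flats N K)
  (@loopless_fan_cells R N K j jK) gx).
have -> : (#|sublevels (ground K) x| == k.-1) = (#|sublevels (ground K) x|.+1 == k).
  by rewrite -eqSS prednK.
by rewrite in_set; case: ifP.
Qed.

Lemma contraction_difference : is_difference (k%:Z - 1) S Df Dg contraction_fan.
Proof.
move=> J x JS gD gf gg.
have [k0|k0] := posnP k.
  have k1 : k%:Z - 1 < 0 by rewrite k0.
  by rewrite !(mult_dim_lt0 _ _ k1) subrr.
have [LJ|LJ] := boolP (L \subset J); last first.
  rewrite [X in _ = X - _](divisor_tcomplex_notsub _ _ _ iL) //.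
  rewrite [X in _ = _ - X](divisor_tcomplex_notsub _ _ _ iL) // subrr.
  rewrite /contraction_fan; case: ifP => [/andP[/eqP eJ _]|_].
    by rewrite eJ subsetUr in LJ.
  by apply: fsbig1 => Q [[[]]].
have [G GB eJ] : exists2 G : {set 'I_N}, G \subset B :\ j & J = G :|: L.
  exists (J :\: L); last by rewrite setUC -[LHS](setID J L) (setIidPr LJ).
  apply/subsetP => l /setDP[lJ lL]; have := subsetP JS _ lJ.
  by rewrite in_setU (negbTE lL) orbF.
have PL : [disjoint P & L] by rewrite disjoint_sym; apply: disjointWr LB; exact: PB.
have GL : [disjoint G & L].
  rewrite disjoint_sym; apply: disjointWr LB.
  exact: subset_trans GB (subD1set _ _).
have GP : (J == P :|: L) = (G == P).
  rewrite eJ; apply/eqP/eqP => [e|->//].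
  have := congr1 (fun T => T :\: L) e; rewrite !setDUl setDv !setU0.
  by rewrite (setDidPl GL) (setDidPl PL).
move: gf gg; rewrite eJ !(divisor_tcomplexE iB _ iL) // => gf gg.
have [G0|G0] := eqVneq G set0.
  rewrite [X in _ = X - _](infinity_mult0 mD l0 jB iB rB iL LB suppS coneS avoidS GB G0 gf).
  rewrite [X in _ = _ - X](infinity_mult0 mD l0 jB iB rB iL LB suppC coneC avoidC GB G0 gg).
  set s := sublevels _ x.
  have dfct : is_chain_of_flats Mdel s -> #|s|.+1 = k ->
      defect Mdel j psiS s - defect Mdel j psiC s = (contract_chain M i s)%:R.
    move=> sc sk; rewrite -(defect_min (R := R) mM loopless iE jE ji i_notcoloop rE sc sk).
    by apply: defectB => F; rewrite /psi_cosum subKr.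
  have eJ0 : G :|: L = L by rewrite G0 set0U.
  (* If M / i has new loops, its fan has no part in this stratum; correspondingly [i |: set0] is not
     flat and the difference of the defects is 0. *)
  have [P0|P0] := eqVneq P set0; last first.
    rewrite /contraction_fan -eJ GP G0 eq_sym (negbTE P0) /=.
    rewrite [LHS]fsbig1; last by move=> Q [[[]]].
    case: ifP => [/and3P[_ sc /eqP sk]|_]; last by rewrite subrr.
    rewrite dfct //; have := contract_chainP s; rewrite sc (negbTE P0) /= => ->.
    by [].
  have jP : j \notin P by rewrite P0 inE.
  rewrite -eJ in gD *; rewrite (contraction_fan_mult _ jP k0 gD); last first.
    by apply/eqP; rewrite GP G0 P0.
  have KE : is_chain_of_flats K =1 is_chain_of_flats Mcon.
    by move=> c; rewrite P0 /mdelete setD0.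
  rewrite KE P0 setD0 -/s; case: asboolP => _ //=.
  have := contract_chainP s; rewrite P0 eqxx /= => <-.
  case sc : is_chain_of_flats; last by rewrite subrr.
  case: eqP => [sk|_]; last by rewrite andbF subrr.
  by rewrite dfct // andbT.
rewrite [X in _ = X - _](infinity_mult mD l0 jB iB rB iL LB suppS coneS avoidS rk1S GB G0 gf).
rewrite [X in _ = _ - X](infinity_mult mD l0 jB iB rB iL LB suppC coneC avoidC rk1C GB G0 gg).
set s := sublevels _ x.
have jG : j \notin G by apply/negP => /(subsetP GB); rewrite !inE eqxx.
have rk1 : #|s|.+1 = k -> s \in quotients_above Mdel G -> is_flat Mdel G /\ r G = 1%N.
  move=> sk /imsetP[c]; rewrite in_set => /andP[]; rewrite in_set => cc Gc es.
  split; first exact: chain_flat cc Gc.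
  by apply: (quotient_rk1 mD l0 rB cc Gc); rewrite -es.
have -> : [&& `[< realspace (ground Mdel :\: G :\ j) x >], psiC G < 0, #|s|.+1 == k
    & s \in quotients_above Mdel G] = false.
  apply/negP => /and4P[_ + /eqP sk sq]; have [fG rG] := rk1 sk sq.
  by rewrite psiC_rk1 // ltxx.
rewrite subr0; have [eGP|nGP] := eqVneq G P; last first.
  rewrite /contraction_fan -eJ GP (negbTE nGP) /= [LHS]fsbig1; last by move=> Q [[[]]].
  case: ifP => // /and4P[_ + /eqP sk sq]; have [fG rG] := rk1 sk sq.
  rewrite psiS_rk1 // oppr_lt0; have [qG|//] := boolP (q G).
  by move: nGP; rewrite (rank1_spanning fG rG qG) eqxx.
have P0 : P != set0 by rewrite -eGP.
have jP : j \notin P by rewrite -eGP.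
rewrite -eJ in gD *; rewrite (contraction_fan_mult _ jP k0 gD); last first.
  by apply/eqP; rewrite GP eGP.
rewrite /s eGP -quotients_aboveE // -eGP -/s.
case: asboolP => _ //=; rewrite andbC.
case: (eqVneq #|s|.+1 k) => [sk|_] /=; last by rewrite andbF.
case: (boolP (s \in _)) => [sq|_]; last by rewrite andbF.
have [fG rG] := rk1 sk sq; rewrite psiS_rk1 // oppr_lt0 eGP qP //.
Qed.

Lemma fan_sed_finite c (a : {set 'I_N} -> R) : is_chain_of_flats Mdel c ->
  (forall F, F \in c -> 0 <= a F) ->
  let x := \sum_(F in c) a F *: int_vec (cv B j F) in
  [/\ f (sed L x) \is a fin_num, g (sed L x) \is a fin_num &
      rational_on f g L x = \sum_(F in c) a F * (psi F)%:~R].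
Proof.
move=> cc a0 x; rewrite /rational_on (tpoly_cone LB suppS coneS cc a0).
rewrite (tpoly_cone LB suppC coneC cc a0) /=; split=> //.
rewrite -sumrB; apply: eq_bigr => F _; rewrite -mulrBr -intrB.
by rewrite /psi_cosum subKr.
Qed.

Lemma extension_modification : i \notin S ->
  [/\ is_regular S f, is_regular S g & exists x : 'rV[R]_N, g (sed set0 x) != -oo%E] /\
  is_modification k%:Z S i f g (fan_tcomplex L (@loopless_fan R N Mdel j))
    (fan_tcomplex L (@loopless_fan R N M j)) /\
  is_divisor k%:Z S i f g (fan_tcomplex L (@loopless_fan R N Mdel j)) contraction_fan.
Proof.
move=> iS; split; last split.
- split.
  + by apply: tpoly_regular => m l mp lS; apply: suppS mp _; apply: contra lS; rewrite in_setU => ->.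
  + by apply: tpoly_regular => m l mp lS; apply: suppC mp _; apply: contra lS; rewrite in_setU => ->.
  have c0 : bchain B set0 by apply/bchainP; split=> [F|F G]; rewrite inE.
  have [m [mp _ mmax]] := coneC (a := fun=> 0) c0 (fun _ _ => lexx _).
  (* The point of the cone of the empty chain is the origin, where g is finite. *)
  exists (\sum_(F in (set0 : {set {set 'I_N}})) 0 *: int_vec (cv B j F)).
  by rewrite (tpoly_sed _ mp mmax) // => m' l _; rewrite inE.
(* The fan is its own subdivision, f - g being linear on each of its cones. *)
- exists (fan_tcomplex L (loopless_fan Mdel j)),
    (fan_tcomplex L (@completed_graph R N Mdel j i k psi)); split.
  + exact: (fan_tcycle mD l0 jB rB LB).
  + by [].
  + exact: (fan_modification mD l0 jB iB rB fan_sed_finite).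
  move=> I _; rewrite /fan_tcomplex; case: eqP => // _.
  exact: same_cycle_extension.
exists Df, Dg; split.
- exact: (tpoly_divisor mD l0 jB iB rB iL LB suppS coneS avoidS).
- exact: (tpoly_divisor mD l0 jB iB rB iL LB suppC coneC avoidC).
- exact: contraction_difference.
Qed.

End ContractionFan.

(** * Reduction to the loopless case *)

(** Covers the charts with j a loop of M: there all three Bergman fans are empty. *)
Lemma wzero_modification (R : realType) N k (S : {set 'I_N}) i :
  elementary_modification k S i (fun=> wzero) (fun=> wzero) (fun=> @wzero R N).
Proof.
have reg0 : is_regular S (cst 0%E : 'rV[\bar R]_N -> \bar R).
  exists [:: (0%R, 0%R)]; split=> [c l|x]; first by rewrite inE => /eqP-> _; rewrite mxE.
  by rewrite big_seq1 add0e big1 // => l _; rewrite mxE mule0n.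
have mod0 : is_modification_complex k S i (cst 0%E) (cst 0%E) (fun=> wzero) (fun=> @wzero R N).
  by move=> I; case: ifP => // _; split=> //; apply: wzero_completed_graph.
have div0 : is_divisor_regular k S i (cst 0%E) (fun=> wzero) (fun=> @wzero R N).
  exists (fun=> wzero), (fun=> wzero), (fun=> wzero); split; split=> //.
  - exact: wzero_tcycle.
  - split.
    + by move=> I; case: ifP => // _; case: (@wzero_cycle R N 0%R ((i |: S) :\: I)).
    + by move=> I _ _; apply: hyp_intersect_wzero_tcomplex.
    move=> J x _ _ _; rewrite mult_wzero // big1 // => I _.
    exact/mult_wzero/hyp_intersect_wzero.
  - by move=> I; case: ifP => // _; case: (@wzero_cycle R N 0%R (S :\: I)).
  by move=> I _ x _ _; rewrite !mult_wzero //; rewrite /project; case: ifP.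
split; first by split; apply: wzero_tcycle.
exists (cst 0%E), (cst 0%E); split; first by split=> //; exists 0%R.
split; last by left.
- by exists (fun=> wzero), (fun=> wzero); split=> //; apply: wzero_tcycle.
exists (fun=> wzero), (fun=> wzero); split=> // J x _ _ _ _.
by rewrite mult_wzero // subrr.
Qed.

Lemma loops_mdelete N (M : rankdata N) D : is_matroid M -> loops (mdelete M D) = loops M :\: D.
Proof.
move=> mM; apply/setP => l; rewrite !inE !loopE //; last exact: matroid_mdelete.
by rewrite /= !inE -andbA.
Qed.

Section Bergman.
Context {R : realType} {N : nat} (M : rankdata N) (mM : is_matroid M).
Notation E := (ground M).
Notation L := (loops M).

Lemma mem_loops_mcontract i l : i \in E -> (l \in loops (mcontract M i)) =
  (l \in E :\ i) && (rk M [set i; l] == rk M [set i]).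
Proof.
move=> iE; rewrite inE loopE; last exact: matroid_mcontract.
rewrite /=; case: (boolP (l \in E :\ i)) => //= lEi; rewrite subn_eq0 eqn_leq andb_idr // => _.
apply: (rk_sub mM); first exact: subsetUl.
by rewrite subUset !sub1set iE; case/setD1P: lEi.
Qed.

Lemma loops_sub_mcontract i : i \in E -> i \notin L -> L \subset loops (mcontract M i).
Proof.
move=> iE iL; apply/subsetP => l lL; rewrite mem_loops_mcontract //.
have lE := subsetP (loops_subE M) l lL.
have il : l != i by apply: contraNneq iL => <-.
rewrite !inE il lE /=; move: lL; rewrite inE loopE // => /andP[_ /eqP l0].
have i1 : [set i] \subset E by rewrite sub1set.
have l1 : [set l] \subset E by rewrite sub1set.
rewrite eqn_leq; apply/andP; split; last by apply: (rk_sub mM); rewrite ?subsetUl // subUset i1.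
have [_ _ sm] := mM; have := sm _ _ i1 l1; rewrite l0 addn0; apply: leq_trans.
exact: leq_addr.
Qed.

Lemma bergman_fan_tcomplex j : j \notin L ->
  bergman R M j = fan_tcomplex L (loopless_fan (mdelete M L) j).
Proof. by move=> jL; apply/funext => I; rewrite /bergman /fan_tcomplex jL andbT. Qed.

End Bergman.

(** * Matroids with loops *)

Section Deletion.
Context {R : realType} {N : nat} (M : rankdata N) (mM : is_matroid M).
Context (i j : 'I_N) (iE : i \in ground M) (jE : j \in ground M) (ji : j != i).
Context (k : nat) (rE : rk M (ground M) = k.+1).
Context (i_notloop : i \notin loops M) (i_notcoloop : ~~ is_coloop M i).
Notation E := (ground M).
Notation L := (loops M).
Notation M' := (mdelete M (loops M)).
Notation S := (E :\ i :\ j).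

Let mM' : is_matroid M' := matroid_mdelete _ mM.
Let iE' : i \in ground M'. Proof. by rewrite in_setD i_notloop. Qed.

Lemma loops_mdelete1 : loops (mdelete M [set i]) = L.
Proof. by rewrite loops_mdelete //; apply/setDidPl; rewrite disjoint_sym disjoints1. Qed.

Lemma mdeleteAC (D D' : {set 'I_N}) : mdelete (mdelete M D) D' = mdelete (mdelete M D') D.
Proof. by rewrite /mdelete /= setDDl setUC -setDDl. Qed.

Lemma bergman_mdelete : j \notin L ->
  bergman R (mdelete M [set i]) j = fan_tcomplex L (loopless_fan (mdelete M' [set i]) j).
Proof.
by move=> jL; rewrite bergman_fan_tcomplex loops_mdelete1 // mdeleteAC.
Qed.

(** Splits the loops of M / i into the elements parallel to [i] and the loops of M. *)
Lemma loops_mcontractE : loops (mcontract M i) = loops (mcontract M' i) :|: L.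
Proof.
apply/setP => l; rewrite in_setU (mem_loops_mcontract mM' _ iE') /=.
have [lL|lL] := boolP (l \in L).
  by rewrite orbT; apply: (subsetP (loops_sub_mcontract mM iE i_notloop)).
by rewrite orbF mem_loops_mcontract // !in_setD1 in_setD lL.
Qed.

Lemma bergman_mcontract : j \notin L -> bergman R (mcontract M i) j = contraction_fan M' i j L.
Proof.
move=> jL; apply/funext => I; rewrite /bergman /contraction_fan loops_mcontractE.
rewrite in_setU (negbTE jL) orbF; case: ifP => // _; congr (loopless_fan _ j).
rewrite /mdelete /mcontract /=; congr RankData; apply/setP => l.
rewrite !in_setD !in_setU !in_set1.
by case: (l \in L); case: (l \in E); rewrite ?andbF ?orbT ?orbF ?andbT.
Qed.

Lemma bergman_modification :
  elementary_modification k%:Z S i (bergman R M j) (bergman R (mdelete M [set i]) j)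
    (bergman R (mcontract M i) j).
Proof.
have iS : i |: S = E :\ j.
  apply/setP => l; rewrite !inE; have [->|] := eqVneq l i; last by rewrite andTb.
  by rewrite iE eq_sym ji.
have jEi : j \in E :\ i by rewrite !inE ji.
have rEi : rk M (E :\ i) = k.+1 by rewrite notcoloop_rk.
have [jL|jL] := boolP (j \in L).
  rewrite !bergman_loop //.
  - by apply: wzero_modification.
  - exact: (subsetP (loops_sub_mcontract mM iE i_notloop)).
  - by rewrite loops_mdelete1.
have ri : rk M [set i] = 1%N.
  have : rk M [set i] != 0 by move: i_notloop; rewrite inE loopE // iE.
  have := rk_le_card mM (_ : [set i] \subset E); rewrite sub1set cards1 iE => /(_ isT).
  by case: (rk M [set i]) => [|[]].
split.
  split; [exact: (bergman_cycle (matroid_mdelete _ mM)) | by rewrite iS; apply: bergman_cycle |].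
  have mC := matroid_mcontract mM iE.
  have rC : rk (mcontract M i) (E :\ i) = k by rewrite /= setD1K // ri rE subn1.
  (* For [k] = 0 the contraction has rank 0, so j is one of its loops and the cycle of dimension -1
     is empty. *)
  case: (posnP k) => [k0|k0]; last first.
    have kE : (k%:Z - 1 = k.-1%:Z)%R by move: k0; clear; lia.
    by rewrite kE; apply: (bergman_cycle mC jEi); rewrite prednK.
  rewrite bergman_loop; first exact: wzero_tcycle.
  rewrite inE loopE // jEi /= -leqn0 -[X in _ <= X]k0 -[X in _ <= X]rC.
  by apply: (rk_sub mC); rewrite ?sub1set.
have SE : ground M' :\ i :\ j :|: L = S.
  apply/setP => l; rewrite in_setU !in_setD !in_set1.
  case: (boolP (l \in L)) => lL; rewrite ?orbT ?orbF //=.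
  have -> : l != j by apply: contraNneq jL => <-.
  have -> : l != i by apply: contraNneq i_notloop => <-.
  by rewrite (subsetP (loops_subE M)).
have LD : [disjoint L & ground (mdelete M' [set i])].
  rewrite disjoints_subset; apply/subsetP => l lL.
  by rewrite in_setC !in_setD lL !andbF.
have jE' : j \in ground M' by rewrite in_setD jL.
have rE' : rk M' (ground M') = k.+1 by rewrite /= rk_ground_noloops.
have rB' : rk M' (ground M' :\ i) = rk M' (ground M').
  rewrite rE' /= -rEi -(rk_ground_noloops (matroid_mdelete [set i] mM)) loops_mdelete1 /=.
  by rewrite !setDDl setUC.
have iS' : i \notin ground M' :\ i :\ j :|: L.
  by rewrite in_setU !in_setD1 eqxx andbF.
have [reg [mod div]] := extension_modification (R := R) mM' (loopless_mdelete mM)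
  iE' jE' ji rB' rE' i_notloop LD iS'.
rewrite bergman_mdelete // bergman_fan_tcomplex // bergman_mcontract //.
(* Effectivity, not g = 0, is the alternative of the definition that applies to this pair. *)
exists (tpoly (sum_poly j (spanning_flats M' i))), (tpoly (cosum_poly j (spanning_flats M' i))).
rewrite SE in reg mod div; split=> //; split=> //; right.
rewrite -bergman_mdelete // -bergman_mcontract //.
by split; apply: bergman_effective.
Qed.

End Deletion.

Local Open Scope ring_scope.

Theorem proposition2p22 (R : realType) (n k : nat) (M : rankdata n.+1)
    (i : 'I_n.+1) (M_matroid : is_matroid M)
    (M_ground : ground M = [set: 'I_n.+1]%SET)
    (M_rank : rk M (ground M) = k.+1)
    (i_notloop : ~~ is_loop M i) (i_notcoloop : ~~ is_coloop M i)
    (j : 'I_n.+1) (j_neq_i : j != i) :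
  elementary_modification k%:Z (ground M :\ i :\ j)%SET i
    (bergman R M j)
    (bergman R (mdelete M [set i]%SET) j)
    (bergman R (mcontract M i) j).
Proof.
have inE' l : l \in ground M by rewrite M_ground finset.in_setT.
by apply: bergman_modification => //; rewrite finset.inE.
Qed.
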